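(* Let $\mathcal{B}=(B_t)_{t\in G}$ be a Fell bundle over a discrete group $G$, and let $\hat\alpha$ be the partial action on $\widehat{B_e}$ associated with $\mathcal{B}$. Then the map $J\mapsto X_J=\{\pi\in\widehat{B_e}:\pi|_J\neq0\}$ is an isomorphism from the lattice of $\mathcal{B}$-invariant ideals in $B_e$ to the lattice of open $\hat\alpha$-invariant sets in $\widehat{B_e}$.
   Context: Ideals of $C^*$-algebras are closed and two-sided. For subsets $X_i\subseteq B_{t_i}$ of fibers, $X_1\cdots X_n$ denotes the closed linear span of the products $x_1\cdots x_n$ with $x_i\in X_i$; $X^*=\{x^*:x\in X\}$. An ideal $I$ in $B_e$ is $\mathcal{B}$-invariant if $B_tIB_t^*\subseteq I$ for all $t\in G$. $D_t=B_tB_t^*$ is a closed two-sided ideal of $B_e$. $\widehat{B_e}$ is the spectrum of $B_e$ (unitary equivalence classes of irreducible representations, usual topology induced from the hull-kernel topology), and $X_t=X_{D_t}=\{\pi\in\widehat{B_e}:\pi|_{D_t}\neq0\}$. The partial action $\hat\alpha$ associated with $\mathcal{B}$ consists of the homeomorphisms $\hat\alpha_t:X_{t^{-1}}\to X_t$ between open subsets of $\widehat{B_e}$ where, for $\pi\in X_{t^{-1}}$ acting on $H_\pi$, $\hat\alpha_t(\pi)$ is (the class of) the representation of $B_e$ on $B_t\otimes_{D_{t^{-1}}}H_\pi$ (completion of the algebraic tensor product for $\langle b\otimes h,c\otimes k\rangle=\langle\pi(c^*b)h,k\rangle$) given by $\hat\alpha_t(\pi)(a)(b\otimes h)=ab\otimes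 h$. If $\alpha$ is a partial action of $G$ on a set $X$, a subset $S\subseteq X$ is $\alpha$-invariant if $\alpha_t(S\cap\mathrm{dom}\,\alpha_t)=S\cap\mathrm{dom}\,\alpha_{t^{-1}}$ for all $t\in G$. *)

(* Defs.v *)
From HB Require Import structures.
From mathcomp Require Import all_boot all_order all_algebra complex.
From mathcomp Require Import boolp classical_sets reals topology.
From mathcomp Require Import normedtype.

Set Implicit Arguments.
Unset Strict Implicit.
Unset Printing Implicit Defensive.

Import Order.TTheory GRing.Theory Num.Theory.
Import numFieldNormedType.Exports.

Local Open Scope classical_set_scope.
Local Open Scope ring_scope.

(* Subsets of the spectrum are written spectrum -> Prop below, not with set: the
   spectrum is too large for the universe of [set]. The notions of this section
   apply to both. *)
Section LatticeOfSets.
Variable T : Type.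
Implicit Types (L : (T -> Prop) -> Prop) (A B S : T -> Prop).

Definition included A B := forall x, A x -> B x.

Definition is_meet L A B S :=
  [/\ L S, included S A, included S B &
      forall S', L S' -> included S' A -> included S' B -> included S' S].

Definition is_join L A B S :=
  [/\ L S, included A S, included B S &
      forall S', L S' -> included A S' -> included B S' -> included S S'].

Definition is_lattice L :=
  forall A B, L A -> L B ->
    (exists S, is_meet L A B S) /\ (exists S, is_join L A B S).

End LatticeOfSets.

Record lattice_isomorphism (T U : Type)
    (L : (T -> Prop) -> Prop) (M : (U -> Prop) -> Prop)
    (f : (T -> Prop) -> (U -> Prop)) : Prop := LatticeIsomorphism {
  iso_dom : is_lattice L;
  iso_cod : is_lattice M;
  iso_fun : forall A, L A -> M (f A);
  iso_inj : forall A B, L A -> L B -> f A = f B -> A = B;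
  iso_surj : forall C, M C -> exists2 A, L A & f A = C;
  iso_meet : forall A B S, L A -> L B ->
    is_meet L A B S -> is_meet M (f A) (f B) (f S);
  iso_join : forall A B S, L A -> L B ->
    is_join L A B S -> is_join M (f A) (f B) (f S) }.

(* A partial action alpha of G on T is given by the graphs of the partial maps
   alpha_t, together with their domains. *)
Definition partial_action_invariant (G : groupType) (T : Type)
    (dom : G -> T -> Prop) (alpha : G -> T -> T -> Prop) (S : T -> Prop) :=
  forall (t : G) (y : T),
    (exists x, [/\ S x, dom t x & alpha t x y]) <-> S y /\ dom t^-1%g y.

Section Banach.
Variables (R : realType) (V : normedModType R[i]).
Implicit Types M A : set V.

Definition subspace M :=
  M 0 /\ forall (a : R[i]) x y, M x -> M y -> M (a *: x + y).

Definition closed_span A : set V := closure (smallest subspace A).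

End Banach.

(* The inner product is linear in its first argument. *)
Record hilbert (R : realType) := Hilbert {
  hilbert_sort :> completeNormedModType R[i];
  hdot : {dot hilbert_sort for Num.conj};
  hdot_norm : forall h : hilbert_sort, `|h| ^+ 2 = hdot h h }.

(* To avoid transports between equal fibers, the product takes values in B_r
   for any r with a proof of s t = r, and the involution in B_r for any r with
   a proof of s^-1 = r. *)
Record fell_bundle (R : realType) (G : groupType) := FellBundle {
  fiber :> G -> completeNormedModType R[i];
  fmul : forall s t r : G, (s * t)%g = r ->
    {bilinear fiber s -> fiber t -> fiber r};
  fstar : forall s r : G, (s^-1)%g = r ->
    {linear fiber s -> fiber r | Num.conj \; *:%R};
  fmulA : forall (s t u st tu r : G)
    (h1 : (s * t)%g = st) (h2 : (st * u)%g = r)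
    (h3 : (t * u)%g = tu) (h4 : (s * tu)%g = r)
    (a : fiber s) (b : fiber t) (c : fiber u),
    fmul h2 (fmul h1 a b) c = fmul h4 a (fmul h3 b c);
  fmul_norm : forall (s t r : G) (h : (s * t)%g = r)
    (a : fiber s) (b : fiber t), `|fmul h a b| <= `|a| * `|b|;
  fstarK : forall (s r : G) (h : (s^-1)%g = r) (h' : (r^-1)%g = s)
    (a : fiber s), fstar h' (fstar h a) = a;
  fstarM : forall (s t r s' t' r' : G) (h : (s * t)%g = r)
    (hs : (s^-1)%g = s') (ht : (t^-1)%g = t') (hr : (r^-1)%g = r')
    (h' : (t' * s')%g = r') (a : fiber s) (b : fiber t),
    fstar hr (fmul h a b) = fmul h' (fstar ht b) (fstar hs a);
  fstar_norm : forall (s r : G) (h : (s^-1)%g = r) (a : fiber s),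
    `|fstar h a| = `|a|;
  fmul_starl_norm : forall (s : G) (a : fiber s),
    `|fmul (mulVg s) (fstar erefl a) a| = `|a| ^+ 2;
  fmul_starl_pos : forall (s : G) (a : fiber s),
    exists c : fiber 1%g, fmul (mulVg s) (fstar erefl a) a
                        = fmul (mulg1 1%g) (fstar (invg1 G) c) c }.

Arguments fmul {R G f s t r} h.
Arguments fstar {R G f s r} h.

Section Spectrum.
Variables (R : realType) (G : groupType) (B : fell_bundle R G).

Local Notation Be := (B 1%g).

Definition emul (a b : Be) : Be := fmul (mulg1 1%g) a b.
Definition estar (a : Be) : Be := fstar (invg1 G) a.

Definition ideal (I : set Be) :=
  [/\ closed I, subspace I &
      forall a x : Be, I x -> I (emul a x) /\ I (emul x a)].

Definition invariant_ideal (I : set Be) :=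
  ideal I /\ forall t : G,
    closed_span [set x | exists (b c : B t) (i : Be), I i /\
      x = fmul (mulgV t) (fmul (mulg1 t) b i) (fstar erefl c)] `<=` I.

Definition Dideal (t : G) : set Be :=
  closed_span [set x | exists b c : B t,
    x = fmul (mulgV t) b (fstar erefl c)].

Record representation := Representation {
  rep_space : hilbert R;
  rep_op :> {bilinear Be -> rep_space -> rep_space};
  rep_bounded : forall a : Be, continuous (rep_op a);
  rep_mul : forall (a b : Be) (h : rep_space),
    rep_op (emul a b) h = rep_op a (rep_op b h);
  rep_star : forall (a : Be) (h k : rep_space),
    hdot rep_space (rep_op a h) k = hdot rep_space h (rep_op (estar a) k) }.

Definition restriction_nonzero (pi : representation) (J : set Be) :=
  exists a (h : rep_space pi), J a /\ pi a h != 0.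

Definition rep_ker (pi : representation) : set Be :=
  [set a | forall h : rep_space pi, pi a h = 0].

Definition irreducible (pi : representation) :=
  restriction_nonzero pi setT /\
  forall M : set (rep_space pi), closed M -> subspace M ->
    (forall (a : Be) h, M h -> M (pi a h)) -> M = [set 0] \/ M = setT.

Definition unitary_equiv (pi rho : representation) :=
  exists u : {linear rep_space pi -> rep_space rho},
    [/\ forall h k, hdot (rep_space rho) (u h) (u k) = hdot (rep_space pi) h k,
        forall k, exists h, u h = k &
        forall (a : Be) h, u (pi a h) = rho a (u h)].

(* The points are the unitary equivalence classes of irreducible
   representations. *)
Record spectrum := Spectrum {
  irrep_class :> representation -> Prop;
  irrep_classP : exists2 pi, irreducible pi &
    irrep_class = (fun rho => unitary_equiv pi rho) }.

Definition Xset (J : set Be) (x : spectrum) : Prop :=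
  exists2 pi, x pi & restriction_nonzero pi J.

Definition class_ker (x : spectrum) : set Be :=
  [set a | exists2 pi, x pi & rep_ker pi a].

Definition Prim : set (set Be) := [set P | exists x, P = class_ker x].

(* F is equal to its closure, the hull of its kernel. *)
Definition hull_kernel_closed (F : set (set Be)) :=
  F = [set P | Prim P /\ \bigcap_(Q in F) Q `<=` P].

Definition spectrum_open (U : spectrum -> Prop) :=
  exists2 F, hull_kernel_closed F & forall x, U x <-> ~ F (class_ker x).

(* rho is the representation a (b (x) h) = ab (x) h on the completion of the
   algebraic tensor product of B_t and H_pi over D_{t^-1}; the canonical map
   from the algebraic tensor product to its completion is given by the
   balanced bilinear map q b h = b (x) h. A Hilbert space is such a completion
   when the elementary tensors have the prescribed inner products and a dense
   span, which determines it up to a unique unitary fixing them. *)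
Definition is_induced (t : G) (pi rho : representation) :=
  exists q : {bilinear B t -> rep_space pi -> rep_space rho},
    [/\ forall (b : B t) (d : Be) h, Dideal t^-1%g d ->
          q (fmul (mulg1 t) b d) h = q b (pi d h),
        forall (b c : B t) h k,
          hdot (rep_space rho) (q b h) (q c k)
          = hdot (rep_space pi) (pi (fmul (mulVg t) (fstar erefl c) b) h) k,
        closed_span [set v | exists b h, v = q b h] = setT &
        forall (a : Be) (b : B t) h, rho a (q b h) = q (fmul (mul1g t) a b) h].

Definition hat_dom (t : G) : spectrum -> Prop := Xset (Dideal t^-1%g).

(* Graph of \hat\alpha_t : X_{t^-1} -> X_t. *)
Definition hat_alpha (t : G) (x y : spectrum) :=
  hat_dom t x /\ exists pi rho, [/\ x pi, y rho & is_induced t pi rho].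

Definition invariant_open (U : spectrum -> Prop) :=
  spectrum_open U /\ partial_action_invariant hat_dom hat_alpha U.

End Spectrum.

(* Main.v *)
Require Import Defs.
From HB Require Import structures.
From mathcomp Require Import all_boot all_order all_algebra complex.
From mathcomp Require Import boolp classical_sets functions reals topology.
From mathcomp Require Import normedtype sequences.
From mathcomp Require Import ring lra.
Import Defs.

(** The proof rests on one theorem and one formula.

    The theorem, [irreducible_separation]: an element outside a closed ideal [J]
    of a C*-algebra is not killed by some irreducible representation that
    vanishes on [J]. Hence [X_I] is contained in [X_J] only if [I] is contained
    in [J] ([Xset_le]). Every hull-kernel open set [O] is [X_J], with [J] the
    intersection of the kernels of the points outside [O]
    ([Xset_ideal_of_open]). So [J |-> X_J] is an order isomorphism from the
    ideals to the open sets, and as such it respects meets and joins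
    ([lattice_isomorphism_of_order]). What remains is that invariant ideals
    correspond to invariant open sets.

    The formula, [induced_kernel]: if [rho] is induced from [pi] along [B_t],
    then [rho a = 0] if and only if [pi] kills [B_t^* a B_t]. Together with the
    primeness of the kernels of irreducible representations
    ([irreducible_prime]) it shows that the partial homeomorphisms preserve
    [X_J] when [J] is invariant ([Xset_invariant]), and that the ideal of an
    invariant open set is invariant ([ideal_of_open_invariant]). Both arguments
    also need that an irreducible representation [rho] that is nonzero on [D_t]
    is induced along [B_t] from an irreducible one ([induced_exists]); the
    latter acts on [B_{t^-1} (x) rho], which is generated by the tensors with one
    suitable vector of [rho].

    For the theorem, the algebra is embedded in its unitization, a unital
    C*-algebra. Square roots come from the iteration [s -> (v + s^2) / 2], which
    gives that positive elements are squares, that the norm is monotone on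
    them, and that [x^*x] is positive ([pos_starM]). Approximate units then show
    that an element [b] for which [b^*b] is dominated modulo [J] by every [e > 0]
    is in [J] ([ideal_of_dominated]). So the gauge of the cone generated by the
    positive elements and [J] is positive at [b^*b] when [b] is outside [J]. An
    extreme linear functional below this gauge, obtained directly from Zorn's
    lemma ([extreme_exists]), is a pure state that vanishes on [J] and not at
    [b^*b] ([pure_state_exists]), and its GNS representation is irreducible
    ([gns_irreducible]).

    The Hilbert spaces needed, for the GNS construction and for induction, are
    completions of spaces with a positive semidefinite form
    ([completion_hilbert]). *)
Set Implicit Arguments.
Unset Strict Implicit.
Unset Printing Implicit Defensive.

Import Order.TTheory GRing.Theory Num.Theory.
Import numFieldNormedType.Exports.

Local Open Scope classical_set_scope.
Local Open Scope complex_scope.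
Local Open Scope ring_scope.

(** * Complex scalars *)

Section ComplexModulus.
Variable R : realType.
Implicit Types (z w : R[i]) (r : R).

(** The modulus [`|z|] is valued in the complex numbers, where
    only some pairs are comparable. *)
Definition cabs z : R := complex.Re `|z|.

Lemma cabsE z : (cabs z)%:C = `|z|.
Proof. by rewrite /cabs RRe_real ?normr_real. Qed.

Lemma cabs_ge0 z : 0 <= cabs z.
Proof. by rewrite -lecR cabsE normr_ge0. Qed.

Lemma cabsM z w : cabs (z * w) = cabs z * cabs w.
Proof. by apply: complexI; rewrite rmorphM /= !cabsE normrM. Qed.

Lemma cabsD z w : cabs (z + w) <= cabs z + cabs w.
Proof. by rewrite -lecR rmorphD /= !cabsE ler_normD. Qed.

Lemma cabsN z : cabs (- z) = cabs z.
Proof. by rewrite /cabs normrN. Qed.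

Lemma cabs0 : cabs 0 = 0.
Proof. by rewrite /cabs normr0. Qed.

Lemma cabs1 : cabs 1 = 1.
Proof. by rewrite /cabs normr1. Qed.

Lemma cabs0_eq0 z : cabs z = 0 -> z = 0.
Proof. by move=> z0; apply/eqP; rewrite -normr_eq0 -cabsE z0. Qed.

Lemma cabs_real r : cabs r%:C = `|r|.
Proof.
by rewrite /cabs normc_def /= expr0n /= addr0 sqrtr_sqr.
Qed.

Lemma cabs_i : cabs 'i = 1.
Proof. by rewrite /cabs normCi. Qed.

Lemma cabs_conj z : cabs z^* = cabs z.
Proof. by rewrite /cabs norm_conjC. Qed.

Lemma conjC_real r : (r%:C)^* = r%:C.
Proof. exact: conjc_real. Qed.

Lemma le_Re_cabs z : complex.Re z <= cabs z.
Proof.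
rewrite -lecR cabsE; apply: le_trans (normc_ge_Re z).
by rewrite lecR ler_norm.
Qed.

Lemma cabs2E z : (cabs z ^+ 2)%:C = z * z^*.
Proof. by rewrite rmorphXn /= cabsE -normCK. Qed.

End ComplexModulus.

(** * Real-valued norms and best constants *)

Section RealNorm.
Variable R : realType.

(** Real-valued, as [cabs] is. *)
Definition nr (V : normedZmodType R[i]) (x : V) : R := complex.Re `|x|.

Section Theory.
Variable V : normedModType R[i].
Implicit Types x y : V.

Lemma nrE x : (nr x)%:C = `|x|.
Proof. by rewrite /nr RRe_real ?normr_real. Qed.

Lemma nr_ge0 x : 0 <= nr x.
Proof. by rewrite -lecR nrE normr_ge0. Qed.

Lemma nrD x y : nr (x + y) <= nr x + nr y.
Proof. by rewrite -lecR rmorphD /= !nrE ler_normD. Qed.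

Lemma nrN x : nr (- x) = nr x.
Proof. by rewrite /nr normrN. Qed.

Lemma nrBC x y : nr (x - y) = nr (y - x).
Proof. by rewrite -nrN opprB. Qed.

Lemma nr0 : nr (0 : V) = 0.
Proof. by rewrite /nr normr0. Qed.

Lemma nr0_eq0 x : nr x = 0 -> x = 0.
Proof. by move=> z0; apply/eqP; rewrite -normr_eq0 -nrE z0. Qed.

Lemma nrZ (c : R[i]) x : nr (c *: x) = cabs c * nr x.
Proof. by apply: complexI; rewrite rmorphM /= cabsE !nrE normrZ. Qed.

Lemma nr_triangle y x z : nr (x - z) <= nr (x - y) + nr (y - z).
Proof. by have := nrD (x - y) (y - z); rewrite addrA subrK. Qed.

Lemma nr_leD x y e r : nr (x - y) <= e -> nr y <= r -> nr x <= e + r.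
Proof. by move=> h1 h2; rewrite -(subrK y x); apply: le_trans (nrD _ _) (lerD h1 h2). Qed.

Lemma nr_eq x y : (forall e, 0 < e -> nr (x - y) <= e) -> x = y.
Proof.
move=> h; apply/eqP; rewrite -subr_eq0; apply/eqP/nr0_eq0/eqP.
rewrite eq_le nr_ge0 andbT; apply/ler_addgt0Pr => e e0.
by rewrite add0r; exact: h.
Qed.

End Theory.

Lemma posC (e : R[i]) : 0 < e -> exists2 r : R, 0 < r & e = r%:C.
Proof.
case: e => a b; rewrite ltcE /= => /andP[/eqP b0 a0].
by exists a => //; rewrite b0.
Qed.

Lemma closure_nr (V : normedModType R[i]) (A : set V) x :
  closure A x <-> forall e, 0 < e -> exists2 y, A y & nr (x - y) < e.
Proof.
split=> [cA e e0|h B /nbhs_ballP[e /posC[r r0 ->] rB]].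
  have [|y [Ay By]] := cA (ball x e%:C).
    by apply: nbhsx_ballx; rewrite ltcR.
  by exists y => //; rewrite -ltcR nrE; move: By; rewrite -ball_normE.
have [y Ay yr] := h r r0; exists y; split => //; apply: rB.
by rewrite -ball_normE /= -nrE ltcR.
Qed.

Lemma closed_nr (V : normedModType R[i]) (A : set V) : closed A <->
  forall x, (forall e, 0 < e -> exists2 y, A y & nr (x - y) <= e) -> A x.
Proof.
split=> [cA x h|h x /closure_nr cx].
  apply: cA; apply/closure_nr => e e0.
  have [y Ay hy] := h (e / 2) (divr_gt0 e0 (ltr0n _ 2)); exists y => //.
  by apply: le_lt_trans hy _; rewrite ltr_pdivrMr // ltr_pMr // ltr1n.
by apply: h => e e0; have [y Ay /ltW hy] := cx e e0; exists y.
Qed.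

Lemma inv_succ_small (e : R) : 0 < e ->
  exists n : nat, forall m, (n <= m)%N -> m.+1%:R^-1 <= e.
Proof.
move=> e0; exists (Num.bound e^-1) => m nm.
rewrite -[leRHS]invrK lef_pV2 ?posrE ?invr_gt0 //.
apply/ltW/(lt_trans (archi_boundP _)); first by rewrite invr_ge0 ltW.
by rewrite ltr_nat ltnS.
Qed.

Lemma cauchy_seq_cvg (K : numFieldType) (V : completeNormedModType K) (u : nat -> V) :
  (forall e, 0 < e -> exists n0 : nat, forall n, (n0 <= n)%N -> `|u n - u n0| < e) ->
  cvgn u.
Proof.
move=> h; apply/cauchy_cvgP/cauchy_exP => e e0.
have [n0 hn0] := h e e0; exists (u n0); exists n0 => // n n0n /=.
by rewrite -ball_normE /= distrC; exact: hn0.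
Qed.

Lemma nr_complete (V : completeNormedModType R[i]) (u : nat -> V) :
  (forall e, 0 < e -> exists n0 : nat, forall n m, (n0 <= n)%N -> (n <= m)%N ->
     nr (u m - u n) <= e) ->
  exists l, forall e, 0 < e -> exists n0 : nat, forall n, (n0 <= n)%N ->
     nr (u n - l) <= e.
Proof.
move=> h; have /cvg_ex[l ul] : cvgn u.
  apply: cauchy_seq_cvg => _ /posC[e e0 ->].
  have [n0 hn0] := h (e / 2) (divr_gt0 e0 (ltr0n _ 2)); exists n0 => n n0n.
  rewrite -nrE ltcR; apply: le_lt_trans (hn0 _ _ _ n0n) _ => //.
  by rewrite ltr_pdivrMr // ltr_pMr // ltr1n.
exists l => e e0.
have eC : (0 : R[i]) < e%:C by rewrite ltcR.
have /cvgrPdist_le/(_ _ eC)[n0 _ hn0] := ul.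
exists n0 => n n0n; have := hn0 n n0n.
by rewrite /= -nrE lecR nrBC.
Qed.

Lemma complex_complete (u : nat -> R[i]) :
  (forall e, 0 < e -> exists n0 : nat, forall n m, (n0 <= n)%N -> (n <= m)%N ->
     cabs (u m - u n) <= e) ->
  exists l, forall e, 0 < e -> exists n0 : nat, forall n, (n0 <= n)%N ->
     cabs (u n - l) <= e.
Proof.
move=> h.
have real_cv (p : R[i] -> R) (pB : {morph p : x y / x - y}) :
    (forall z, `|p z| <= cabs z) -> exists l, forall e, 0 < e ->
    exists n0 : nat, forall n, (n0 <= n)%N -> `|p (u n) - l| <= e.
  move=> pc; have /cvg_ex[l ul] : cvgn (p \o u : nat -> R^o).
    apply: cauchy_seq_cvg => e e0.
    have [n0 hn0] := h (e / 2) (divr_gt0 e0 (ltr0n _ 2)); exists n0 => n n0n /=.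
    rewrite -pB; apply: le_lt_trans (pc _) _.
    apply: le_lt_trans (hn0 _ _ _ n0n) _ => //.
    by rewrite ltr_pdivrMr // ltr_pMr // ltr1n.
  exists l => e e0; have /cvgrPdist_le/(_ _ e0)[n0 _ hn0] := ul.
  by exists n0 => n n0n; rewrite distrC; exact: hn0.
have Re_le z : `|complex.Re z| <= cabs z by rewrite -lecR cabsE normc_ge_Re.
have Im_le z : `|complex.Im z| <= cabs z.
  by rewrite -lecR cabsE normc_def lecR -sqrtr_sqr ler_wsqrtr // lerDr sqr_ge0.
have [a ha] : exists l, forall e, 0 < e ->
    exists n0 : nat, forall n, (n0 <= n)%N -> `|complex.Re (u n) - l| <= e.
  by apply: (real_cv (@complex.Re R)) => // -[? ?] [? ?].
have [b hb] : exists l, forall e, 0 < e ->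
    exists n0 : nat, forall n, (n0 <= n)%N -> `|complex.Im (u n) - l| <= e.
  by apply: (real_cv (@complex.Im R)) => // -[? ?] [? ?].
exists (a +i* b) => e e0.
have e2 : 0 < e / 2 by rewrite divr_gt0.
have [n1 h1] := ha _ e2; have [n2 h2] := hb _ e2.
exists (maxn n1 n2) => n; rewrite geq_max => /andP[/h1 {}h1 /h2 {}h2].
have -> : u n - (a +i* b) = (complex.Re (u n) - a)%:C + 'i * (complex.Im (u n) - b)%:C.
  by rewrite (complexE (u n - _)) complexiE; case: (u n).
apply: le_trans (cabsD _ _) _; rewrite cabsM cabs_i mul1r !cabs_real.
have -> : e = e / 2 + e / 2 by field.
exact: lerD.
Qed.

(** Operator norms and dual norms are best constants in an inequality
    [f <= M * g]. *)
Section BestConstant.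
Variables (I : Type) (f g : I -> R).
Hypothesis g_ge0 : forall i, 0 <= g i.

Definition bound_const (M : R) := 0 <= M /\ forall i, f i <= M * g i.
Definition best_const : R := inf [set M | bound_const M].

Lemma best_const_le M : bound_const M -> best_const <= M.
Proof. by move=> h; apply: ge_inf => //; exists 0 => x []. Qed.

Lemma best_constP : (exists M, bound_const M) -> bound_const best_const.
Proof.
move=> [M0 hM0].
have hi : has_inf [set M | bound_const M] by split; [exists M0|exists 0 => x []].
have b0 : 0 <= best_const by apply: lb_le_inf; [exists M0|move=> x []].
split=> // i; apply/ler_addgt0Pr => e e0.
have g1 : 0 < g i + 1 by have := g_ge0 i; lra.
have [M hM Me] := inf_adherent (divr_gt0 e0 g1) hi.
apply: le_trans (hM.2 i) _.
apply: le_trans (ler_wpM2r (g_ge0 i) (ltW Me)) _.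
rewrite mulrDl lerD2l mulrAC ler_pdivrMr // ler_pM2l //; lra.
Qed.

End BestConstant.
End RealNorm.

(** * Unital C*-algebras and square roots *)

Record unital_cstar (R : realType) := UnitalCstar {
  ucs_sort :> algType R[i];
  ustar : ucs_sort -> ucs_sort;
  unrm : ucs_sort -> R;
  ustarP : forall (c : R[i]) x y,
    ustar (c *: x + y) = c^* *: ustar x + ustar y;
  ustarM : forall x y, ustar (x * y) = ustar y * ustar x;
  ustarK : forall x, ustar (ustar x) = x;
  unrmD : forall x y, unrm (x + y) <= unrm x + unrm y;
  unrmZ : forall c x, unrm (c *: x) = cabs c * unrm x;
  unrm0_eq0 : forall x, unrm x = 0 -> x = 0;
  unrmM : forall x y, unrm (x * y) <= unrm x * unrm y;
  unrm_starl : forall x, unrm (ustar x * x) = unrm x ^+ 2;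
  unrm_complete : forall u : nat -> ucs_sort,
    (forall e, 0 < e -> exists n0 : nat, forall n m, (n0 <= n)%N -> (n <= m)%N ->
       unrm (u m - u n) <= e) ->
    exists l, forall e, 0 < e -> exists n0 : nat, forall n, (n0 <= n)%N ->
       unrm (u n - l) <= e }.

Section UnitalCstar.
Variables (R : realType) (U : unital_cstar R).
Local Notation N := (@unrm R U).
Local Notation star := (@ustar R U).
Implicit Types (x y z a b d u v w : U) (r s e lam mu : R).

Lemma ustarD x y : star (x + y) = star x + star y.
Proof. by have := ustarP 1 x y; rewrite rmorph1 !scale1r. Qed.

Lemma ustar0 : star 0 = 0.
Proof. by apply: (addrI (star 0)); rewrite -ustarD !addr0. Qed.

Lemma ustarZ c x : star (c *: x) = c^* *: star x.
Proof. by have := ustarP c x 0; rewrite ustar0 !addr0. Qed.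

Lemma ustarN x : star (- x) = - star x.
Proof. by rewrite -scaleN1r ustarZ rmorphN rmorph1 scaleN1r. Qed.

Lemma ustarB x y : star (x - y) = star x - star y.
Proof. by rewrite ustarD ustarN. Qed.

Lemma ustar1 : star 1 = 1.
Proof. by have := ustarM 1 (star 1); rewrite mul1r !ustarK mul1r. Qed.

Lemma ustarZr r x : star (r%:C *: x) = r%:C *: star x.
Proof. by rewrite ustarZ conjC_real. Qed.

Lemma unrmZr r x : N (r%:C *: x) = `|r| * N x.
Proof. by rewrite unrmZ cabs_real. Qed.

Lemma unrm0 : N 0 = 0.
Proof. by rewrite -(scale0r 0) unrmZ cabs0 mul0r. Qed.

Lemma unrmN x : N (- x) = N x.
Proof. by rewrite -scaleN1r unrmZ cabsN cabs1 mul1r. Qed.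

Lemma unrm_ge0 x : 0 <= N x.
Proof.
have := unrmD x (- x); rewrite unrmN subrr unrm0 => h.
by rewrite -(pmulrn_lge0 _ (isT : (0 < 2)%N)) mulr2n.
Qed.
Hint Resolve unrm_ge0 : core.

Lemma unrmB x y : N (x - y) = N (y - x).
Proof. by rewrite -unrmN opprB. Qed.

Lemma unrm_star x : N (star x) = N x.
Proof.
suff h y : N y <= N (star y) by apply/eqP; rewrite eq_le -{2}(ustarK x) !h.
have := unrmM (star y) y; rewrite unrm_starl expr2.
have [->|y0] := eqVneq (N y) 0; first by rewrite unrm_ge0.
by rewrite ler_pM2r // lt_neqAle eq_sym y0 /=.
Qed.

Lemma unrm1 : N 1 = 1.
Proof.
have := unrm_starl (1 : U); rewrite mulr1 ustar1 expr2.
move/eqP; rewrite -subr_eq0 -{1}(mulr1 (N 1)) -mulrBr mulf_eq0 => /orP[/eqP h|].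
  by have /eqP := unrm0_eq0 h; rewrite oner_eq0.
by rewrite subr_eq0 => /eqP.
Qed.

Lemma unrmA r : N (r%:C%:A) = `|r|.
Proof. by rewrite unrmZr unrm1 mulr1. Qed.

Lemma unrm_sqr a : star a = a -> N (a * a) = N a ^+ 2.
Proof. by move=> sa; rewrite -{1}sa unrm_starl. Qed.

Lemma unrm_ltD x y z r s : N (x - y) <= r -> N (y - z) <= s -> N (x - z) <= r + s.
Proof.
move=> h1 h2; have -> : x - z = (x - y) + (y - z) by rewrite addrA subrK.
exact: le_trans (unrmD _ _) (lerD h1 h2).
Qed.

Lemma unrm_eq x y : (forall e, 0 < e -> N (x - y) <= e) -> x = y.
Proof.
move=> h; apply/eqP; rewrite -subr_eq0; apply/eqP/unrm0_eq0/eqP.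
rewrite eq_le unrm_ge0 andbT; apply/ler_addgt0Pr => e e0.
by rewrite add0r; exact: h.
Qed.

Lemma commZ (c : R[i]) x y : GRing.comm x y -> GRing.comm x (c *: y).
Proof. by rewrite /GRing.comm => h; rewrite -scalerAr -scalerAl h. Qed.

Section SquareRootIteration.
Variable v : U.
Hypotheses (v_sa : star v = v) (v_le1 : N v <= 1).

(** The iteration solving [s = (v + s^2) / 2], that is [(1 - s)^2 = 1 - v], and
    the same iteration at the scalar [v = 1], which dominates it: the iterates
    are polynomials in [v] with nonnegative coefficients. *)
Fixpoint sqrt_iter n : U :=
  if n is n.+1 then (2^-1)%:C *: (v + sqrt_iter n * sqrt_iter n) else 0.
Fixpoint sqrt_major n : R :=
  if n is n.+1 then 2^-1 * (1 + sqrt_major n * sqrt_major n) else 0.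

Local Notation s_ := sqrt_iter.
Local Notation t_ := sqrt_major.

Lemma sqrt_major_bd n : 0 <= t_ n <= 1.
Proof.
elim: n => [|n /andP[h0 h1]] /=; first by rewrite lexx ler01.
have : t_ n * t_ n <= 1 * 1 by apply: ler_pM.
have : 0 <= t_ n * t_ n by apply: mulr_ge0.
by set q := _ * _ => q0 q1; lra.
Qed.

Lemma sqrt_iter_comm w n : GRing.comm w v -> GRing.comm w (s_ n).
Proof.
move=> wv; elim: n => [|n ih] /=; first exact: commr0.
by apply: commZ; apply: commrD => //; apply: commrM.
Qed.

Lemma sqrt_iter_sa n : star (s_ n) = s_ n.
Proof.
elim: n => [|n ih] /=; first exact: ustar0.
by rewrite ustarZr ustarD ustarM ih v_sa.
Qed.

Lemma sqrt_iter_bd n : N (s_ n) <= t_ n.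
Proof.
elim: n => [|n ih] /=; first by rewrite unrm0.
rewrite unrmZr ger0_norm ?invr_ge0 ?ler0n // ler_pM2l ?invr_gt0 ?ltr0n //.
apply: le_trans (unrmD _ _) (lerD v_le1 _).
by apply: le_trans (unrmM _ _) _; apply: ler_pM.
Qed.

Lemma sqrt_iter_diff n k : N (s_ (k + n)%N - s_ n) <= t_ (k + n)%N - t_ n.
Proof.
elim: n => [|n ih]; first by rewrite /= !subr0 sqrt_iter_bd.
rewrite addnS /=.
have cs : GRing.comm (s_ (k + n)%N) (s_ n).
  by apply: sqrt_iter_comm; apply/commr_sym; apply: sqrt_iter_comm.
have -> : (2^-1)%:C *: (v + s_ (k + n) * s_ (k + n)) - (2^-1)%:C *: (v + s_ n * s_ n)
  = (2^-1)%:C *: ((s_ (k + n)%N - s_ n) * (s_ (k + n)%N + s_ n)).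
  rewrite -scalerBr opprD addrACA subrr add0r; congr (_ *: _).
  by rewrite mulrDr !mulrBl -cs addrA subrK.
have -> : 2^-1 * (1 + t_ (k + n) * t_ (k + n)) - 2^-1 * (1 + t_ n * t_ n)
  = 2^-1 * ((t_ (k + n)%N - t_ n) * (t_ (k + n)%N + t_ n)) by ring.
rewrite unrmZr ger0_norm ?invr_ge0 ?ler0n // ler_pM2l ?invr_gt0 ?ltr0n //.
apply: le_trans (unrmM _ _) _; apply: ler_pM => //.
by apply: le_trans (unrmD _ _) _; apply: lerD; apply: sqrt_iter_bd.
Qed.

Lemma sqrt_major_ndecr : nondecreasing_seq t_.
Proof.
apply/nondecreasing_seqP => n; rewrite -subr_ge0.
by apply: le_trans (sqrt_iter_diff n 1).
Qed.

Lemma sqrt_iter_cauchy e : 0 < e -> exists n0 : nat, forall n m,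
  (n0 <= n)%N -> (n <= m)%N -> N (s_ m - s_ n) <= e.
Proof.
move=> e0.
have ub : has_ubound (range t_).
  by exists 1 => _ [n _ <-]; have /andP[] := sqrt_major_bd n.
have cv := nondecreasing_cvgn sqrt_major_ndecr ub.
set l := sup _ in cv.
have /cvgrPdist_le/(_ e e0)[n0 _ hn0] := cv.
exists n0 => n m n0n nm; rewrite -(subnK nm).
apply: le_trans (sqrt_iter_diff _ _) _; rewrite subnK //.
have := hn0 _ n0n; rewrite ler_norml => /andP[_ h].
have : t_ m <= l.
  by apply: (ub_le_sup ub); exists m.
lra.
Qed.

(** The scalar iterates increase and are at most [1], so they converge, and the
    iterates at [v] form a Cauchy sequence. This reaches the boundary case
    [N v = 1], where the iteration is not a strict contraction. *)
Lemma usqrt_exists : exists y,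
  [/\ star y = y, y * y = 1 - v, N (1 - y) <= 1 &
      forall w, GRing.comm w v -> GRing.comm w y].
Proof.
have [s cvs] := unrm_complete sqrt_iter_cauchy.
have approx e : 0 < e -> exists n, N (s_ n - s) <= e /\ N (s_ n.+1 - s) <= e.
  by move=> e0; have [n h] := cvs e e0; exists n; split; apply: h.
have s_le1 : N s <= 1.
  apply/ler_addgt0Pr => e e0; have [n [h _]] := approx e e0.
  have -> : s = s_ n + (s - s_ n) by rewrite addrC subrK.
  apply: le_trans (unrmD _ _) _; apply: lerD; last by rewrite unrmB.
  by apply: le_trans (sqrt_iter_bd n) _; have /andP[] := sqrt_major_bd n.
have s_comm w : GRing.comm w v -> GRing.comm w s.
  move=> wv; apply: unrm_eq => e e0.
  have w0 : 0 < N w + N w + 1 by have := unrm_ge0 w; lra.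
  have [n [h _]] := approx (e / (N w + N w + 1)) (divr_gt0 e0 w0).
  have -> : w * s - s * w = (s_ n - s) * w - w * (s_ n - s).
    by rewrite mulrBl mulrBr (sqrt_iter_comm n wv) opprB [RHS]addrC addrA subrK.
  apply: le_trans (unrmD _ _) _; rewrite unrmN.
  have h1 := unrmM (s_ n - s) w; have h2 := unrmM w (s_ n - s).
  apply: le_trans (lerD h1 h2) _.
  rewrite (mulrC (N w)) -mulrDr.
  move: h; rewrite ler_pdivlMr // => h; apply: le_trans h.
  by apply: ler_wpM2l => //; lra.
have s_sa : star s = s.
  apply: unrm_eq => e e0; have [n [h _]] := approx (e / 2) (divr_gt0 e0 (ltr0n _ 2)).
  have -> : e = e / 2 + e / 2 by field.
  apply: (unrm_ltD (y := s_ n)) => //.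
  by rewrite -[X in _ - X](sqrt_iter_sa n) -ustarB unrm_star unrmB.
have s_fix : s + s = v + s * s.
  apply: unrm_eq => e e0.
  have [n [h1 h2]] := approx (e / 4) (divr_gt0 e0 (ltr0n _ 4)).
  have e4 : e = (e / 4 + e / 4) + (e / 4 + e / 4) by field.
  have tn : N (s_ n) <= 1.
    by apply: le_trans (sqrt_iter_bd n) _; have /andP[] := sqrt_major_bd n.
  have sn2 : s_ n.+1 + s_ n.+1 = v + s_ n * s_ n.
    by rewrite -mulr2n -scaler_nat /= scalerA -[2%:R](rmorph_nat (real_complex R))
       -rmorphM /= divff ?pnatr_eq0 // scale1r.
  rewrite e4; apply: (unrm_ltD (y := v + s_ n * s_ n)).
    rewrite -sn2 opprD addrACA; apply: le_trans (unrmD _ _) _.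
    by rewrite !(unrmB s); apply: lerD.
  rewrite opprD addrACA subrr add0r.
  have -> : s_ n * s_ n - s * s = s_ n * (s_ n - s) + (s_ n - s) * s.
    by rewrite mulrBr mulrBl addrA subrK.
  apply: le_trans (unrmD _ _) _; apply: lerD.
    by apply: le_trans (unrmM _ _) _; rewrite -[leRHS]mul1r; apply: ler_pM.
  by apply: le_trans (unrmM _ _) _; rewrite -[leRHS]mulr1; apply: ler_pM.
exists (1 - s); split.
- by rewrite ustarB ustar1 s_sa.
- have -> : 1 - v = 1 - s - (s - s * s).
    have -> : v = s + s - s * s by rewrite s_fix addrK.
    by rewrite -(addrA s s) opprD addrA.
  by rewrite mulrBl mul1r mulrBr mulr1.
- by rewrite opprB addrC subrK.
- by move=> w wv; apply: commrB; [exact: commr1 | exact: s_comm].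
Qed.

End SquareRootIteration.

End UnitalCstar.

(** ** Positive elements *)

Section Positive.
Variables (R : realType) (U : unital_cstar R).
Local Notation N := (@unrm R U).
Local Notation star := (@ustar R U).
Implicit Types (x y z a b d u v w : U) (r s e lam mu : R).
Let N_ge0 x : 0 <= N x := unrm_ge0 x.
Hint Resolve N_ge0 : core.

(** Positivity is stated through the norm, so that the triangle inequality makes
    the positive elements a cone; [pos_sqrt] and [pos_square] show that they are
    the squares of self-adjoint elements. *)
Definition pos a := star a = a /\ exists lam, N (lam%:C%:A - a) <= lam.

Lemma ustarA r : star (r%:C%:A) = r%:C%:A.
Proof. by rewrite ustarZr ustar1. Qed.

Lemma ustarZi x : star ('i *: x) = - ('i *: star x).
Proof. by rewrite ustarZ (_ : ('i : R[i])^* = - 'i) ?scaleNr //; exact: conjCi. Qed.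

Lemma scaler_ii x : 'i *: ('i *: x) = - x :> U.
Proof. by rewrite scalerA -expr2 sqrCi scaleN1r. Qed.

Lemma scalerAD r s : (r + s)%:C%:A = r%:C%:A + s%:C%:A :> U.
Proof. by rewrite rmorphD /= scalerDl. Qed.

Lemma scalerAB r s : (r - s)%:C%:A = r%:C%:A - s%:C%:A :> U.
Proof. by rewrite rmorphB /= scalerBl. Qed.

Lemma scalerAA r s x : r%:C *: (s%:C *: x) = (r * s)%:C *: x.
Proof. by rewrite scalerA rmorphM. Qed.

Lemma scaler_half x : x = (2^-1)%:C *: (x + x).
Proof.
have -> : x + x = (2 : R)%:C *: x by rewrite rmorph_nat scaler_nat mulr2n.
by rewrite scalerAA mulVf ?pnatr_eq0 // scale1r.
Qed.

(** Both [y + iz] and [y - iz] have squared norm [|y^2 + z^2|], and their sum is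
    [2y]. *)
Lemma norm_le_sum_squares y z : star y = y -> star z = z -> GRing.comm y z ->
  N y ^+ 2 <= N (y * y + z * z).
Proof.
move=> sy sz yz; set t := N (_ + _).
have Np : N (y + 'i *: z) ^+ 2 = t.
  rewrite -unrm_starl; congr N; rewrite ustarD ustarZi sy sz mulrBl !mulrDr.
  rewrite -!scalerAl -!scalerAr scaler_ii -yz opprD opprK addrA.
  congr (_ + _).
  by rewrite addrK.
have Nm : N (y - 'i *: z) ^+ 2 = t.
  rewrite -unrm_starl; congr N; rewrite ustarB ustarZi sy sz opprK mulrDl !mulrBr.
  rewrite -!scalerAl -!scalerAr scaler_ii -yz opprK addrA; congr (_ + _).
  by rewrite subrK.
have t0 : 0 <= t by exact: unrm_ge0.
have Np' : N (y + 'i *: z) = Num.sqrt t by rewrite -Np sqrtr_sqr ger0_norm ?unrm_ge0.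
have Nm' : N (y - 'i *: z) = Num.sqrt t by rewrite -Nm sqrtr_sqr ger0_norm ?unrm_ge0.
have h : N y <= Num.sqrt t.
  rewrite {1}(scaler_half y).
  have -> : y + y = (y + 'i *: z) + (y - 'i *: z) by rewrite addrACA subrr addr0.
  rewrite unrmZr ger0_norm ?invr_ge0 ?ler0n //.
  have := unrmD (y + 'i *: z) (y - 'i *: z); rewrite Np' Nm'.
  by set p := N _; set q := Num.sqrt t; lra.
have := ler_pM (unrm_ge0 _) (unrm_ge0 _) h h.
by rewrite -!expr2 sqr_sqrtr.
Qed.

(** With [z] the square root of [1 - y^2], [z + iy] and [z - iy] are unitary, so
    [|z| <= 1]. *)
Lemma unrm_sub_square1 y : star y = y -> N (y * y) <= 1 -> N (1 - y * y) <= 1.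
Proof.
move=> sy yle.
have [|z [sz zz _ zcomm]] := usqrt_exists (v := y * y) _ yle.
  by rewrite ustarM sy.
have yz : GRing.comm z y by apply/commr_sym/zcomm; apply: commrM; exact: commr_refl.
have := norm_le_sum_squares sz sy yz; rewrite zz subrK unrm1 => h.
by rewrite -zz unrm_sqr.
Qed.

Lemma pos_unrm_sub_square y mu : star y = y -> N (y * y) <= mu ->
  N (mu%:C%:A - y * y) <= mu.
Proof.
move=> sy ymu; have [mu0|mu0|mu0] := ltrgt0P mu; last 1 first.
- move: ymu; rewrite mu0 scale0r sub0r unrmN => h.
  by apply: le_trans h _.
- pose c := (Num.sqrt mu)^-1.
  have c2 : c * c = mu^-1 by rewrite -invfM -expr2 sqr_sqrtr // ltW.
  have sy' : star (c%:C *: y) = c%:C *: y by rewrite ustarZr sy.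
  have yy : c%:C *: y * (c%:C *: y) = mu^-1%:C *: (y * y).
    by rewrite -scalerAl -scalerAr scalerAA c2.
  have := @unrm_sub_square1 _ sy'; rewrite yy unrmZr ger0_norm ?invr_ge0 ?(ltW mu0) //.
  rewrite ler_pdivrMl // mulr1 => /(_ ymu).
  have -> : 1 - mu^-1%:C *: (y * y) = mu^-1%:C *: (mu%:C%:A - y * y).
    by rewrite scalerBr scalerAA mulVf ?gt_eqF // scale1r.
  by rewrite unrmZr ger0_norm ?invr_ge0 ?(ltW mu0) // ler_pdivrMl // mulr1.
- by have := le_lt_trans ymu mu0; rewrite ltNge unrm_ge0.
Qed.

Lemma pos_square y : star y = y -> pos (y * y).
Proof.
move=> sy; split; first by rewrite ustarM sy.
by exists (N (y * y)); apply: pos_unrm_sub_square.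
Qed.

Lemma pos_sqrt a : pos a -> exists y,
  [/\ star y = y, pos y, y * y = a & forall w, GRing.comm w a -> GRing.comm w y].
Proof.
move=> [sa [lam' hlam']]; pose lam := lam' + 1.
have lam0 : 0 < lam by have := le_trans (unrm_ge0 _) hlam'; rewrite /lam; lra.
have hlam : N (lam%:C%:A - a) <= lam.
  rewrite scalerAD addrAC; apply: le_trans (unrmD _ _) _.
  by rewrite unrmA normr1 lerD2r.
pose v := lam^-1%:C *: (lam%:C%:A - a).
have va : lam%:C *: (1 - v) = a.
  by rewrite scalerBr scalerAA divff ?gt_eqF // scale1r opprB addrC subrK.
have sv : star v = v by rewrite ustarZr ustarB ustarA sa.
have v1 : N v <= 1.
  by rewrite unrmZr ger0_norm ?invr_ge0 ?(ltW lam0) // ler_pdivrMl // mulr1.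
have [z [sz zz z1 zcomm]] := usqrt_exists sv v1.
pose q := Num.sqrt lam.
have q2 : q * q = lam by rewrite -expr2 sqr_sqrtr // ltW.
have q0 : 0 <= q by exact: sqrtr_ge0.
exists (q%:C *: z); split.
- by rewrite ustarZr sz.
- split; first by rewrite ustarZr sz.
  by exists q; rewrite -scalerBr unrmZr ger0_norm // -[leRHS]mulr1 ler_wpM2l.
- by rewrite -scalerAl -scalerAr scalerAA q2 zz va.
- move=> w wa; apply/commZ/zcomm; apply/commZ/commrB => //.
  by apply: commZ; exact: commr1.
Qed.

Lemma pos_norm a mu : pos a -> N a <= mu -> N (mu%:C%:A - a) <= mu.
Proof.
move=> pa; have [y [sy _ <- _]] := pos_sqrt pa.
exact: pos_unrm_sub_square.
Qed.

Lemma posD a b : pos a -> pos b -> pos (a + b).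
Proof.
move=> [sa [la ha]] [sb [lb hb]]; split; first by rewrite ustarD sa sb.
exists (la + lb); rewrite scalerAD opprD addrACA.
by apply: le_trans (unrmD _ _) (lerD ha hb).
Qed.

Lemma posZ r a : 0 <= r -> pos a -> pos (r%:C *: a).
Proof.
move=> r0 [sa [la ha]]; split; first by rewrite ustarZr sa.
exists (r * la); rewrite -scalerAA -scalerBr unrmZr ger0_norm //.
exact: ler_wpM2l.
Qed.

Lemma pos_of_norm a mu : star a = a -> N a <= mu -> pos (mu%:C%:A - a).
Proof.
move=> sa h; split; first by rewrite ustarB ustarA sa.
by exists mu; rewrite opprB addrC subrK.
Qed.

Lemma posA r : 0 <= r -> pos (r%:C%:A).
Proof.
by move=> r0; split; [rewrite ustarA | exists r; rewrite subrr unrm0].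
Qed.

Lemma pos_scalar_ge0 r : pos (r%:C%:A) -> 0 <= r.
Proof.
move=> [_ [lam]]; rewrite -scalerAB unrmA => h.
have := le_trans (ler_norm _) h; lra.
Qed.

(** Write [a] and [mu - a] as squares of commuting elements and apply
    [norm_le_sum_squares]. *)
Lemma pos_le_scalar a mu : pos a -> pos (mu%:C%:A - a) -> N a <= mu.
Proof.
move=> pa pb.
have mu0 : 0 <= mu.
  by apply: pos_scalar_ge0; rewrite -(subrK a mu%:C%:A); apply: posD.
have [y [sy _ yy ycomm]] := pos_sqrt pa; have [z [sz _ zz zcomm]] := pos_sqrt pb.
have yz : GRing.comm y z.
  apply: zcomm; apply: commrB; first by apply: commZ; exact: commr1.
  by rewrite -yy; apply: commrM; exact: commr_refl.
have := norm_le_sum_squares sy sz yz.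
by rewrite yy zz addrC subrK unrmA ger0_norm // -unrm_sqr // yy.
Qed.

Lemma pos_le_norm a b : pos a -> pos (b - a) -> N a <= N b.
Proof.
move=> pa pba; apply: pos_le_scalar => //.
have -> : (N b)%:C%:A - a = ((N b)%:C%:A - b) + (b - a) by rewrite addrA subrK.
apply: posD => //; apply: pos_of_norm => //.
by have [] := posD pa pba; rewrite addrC subrK.
Qed.

(** For [n = |lam + d|], [n - lam - d] is positive, hence [|d| <= n - lam]. *)
Lemma pos_norm_scalarD lam d : 0 <= lam -> pos d -> N (lam%:C%:A + d) = lam + N d.
Proof.
move=> lam0 pd; apply/eqP; rewrite eq_le; apply/andP; split.
  by apply: le_trans (unrmD _ _) _; rewrite unrmA ger0_norm.
rewrite addrC -lerBrDr; apply: pos_le_scalar => //.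
rewrite scalerAB -addrA -opprD; apply: pos_of_norm => //.
by rewrite ustarD ustarA pd.1.
Qed.

(** The element [d = x x^*] is positive, because [x x^* + x^*x] is a sum of two
    squares. With [t = |d|], positivity of [-x^*x] gives [|t + x^*x| <= t], so
    [d (t + d) = x (t + x^*x) x^*] has norm at most [t^2]; but completing the
    square shows that this norm is at least [2 t^2]. *)
Lemma neg_starM_eq0 x : pos (- (star x * x)) -> x = 0.
Proof.
move=> neg; have [t tE] : exists t, t = N x ^+ 2 by eexists.
pose d := x * star x.
have t0 : 0 <= t by rewrite tE sqr_ge0.
have sd : star d = d by rewrite ustarM ustarK.
have pd : pos d.
  (* Twice the real and imaginary parts of [x], up to sign. *)
  pose p := x + star x; pose q := 'i *: (x - star x).
  have sp : star p = p by rewrite ustarD ustarK addrC.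
  have sq : star q = q by rewrite ustarZi ustarB ustarK -scalerN opprB.
  have -> : d = (2^-1)%:C *: (p * p + q * q) + - (star x * x).
    pose b := star x * x; rewrite -/b.
    have -> : p * p = (b + star x * star x) + (d + x * x).
      by rewrite mulrDl !mulrDr [RHS]addrC [d + _]addrC.
    have -> : q * q = (b - star x * star x) + (d - x * x).
      by rewrite -scalerAl -scalerAr scaler_ii mulrBl !mulrBr opprB [- (_ - d)]opprB.
    rewrite addrACA (addrACA b) (addrACA d) !subrr !addr0 (addrACA b).
    by rewrite -scaler_half addrAC subrr add0r.
  by apply: posD => //; apply: posZ; [rewrite invr_ge0 ler0n|apply: posD; apply: pos_square].
have Nd : N d = t by rewrite /d -{1}(ustarK x) unrm_starl unrm_star tE.
have Nxx : N (t%:C%:A + star x * x) <= t.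
  by rewrite -{1}[star x * x]opprK; apply: pos_norm => //; rewrite unrmN unrm_starl tE.
have up : N (t%:C *: d + d * d) <= t * t.
  have -> : t%:C *: d + d * d = x * (t%:C%:A + star x * x) * star x.
    by rewrite mulrDr mulrDl -scalerAr mulr1 -scalerAl !mulrA.
  apply: le_trans (unrmM _ _) _; rewrite unrm_star.
  have := unrmM x (t%:C%:A + star x * x) => h.
  apply: le_trans (ler_wpM2r _ h) _ => //.
  rewrite mulrAC -expr2 -tE; exact: ler_wpM2l.
(* The norm of the square of [t / 2 + d]. *)
have low : (t + t / 2) ^+ 2 <= N (t%:C *: d + d * d) + t * t / 4.
  set mu := N (_ + _).
  pose g := (t / 2)%:C%:A + d.
  have sg : star g = g by rewrite ustarD ustarA sd.
  have Ng : N g = t + t / 2 by rewrite pos_norm_scalarD ?Nd ?divr_ge0 // addrC.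
  rewrite -Ng -unrm_sqr //; apply: pos_le_scalar; first exact: pos_square.
  have -> : g * g = (t * t / 4)%:C%:A + (t%:C *: d + d * d).
    rewrite /g mulrDl !mulrDr -![in LHS]scalerAl !mul1r -scalerAr mulr1 scalerAA -!addrA.
    congr (_ + _).
      by congr (_%:C *: _); field.
    by rewrite !addrA; congr (_ + _); rewrite -scalerDl -rmorphD; congr (_%:C *: _); field.
  rewrite scalerAD opprD addrA addrK.
  apply: pos_of_norm => //.
  by rewrite ustarD ustarZr ustarM sd.
have /eqP : t = 0.
  apply/eqP; rewrite -sqrf_eq0; apply/eqP.
  have := le_trans low (lerD up (lexx _)); have := sqr_ge0 t; rewrite !expr2; nra.
by rewrite tE sqrf_eq0 => /eqP /unrm0_eq0.
Qed.

(** Put [c = x^*x], [s = |c|] and [v = s - c]. As [s^2 = c^2], [c v = - s v], so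
    [- (x v)^* (x v) = s v^2] is the square of [sqrt s * v]. By [neg_starM_eq0],
    [x v = 0]; then [c v = s v = 0], [v^2 = 0] and [c = s]. *)
Lemma pos_starM x : pos (star x * x).
Proof.
have [c cE] : exists c, c = star x * x by eexists.
have sc : star c = c by rewrite cE ustarM ustarK.
rewrite -cE.
have [s [ss ps s2 scomm]] := pos_sqrt (pos_square sc).
have cs : GRing.comm c s by apply: scomm; apply: commrM; exact: commr_refl.
have [r [sr _ r2 rcomm]] := pos_sqrt ps.
have [v vE] : exists v, v = s - c by eexists.
have sv : star v = v by rewrite vE ustarB ss sc.
have vs : GRing.comm v s.
  by rewrite vE; apply/commr_sym/commrB; [exact: commr_refl|exact/commr_sym].
have vr : GRing.comm v r by apply: rcomm.
have cv : c * v = - (s * v) by rewrite vE !mulrBr cs s2 opprB.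
have xv0 : x * v = 0.
  apply: neg_starM_eq0.
  have -> : - (star (x * v) * (x * v)) = (r * v) * (r * v).
    rewrite ustarM sv -mulrA (mulrA _ x) -cE cv mulrN opprK -r2.
    by rewrite !mulrA vr.
  by apply: pos_square; rewrite ustarM sv sr.
have cv0 : c * v = 0 by rewrite cE -mulrA xv0 mulr0.
have sv0 : s * v = 0 by apply/eqP; rewrite -oppr_eq0 -cv cv0.
have v0 : v = 0.
  apply/unrm0_eq0/eqP; rewrite -sqrf_eq0 -unrm_sqr // {1}vE mulrBl cv0 sv0 subrr.
  by rewrite unrm0.
by move/eqP: vE; rewrite v0 eq_sym subr_eq0 => /eqP <-.
Qed.

Lemma scale1A : (1 : R)%:C%:A = 1 :> U.
Proof. by rewrite rmorph1 scale1r. Qed.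

(** For [w = g^2], [w (1 - w) = 1/4 - (w - 1/2)^2] bounds [|w (1 - w)|] by [1/4],
    and [(g (1 - w))^2 = w (1 - w) (1 - w)]. *)
Lemma norm_mul_sub_square_le_half g : star g = g -> N g <= 1 ->
  N (g * (1 - g * g)) <= 2^-1.
Proof.
move=> sg g1; have [w wE] : exists w, w = g * g by eexists.
have sw : star w = w by rewrite wE ustarM sg.
have w1 : N w <= 1 by rewrite wE unrm_sqr // expr_le1.
rewrite -wE; have [e eE] : exists e : U, e = 1 - w by eexists.
have pe : pos e by rewrite eE -scale1A; apply: pos_of_norm.
have e1 : N e <= 1.
  by rewrite eE wE; apply: unrm_sub_square1 => //; rewrite -wE.
have ge : GRing.comm g e.
  by rewrite eE wE; apply: commrB; [exact: commr1|apply: commrM; exact: commr_refl].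
have [z [sz _ z2 zcomm]] := pos_sqrt pe.
have gz : GRing.comm g z by exact: zcomm.
rewrite -eE.
have we : w * e = (g * z) * (g * z) by rewrite wE -z2 -!mulrA [z * (g * z)]mulrA -gz !mulrA.
have wele : N (w * e) <= 4^-1.
  apply: pos_le_scalar; first by rewrite we; apply: pos_square; rewrite ustarM sg sz.
  have -> : (4^-1)%:C%:A - w * e = (w - (2^-1)%:C%:A) * (w - (2^-1)%:C%:A).
    rewrite eE mulrBr mulr1 mulrBl !mulrBr -!scalerAl -!scalerAr !mulr1 !mul1r scalerAA.
    have -> : 2^-1 * 2^-1 = 4^-1 :> R by field.
    rewrite !opprB [RHS]addrC addrA [in RHS]addrACA -opprD; congr (_ - _).
    by rewrite {1}(scaler_half w) scalerDr.
  by apply: pos_square; rewrite ustarB ustarA sw.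
have : N (g * e) ^+ 2 <= 2^-1 ^+ 2.
  rewrite -unrm_sqr; last by rewrite ustarM sg pe.1 ge.
  have -> : g * e * (g * e) = w * e * e by rewrite wE -!mulrA [e * (g * e)]mulrA -ge !mulrA.
  apply: le_trans (unrmM _ _) _.
  have -> : 2^-1 ^+ 2 = 4^-1 * 1 :> R by field.
  exact: ler_pM.
by rewrite ler_sqr // ?nnegrE // invr_ge0.
Qed.

(** ** Approximate units and quotients by closed ideals *)

Section Ideal.
Variable K : U -> Prop.
Hypotheses (K0 : K 0) (Klin : forall c x y, K x -> K y -> K (c *: x + y))
  (Kl : forall a x, K x -> K (a * x)) (Kr : forall a x, K x -> K (x * a))
  (Kclosed : forall x, (forall e, 0 < e -> exists2 y, K y & N (x - y) <= e) -> K x).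

(** Replacing [k] by [k (1 - k^2 / M^2)], with [|k| <= M], halves the bound [M] on
    the norm and multiplies [k] by an element that is [1] modulo the ideal. *)
Lemma approximate_unit k n : star k = k -> K k -> exists u,
  [/\ star u = u, N u <= 1, K (1 - u), GRing.comm u k & N (k * u) <= N k / 2 ^+ n].
Proof.
move=> sk Kk; elim: n => [|n [e [se e1 Ke ek h]]].
  exists 1; split; rewrite ?ustar1 ?unrm1 ?subrr ?mulr1 ?expr0 ?divr1 //.
  exact/commr_sym/commr1.
have [M ME] : exists M, M = N k / 2 ^+ n by eexists.
have M0 : 0 <= M by rewrite ME divr_ge0 // exprn_ge0.
have ME' : N k / 2 ^+ n.+1 = M / 2 by rewrite ME exprSr invfM mulrA.
rewrite -ME in h; rewrite ME'.
have [M00|Mn0] := eqVneq M 0.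
  by exists e; split => //; rewrite M00 mul0r -M00.
have Mp : 0 < M by rewrite lt_neqAle eq_sym Mn0.
have [g gE] : exists g, g = M^-1%:C *: (k * e) by eexists.
have kg : k * e = M%:C *: g by rewrite gE scalerAA divff // scale1r.
have sg : star g = g by rewrite gE ustarZr ustarM se sk ek.
have g1 : N g <= 1.
  by rewrite gE unrmZr ger0_norm ?invr_ge0 // ler_pdivrMl // mulr1.
have gk : GRing.comm k g.
  by rewrite gE; apply/commZ/commrM; [exact: commr_refl|exact/commr_sym].
have ge : GRing.comm e g.
  by rewrite gE; apply/commZ/commrM; [|exact: commr_refl].
exists (e * (1 - g * g)); split.
- rewrite ustarM ustarB ustar1 ustarM sg se mulrBr mulrBl mulr1 mul1r.
  by rewrite mulrA ge -!mulrA ge.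
- apply: le_trans (unrmM _ _) _; rewrite -[leRHS]mul1r; apply: ler_pM => //.
  by apply: unrm_sub_square1 => //; rewrite unrm_sqr // expr_le1.
- have -> : 1 - e * (1 - g * g) = 1 *: (1 - e) + e * (g * g).
    by rewrite scale1r mulrBr mulr1 opprB addrA [RHS]addrAC addrC addrA addrAC.
  apply: Klin => //; apply: Kl; apply: Kl.
  by rewrite gE -[_ *: _]addr0; apply: Klin => //; apply: Kr.
- apply/commr_sym/commrM; first exact/commr_sym.
  by apply: commrB; [exact: commr1|exact: commrM].
- rewrite mulrA kg -scalerAl unrmZr ger0_norm // ler_pM2l //.
  exact: norm_mul_sub_square_le_half.
Qed.

Lemma approximate_unit_eps k e : star k = k -> K k -> 0 < e -> exists u,
  [/\ star u = u, N u <= 1, K (1 - u) & N (k * u) <= e].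
Proof.
move=> sk Kk e0.
have [u [su u1 Ku _ ku]] := @approximate_unit k (Num.bound (N k / e)) sk Kk.
exists u; split => //; apply: le_trans ku _.
rewrite ler_pdivrMr ?exprn_gt0 // mulrC -ler_pdivrMr //.
exact/ltW/upper_nthrootP.
Qed.

Lemma sqr_le_le e a : 0 < e -> N a ^+ 2 <= e ^+ 2 -> N a <= e.
Proof. by move=> e0; rewrite ler_sqr // nnegrE // ltW. Qed.

(** For [u] close to [1] modulo [K] in the sense of [approximate_unit_eps] for
    [k^*k], [k u] is small, hence so is [u k^*], and [(1 - u) k^*] is in [K]. *)
Lemma ideal_star k : K k -> K (star k).
Proof.
move=> Kk; apply: Kclosed => e e0.
have sh : star (star k * k) = star k * k by rewrite ustarM ustarK.
have [u [su u1 Ku hu]] := approximate_unit_eps sh (Kl (star k) Kk) (exprn_gt0 2 e0).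
exists ((1 - u) * star k).
  have -> : (1 - u) * star k = star k * 0 + (1 - u) * star k by rewrite mulr0 add0r.
  rewrite mulr0 add0r; exact: Kr.
rewrite mulrBl mul1r opprB addrC subrK.
have -> : u * star k = star (k * u) by rewrite ustarM su.
rewrite unrm_star; apply: sqr_le_le => //.
rewrite -unrm_starl ustarM su -mulrA (mulrA (star k)).
apply: le_trans (unrmM _ _) _; rewrite -[leRHS]mul1r; exact: ler_pM.
Qed.

(** Modulo [K], [b^*b] is at most [e] for every [e > 0]. The rest [h = k + j]
    is self-adjoint, hence equal to the self-adjoint part of [k], which is in [K].
    Take [u] with [1 - u] in [K] and [h u] small. Then
    [|b u|^2 = |u b^*b u| <= |u (e - h) u|] is small, and [b - b u] is in [K].
    The skew part [j] is allowed because the functionals used below are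
    defined on non-self-adjoint elements too. *)
Lemma ideal_of_dominated b :
  (forall e, 0 < e -> exists c k j,
     [/\ pos c, K k, star j = - j & e%:C%:A - star b * b = c + k + j]) -> K b.
Proof.
move=> hb; apply: Kclosed => e e0.
have e2 : 0 < e ^+ 2 / 2 by rewrite divr_gt0 ?exprn_gt0.
have [c [k [j [pc Kk sj E]]]] := hb _ e2.
set eps := e ^+ 2 / 2 in e2 E.
have [h hE] : exists h, h = k + j by eexists.
have E' : eps%:C%:A - h = star b * b + c.
  by apply/eqP; rewrite subr_eq -addrA [_ + h]addrC addrC -subr_eq E -addrA -hE [h + c]addrC.
have sh : star h = h.
  have -> : h = eps%:C%:A - star b * b - c.
    by rewrite E -(addrA c) -hE addrAC subrr add0r.
  by rewrite !ustarB ustarA ustarM ustarK pc.1.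
have Kh : K h.
  have -> : h = (2^-1)%:C *: k + ((2^-1)%:C *: star k + 0).
    rewrite addr0 -scalerDr {1}(scaler_half h) -{2}sh {1}hE hE ustarD sj.
    by rewrite addrACA subrr addr0.
  by apply: (Klin _ Kk); apply: Klin => //; exact: ideal_star.
have [u [su u1 Ku hu]] := approximate_unit_eps sh Kh e2.
exists (b * (1 - u)); first exact: Kl.
rewrite mulrBr mulr1 opprB addrC subrK; apply: sqr_le_le => //.
rewrite -unrm_starl.
have -> : e ^+ 2 = eps + eps by rewrite /eps; field.
have [r [sr _ r2 _]] := pos_sqrt pc.
apply: le_trans (_ : N (u * (eps%:C%:A - h) * u) <= _).
  apply: pos_le_norm; first exact: pos_starM.
  have -> : u * (eps%:C%:A - h) * u - star (b * u) * (b * u) = star (r * u) * (r * u).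
    rewrite E' !ustarM su sr mulrDr mulrDl -r2 !mulrA.
    by rewrite [LHS]addrC addKr.
  exact: pos_starM.
rewrite mulrBr mulrBl -scalerAr mulr1 -scalerAl.
apply: le_trans (unrmD _ _) _; rewrite unrmN unrmZr ger0_norm ?(ltW e2) //.
apply: lerD.
  rewrite -[leRHS]mulr1; apply: ler_wpM2l; first exact: ltW.
  by rewrite unrm_sqr // expr_le1.
by rewrite -mulrA; apply: le_trans (unrmM _ _) _; rewrite -[leRHS]mul1r; exact: ler_pM.
Qed.

End Ideal.
End Positive.

(** * Extreme functionals below a sublinear functional *)

Section Sublinear.
Variables (R : realType) (V : lmodType R[i]).
Implicit Types (p q f g : V -> R) (x y v w : V) (r s t : R).

Definition sublinear q :=
  (forall x y, q (x + y) <= q x + q y) /\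
  (forall r x, 0 < r -> q (r%:C *: x) = r * q x).

Definition real_linear f :=
  (forall x y, f (x + y) = f x + f y) /\ (forall r x, f (r%:C *: x) = r * f x).

Definition pointwise_le f g := forall x, f x <= g x.

(** Faces of the convex set of linear functionals below [p], each given by the
    sublinear functional [q] that it lies below. *)
Definition face p q :=
  [/\ sublinear q, pointwise_le q p &
    forall f g r, real_linear f -> real_linear g ->
      pointwise_le f p -> pointwise_le g p -> 0 < r < 1 ->
      (forall x, r * f x + (1 - r) * g x <= q x) ->
      pointwise_le f q /\ pointwise_le g q].

Definition extreme p f :=
  [/\ real_linear f, pointwise_le f p &
    forall g h r, real_linear g -> real_linear h ->
      pointwise_le g p -> pointwise_le h p -> 0 < r < 1 ->
      (forall x, f x = r * g x + (1 - r) * h x) -> g = f].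

Lemma sublinear0 q : sublinear q -> q 0 = 0.
Proof.
move=> [_ qZ]; have := qZ 2 0 (ltr0n _ 2); rewrite scaler0; lra.
Qed.

Lemma sublinear_ge q x : sublinear q -> - q (- x) <= q x.
Proof.
move=> sq; have := sq.1 x (- x); rewrite subrr sublinear0 //; lra.
Qed.

Lemma sublinearZ0 q r x : sublinear q -> 0 <= r -> q (r%:C *: x) = r * q x.
Proof.
move=> sq; rewrite le_eqVlt => /orP[/eqP <-|]; last exact: sq.2.
by rewrite scale0r mul0r sublinear0.
Qed.

(** The largest sublinear functional below [q] that is linear along [x]; it cuts
    out the face of the functionals [f <= q] with [f x = q x]. *)
Definition directional q x v :=
  inf [set q (v + t%:C *: x) - t * q x | t in [set t : R | 0 <= t]].

Section Directional.
Variables (q : V -> R) (x : V).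
Hypothesis sq : sublinear q.

Lemma directional_hasinf v :
  has_inf [set q (v + t%:C *: x) - t * q x | t in [set t : R | 0 <= t]].
Proof.
split; first by exists (q (v + 0%:C *: x) - 0 * q x), 0 => //=.
exists (- q (- v)) => _ [t /= t0 <-].
have := sq.1 (v + t%:C *: x) (- v).
rewrite addrAC subrr add0r sublinearZ0 //; lra.
Qed.

Lemma directional_le v t : 0 <= t -> directional q x v <= q (v + t%:C *: x) - t * q x.
Proof. by move=> t0; apply: ge_inf; [exact: (directional_hasinf v).2|exists t]. Qed.

Lemma directional_ge v r : (forall t, 0 <= t -> r <= q (v + t%:C *: x) - t * q x) ->
  r <= directional q x v.
Proof.
by move=> h; apply: lb_le_inf; [exact: (directional_hasinf v).1|move=> _ [t t0 <-]; exact: h].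
Qed.

Lemma directional_le_self : pointwise_le (directional q x) q.
Proof.
by move=> v; have := directional_le v (lexx 0); rewrite scale0r addr0 mul0r subr0.
Qed.

Lemma directional_opp : directional q x (- x) <= - q x.
Proof.
have := directional_le (- x) ler01.
by rewrite rmorph1 scale1r addNr sublinear0 // sub0r mul1r.
Qed.

Lemma directional_sublinear : sublinear (directional q x).
Proof.
split=> [v w|r v r0].
  rewrite -lerBlDr; apply: directional_ge => t t0.
  rewrite lerBlDr -lerBlDl; apply: directional_ge => s s0; rewrite lerBlDl.
  apply: le_trans (directional_le (v + w) (addr_ge0 t0 s0)) _.
  rewrite rmorphD /= scalerDl addrACA.
  have := sq.1 (v + t%:C *: x) (w + s%:C *: x); lra.
have aux r' v' : 0 < r' -> r' * directional q x v' <= directional q x (r'%:C *: v').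
  move=> r'0; apply: directional_ge => t t0.
  rewrite mulrC -ler_pdivlMr //.
  apply: le_trans (directional_le v' (divr_ge0 t0 (ltW r'0))) _.
  rewrite ler_pdivlMr // mulrBl -mulrA [q x * _]mulrC mulrA divfK ?gt_eqF //.
  rewrite lerD2r mulrC -sq.2 // scalerDr scalerA -rmorphM.
  by rewrite mulrCA divff ?gt_eqF // mulr1.
apply/eqP; rewrite eq_le aux // andbT.
have ri : 0 < r^-1 by rewrite invr_gt0.
have := aux _ (r%:C *: v) ri.
by rewrite scalerA -rmorphM mulVf ?gt_eqF // scale1r mulrC ler_pdivrMr // mulrC.
Qed.

Lemma directional_face p : face p q -> face p (directional q x).
Proof.
move=> [_ qp qface]; split.
- exact: directional_sublinear.
- by move=> v; apply: le_trans (directional_le_self v) _.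
- move=> f g r lf lg fp gp r01 h.
  have [fq gq] : pointwise_le f q /\ pointwise_le g q.
    apply: (qface f g r) => // v; exact: le_trans (h v) (directional_le_self v).
  have neg k (lk : real_linear k) v : k (- v) = - k v.
    by have := lk.2 (-1) v; rewrite rmorphN rmorph1 scaleN1r mulN1r.
  have hx := le_trans (h (- x)) directional_opp.
  rewrite !neg // in hx.
  have [r0 r1] := andP r01.
  have fx := fq x; have gx := gq x.
  have Ef : f x = q x by apply/eqP; rewrite eq_le fx /=; nra.
  have Eg : g x = q x by apply/eqP; rewrite eq_le gx /=; nra.
  have fin k : real_linear k -> pointwise_le k q -> k x = q x ->
      pointwise_le k (directional q x).
    move=> lk kq kx v; apply: directional_ge => t t0.
    by have := kq (v + t%:C *: x); rewrite lk.1 lk.2 kx lerBrDr.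
  by split; apply: fin.
Qed.

End Directional.

(** Zorn's lemma on the faces, ordered by decreasing sublinear functionals. A
    minimal [q] equals its directional functionals, so [q (- x) = - q x] for every
    [x]: it is linear, and as a face it is a single, hence extreme, functional.
    Starting from the face in the direction [x0] fixes the value there. This
    plays the role of the theorems of Hahn-Banach and Krein-Milman together. *)
Theorem extreme_exists p x0 : sublinear p -> exists2 f, extreme p f & f x0 = p x0.
Proof.
move=> sp.
have facep : face p p by split.
pose good q := face p q /\ q (- x0) <= - p x0.
pose T := {q : V -> R | good q}.
pose q0 : T := exist _ (directional p x0)
  (conj (directional_face x0 sp facep) (directional_opp x0 sp)).
pose ord (a b : T) := `[< pointwise_le (sval b) (sval a) >].
have [| |A tot|m hm] := @ZL_preorder T q0 ord.
- by move=> a; apply/asboolP => x.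
- by move=> a b c /asboolP h1 /asboolP h2; apply/asboolP => x; exact: le_trans (h2 x) (h1 x).
- have [[a0 Aa0]|A0] := pselect (exists a, A a); last first.
    by exists q0 => s As; exfalso; apply: A0; exists s.
  pose im x := [set sval a x | a in A].
  have him x : has_inf (im x).
    split; first by exists (sval a0 x), a0.
    exists (- p (- x)) => _ [a Aa <-].
    have [[sa ap _] _] := svalP a.
    by apply: le_trans (sublinear_ge x sa); rewrite lerN2.
  pose q x := inf (im x).
  have q_le a x : A a -> q x <= sval a x.
    by move=> Aa; apply: ge_inf; [exact: (him x).2|exists a].
  have q_ge x r : (forall a, A a -> r <= sval a x) -> r <= q x.
    by move=> h; apply: lb_le_inf; [exact: (him x).1|move=> _ [a Aa <-]; exact: h].
  have qgood : good q.
    split; last first.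
      by apply: le_trans (q_le a0 _ Aa0) _; have [_] := svalP a0.
    split.
    + split=> [x y|r x r0].
        rewrite -lerBlDr; apply: (q_ge x) => a Aa.
        rewrite lerBlDr -lerBlDl; apply: q_ge => b Ab; rewrite lerBlDl.
        have [[[sa _] _ _] _] := svalP a; have [[[sb _] _ _] _] := svalP b.
        have [/asboolP ab|/asboolP ba] := tot a b Aa Ab.
          apply: le_trans (q_le b _ Ab) _; apply: le_trans (sb _ _) _.
          by rewrite lerD2r; exact: ab.
        apply: le_trans (q_le a _ Aa) _; apply: le_trans (sa _ _) _.
        by rewrite lerD2l; exact: ba.
      apply/eqP; rewrite eq_le; apply/andP; split.
        rewrite mulrC -ler_pdivrMr //; apply: q_ge => a Aa.
        rewrite ler_pdivrMr // mulrC.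
        by have [[[_ sa] _ _] _] := svalP a; rewrite -sa //; exact: q_le.
      apply: q_ge => a Aa; have [[[_ sa] _ _] _] := svalP a; rewrite sa //.
      by rewrite ler_pM2l //; exact: q_le.
    + move=> x; apply: le_trans (q_le a0 _ Aa0) _.
      by have [[_ h _] _] := svalP a0; exact: h.
    + move=> f g r lf lg fp gp r01 h.
      have fg a : A a -> pointwise_le f (sval a) /\ pointwise_le g (sval a).
        move=> Aa; have [[_ _ ha] _] := svalP a; apply: (ha f g r) => // x.
        exact: le_trans (h x) (q_le _ _ Aa).
      by split=> x; apply: q_ge => a /fg[h1 h2].
  exists (exist _ q qgood) => a Aa; apply/asboolP => x; exact: q_le.
- have [fm m0] := svalP m; set f := sval m in fm m0.
  have [sf fp ff] := fm.
  have fN x : f (- x) = - f x.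
    apply/eqP; rewrite eq_le; apply/andP; split; last first.
      by have := sublinear_ge (- x) sf; rewrite opprK.
    have gd : good (directional f x).
      split; first exact: directional_face.
      by apply: le_trans m0; exact: directional_le_self.
    have : ord m (exist _ _ gd) by apply/asboolP; exact: directional_le_self.
    move=> /hm/asboolP/(_ (- x)) /= h.
    exact: le_trans h (directional_opp x sf).
  have lf : real_linear f.
    split=> [x y|r x].
      apply/eqP; rewrite eq_le sf.1 /=.
      have := sf.1 (x + y) (- y); rewrite addrK fN; lra.
    have [r0|r0] := leP 0 r; first exact: sublinearZ0.
    have := sublinearZ0 x sf (ltW (_ : 0 < - r)); rewrite oppr_gt0 => /(_ r0).
    by rewrite rmorphN scaleNr fN; lra.
  exists f.
    split=> // g h r lg lh gp hp r01 E.
    have [gf _] : pointwise_le g f /\ pointwise_le h f.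
      by apply: (ff g h r) => // x; rewrite -E.
    apply/funext => x; apply/eqP; rewrite eq_le gf /=.
    have gN : g (- x) = - g x.
      by have := lg.2 (-1) x; rewrite rmorphN rmorph1 scaleN1r mulN1r.
    by have := gf (- x); rewrite fN gN lerN2.
  apply/eqP; rewrite eq_le fp /=.
  by move: m0; rewrite fN lerN2.
Qed.

End Sublinear.

(** * Pure states *)

Section PureState.
Variables (R : realType) (U : unital_cstar R) (K : U -> Prop).
Local Notation N := (@unrm R U).
Local Notation star := (@ustar R U).
Hypotheses (K0 : K 0) (Klin : forall c x y, K x -> K y -> K (c *: x + y))
  (Kl : forall a x, K x -> K (a * x)) (Kr : forall a x, K x -> K (x * a))
  (Kclosed : forall x, (forall e, 0 < e -> exists2 y, K y & N (x - y) <= e) -> K x).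
Variable b : U.
Hypothesis Kb : ~ K b.
Implicit Types (x y u v : U) (r s lam mu e : R).

Definition positive_mod (g : U -> R[i]) :=
  [/\ forall c x y, g (c *: x + y) = c * g x + g y,
      forall x, g (star x) = (g x)^*,
      forall x, 0 <= g (star x * x) &
      forall x, K x -> g x = 0].

(** A real-linear functional that is nonnegative on this cone is positive, and it
    vanishes on [K] and on the skew elements, since these form subspaces. *)
Let cone u := exists c k j, [/\ pos c, K k, star j = - j & u = c + k + j].

Let coneD u v : cone u -> cone v -> cone (u + v).
Proof.
move=> [c [k [j [pc Kk sj ->]]]] [c' [k' [j' [pc' Kk' sj' ->]]]].
exists (c + c'), (k + k'), (j + j'); split.
- exact: posD.
- by rewrite -[k]scale1r; exact: Klin.
- by rewrite ustarD sj sj' opprD.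
- by rewrite addrACA; congr (_ + _); rewrite addrACA.
Qed.

Let coneZ r u : 0 <= r -> cone u -> cone (r%:C *: u).
Proof.
move=> r0 [c [k [j [pc Kk sj ->]]]].
exists (r%:C *: c), (r%:C *: k), (r%:C *: j); split.
- exact: posZ.
- by rewrite -[_ *: k]addr0; exact: Klin.
- by rewrite ustarZr sj scalerN.
- by rewrite !scalerDr.
Qed.

Let cone_pos u : pos u -> cone u.
Proof. by move=> pu; exists u, 0, 0; split; rewrite ?ustar0 ?oppr0 ?addr0. Qed.

Let cone_skew u : star u = - u -> cone u.
Proof.
move=> su; exists 0, 0, u; split; rewrite ?addr0 ?add0r //.
by rewrite -[0](scale0r 1); apply: (@posA _ _ 0).
Qed.

Let cone_ideal u : K u -> cone u.
Proof.
move=> Ku; exists 0, u, 0; split; rewrite ?ustar0 ?oppr0 ?addr0 ?add0r //.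
by rewrite -[0](scale0r 1); apply: (@posA _ _ 0).
Qed.

Let cone_scalar_ge0 r : cone (r%:C%:A) -> 0 <= r.
Proof.
move=> Cr; rewrite leNgt; apply/negP => r0; apply: Kb.
apply: (ideal_of_dominated K0 Klin Kl Kr Kclosed) => e e0.
pose n := N (star b * b).
have -> : e%:C%:A - star b * b = (n%:C%:A - star b * b) + (e - n)%:C%:A.
  by rewrite scalerAB [RHS]addrC addrA subrK.
apply: coneD.
  by apply: cone_pos; apply: pos_of_norm; rewrite // ustarM ustarK.
have [en|en] := leP 0 (e - n); first by apply: cone_pos; exact: posA.
have -> : e - n = ((e - n) / r) * r by rewrite divfK // lt_eqF.
by rewrite -scalerAA; apply: coneZ => //; rewrite nmulr_rge0 // invr_le0 ltW.
Qed.

Let dom u := [set lam : R | cone (lam%:C%:A - u)].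
Let p u := inf (dom u).

Let dom_nonempty u : exists lam, dom u lam.
Proof.
pose h := (2^-1)%:C *: (u + star u).
exists (N h); rewrite /dom /=.
have -> : (N h)%:C%:A - u = ((N h)%:C%:A - h) + (h - u) by rewrite addrA subrK.
have sh : star h = h by rewrite ustarZr ustarD ustarK addrC.
apply: coneD; first by apply: cone_pos; exact: pos_of_norm.
apply: cone_skew; rewrite ustarB sh opprB.
apply/eqP; rewrite subr_eq eq_sym addrAC subr_eq; apply/eqP.
by rewrite /h -scalerDr -scaler_half.
Qed.

Let dom_hasinf u : has_inf (dom u).
Proof.
split; first exact: dom_nonempty.
have [mu hmu] := dom_nonempty (- u).
exists (- mu) => lam hlam; rewrite -subr_ge0 opprK; apply: cone_scalar_ge0.
by rewrite scalerAD; have := coneD hlam hmu; rewrite opprK addrACA addNr addr0.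
Qed.

Let p_le u lam : cone (lam%:C%:A - u) -> p u <= lam.
Proof. by move=> h; apply: ge_inf => //; exact: (dom_hasinf u).2. Qed.

Let p_ge u r : (forall lam, cone (lam%:C%:A - u) -> r <= lam) -> r <= p u.
Proof. by move=> h; apply: lb_le_inf => //; exact: dom_nonempty. Qed.

Let p_sublinear : sublinear p.
Proof.
split=> [u v|r u r0].
  rewrite -lerBlDr; apply: (@p_ge u) => lam hlam.
  rewrite lerBlDr -lerBlDl; apply: (@p_ge v) => mu hmu; rewrite lerBlDl.
  by apply: p_le; rewrite scalerAD opprD addrACA; exact: coneD.
have aux s v : 0 < s -> p (s%:C *: v) <= s * p v.
  move=> s0; rewrite -ler_pdivrMl //; apply: (@p_ge v) => lam hlam.
  rewrite ler_pdivrMl //; apply: p_le.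
  by rewrite -scalerAA -scalerBr; apply: coneZ => //; exact: ltW.
apply/eqP; rewrite eq_le aux //=.
have ri : 0 < r^-1 by rewrite invr_gt0.
have := aux _ (r%:C *: u) ri.
by rewrite scalerAA mulVf ?gt_eqF // scale1r ler_pdivlMl.
Qed.

Let cone_ge0 f u : real_linear f -> pointwise_le f p -> cone u -> 0 <= f u.
Proof.
move=> lf fp Cu.
have fN v : f (- v) = - f v.
  by have := lf.2 (-1) v; rewrite rmorphN rmorph1 scaleN1r mulN1r.
rewrite -oppr_le0 -fN; apply: le_trans (fp _) _; apply: p_le.
by rewrite rmorph0 scale0r opprK add0r.
Qed.

Let le_p f : real_linear f -> f 1 = 1 -> (forall u, cone u -> 0 <= f u) ->
  pointwise_le f p.
Proof.
move=> lf f1 fC u; apply: p_ge => lam /fC.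
have fN v : f (- v) = - f v.
  by have := lf.2 (-1) v; rewrite rmorphN rmorph1 scaleN1r mulN1r.
by rewrite lf.1 lf.2 fN f1 mulr1 subr_ge0.
Qed.

Let positive_mod_cone g u : positive_mod g -> cone u -> 0 <= complex.Re (g u).
Proof.
move=> [glin gst gpos gK] [c [k [j [pc Kk sj ->]]]].
have gD x y : g (x + y) = g x + g y by rewrite -{1}[x]scale1r glin mul1r.
have g0 : g 0 = 0 by exact: gK.
have gZ c' x : g (c' *: x) = c' * g x by rewrite -[_ *: x]addr0 glin g0 addr0.
rewrite !gD (gK k Kk) addr0.
have Rj : complex.Re (g j) = 0.
  have := gst j; rewrite sj -scaleN1r gZ mulN1r.
  case: (g j) => a d /(congr1 (@complex.Re R)) /= E; lra.
have [y [sy _ <- _]] := pos_sqrt pc.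
have := gpos y; rewrite sy.
by move: Rj; case: (g j) (g (y * y)) => [? ?] [? ?] /= ->; rewrite addr0 lecE /= => /andP[].
Qed.

(** The functionals below the gauge [p] of the cone are the real parts of states
    vanishing on [K]. An extreme one attaining [p (b^*b)] is nonzero at [b^*b],
    because [p (b^*b) <= 0] would put [b] in [K] by [ideal_of_dominated]. If it is
    [g + h], then [g / g 1] and [h / h 1] are below [p] too, and extremality
    makes both equal to it. *)
Lemma pure_state_exists : exists F : U -> R[i],
  [/\ positive_mod F, F 1 = 1, F (star b * b) <> 0 &
    forall g h, positive_mod g -> positive_mod h ->
      (forall u, F u = g u + h u) -> 0 < complex.Re (g 1) < 1 ->
      forall u, g u = g 1 * F u].
Proof.
have [f [lf fp fext] fb] := extreme_exists (star b * b) p_sublinear.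
have fN v : f (- v) = - f v.
  by have := lf.2 (-1) v; rewrite rmorphN rmorph1 scaleN1r mulN1r.
have fC u : cone u -> 0 <= f u by exact: cone_ge0.
have f0 u : cone u -> cone (- u) -> f u = 0.
  by move=> /fC h1 /fC; rewrite fN => h2; apply/eqP; rewrite eq_le h1 andbT; lra.
have fK u : K u -> f u = 0.
  by move=> Ku; apply: f0; apply: cone_ideal => //; rewrite -scaleN1r -[_ *: _]addr0; exact: Klin.
have fskew u : star u = - u -> f u = 0.
  by move=> su; apply: f0; apply: cone_skew; rewrite // ustarN su.
have f1 : f 1 = 1.
  have C0 : cone 0 by exact: cone_ideal.
  apply/eqP; rewrite eq_le; apply/andP; split.
    by apply: le_trans (fp _) _; apply: p_le; rewrite scale1A subrr.
  rewrite -lerN2 -fN; apply: le_trans (fp _) _; apply: p_le.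
  by rewrite rmorphN rmorph1 scaleN1r subrr.
have fst u : f (star u) = f u.
  have : f (star u - u) = 0 by apply: fskew; rewrite ustarB ustarK opprB.
  by rewrite lf.1 fN => h; lra.
have fbpos : 0 < f (star b * b).
  rewrite fb ltNge; apply/negP => pb; apply: Kb.
  apply: (ideal_of_dominated K0 Klin Kl Kr Kclosed) => e e0.
  have [lam hlam lame] := inf_adherent e0 (dom_hasinf (star b * b)).
  have -> : e%:C%:A - star b * b = (lam%:C%:A - star b * b) + (e - lam)%:C%:A.
    by rewrite scalerAB [RHS]addrC addrA subrK.
  apply: coneD => //; apply: cone_pos; apply: posA.
  by rewrite subr_ge0 ltW // (lt_le_trans lame) // gerDr.
pose F u := Complex (f u) (- f ('i *: u)).
have FE g u : (forall c x y, g (c *: x + y) = c * g x + g y) -> g 0 = 0 ->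
    g u = Complex (complex.Re (g u)) (- complex.Re (g ('i *: u))) :> R[i].
  move=> gl g0; rewrite -['i *: u]addr0 gl g0 addr0 -complexiE.
  by case: (g u) => a d /=; rewrite mul0r mul1r sub0r opprK.
have Flin c x y : F (c *: x + y) = c * F x + F y.
  case: c => r s.
  have cE : r +i* s = r%:C + s%:C * 'i :> R[i].
    by rewrite [LHS]complexE /= complexiE mulrC.
  rewrite /F cE !scalerDr !scalerDl -!scalerA !scalerDr.
  have -> : 'i *: (r%:C *: x) = r%:C *: ('i *: x) by rewrite !scalerA mulrC.
  have -> : 'i *: (s%:C *: ('i *: x)) = - (s%:C *: x).
    by rewrite !scalerA mulrAC -expr2 sqrCi mulN1r scaleNr.
  rewrite !lf.1 !fN !lf.2 -cE; apply/eqP; rewrite eq_complex /=.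
  by apply/andP; split; apply/eqP; ring.
exists F; split.
- split.
  + exact: Flin.
  + move=> x; rewrite /F fst.
    have -> : 'i *: star x = - star ('i *: x) by rewrite ustarZi opprK.
    by rewrite fN fst.
  + move=> x; rewrite lecE /= fC ?andbT; last exact/cone_pos/pos_starM.
    by rewrite fskew ?oppr0 // ustarZi ustarM ustarK.
  + by move=> x Kx; rewrite /F !fK ?oppr0 // -[_ *: _]addr0; exact: Klin.
- by rewrite /F f1 fskew ?oppr0 // ustarZi ustar1.
- by move=> [E _]; move: fbpos; rewrite E ltxx.
move=> g h pg ph E.
set r := complex.Re (g 1) => /andP[r0 r1].
have [glin gst _ gK] := pg; have [hlin hst _ hK] := ph.
have real g' : positive_mod g' -> g' 1 = (complex.Re (g' 1))%:C.
  move=> [_ gst' _ _]; have := gst' 1; rewrite ustar1.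
  by case: (g' 1) => a d /(congr1 (@complex.Im R)) /= k; congr (_ +i* _); lra.
have Relin s g' : positive_mod g' -> real_linear (fun u => s * complex.Re (g' u)).
  move=> [gl _ _ gK']; split=> [x y|t x].
    rewrite -{1}[x]scale1r gl mul1r -mulrDr; congr (_ * _).
    by case: (g' x) (g' y) => [? ?] [? ?].
  rewrite -[_ *: x]addr0 gl (gK' 0 K0) addr0; case: (g' x) => a d /=.
  by rewrite mul0r subr0 mulrCA.
have FR u : f u = complex.Re (g u) + complex.Re (h u).
  by have := congr1 (@complex.Re R) (E u); case: (g u) (h u) => [? ?] [? ?].
have hr : complex.Re (h 1) = 1 - r by have := FR 1; rewrite f1 -/r; lra.
have below s g' : positive_mod g' -> 0 < s -> complex.Re (g' 1) = s ->
    pointwise_le (fun u => s^-1 * complex.Re (g' u)) p.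
  move=> pg' s0 gs; apply: le_p; first exact: Relin.
    by rewrite gs mulVf // gt_eqF.
  by move=> u Cu; rewrite mulr_ge0 ?invr_ge0 ?(ltW s0) //; exact: positive_mod_cone.
have s0 : 0 < 1 - r by rewrite subr_gt0.
have gf := fext _ _ r (Relin r^-1 g pg) (Relin (1 - r)^-1 h ph) (below r g pg r0 erefl)
  (below (1 - r) h ph s0 hr).
have {}gf : (fun u => r^-1 * complex.Re (g u)) = f.
  apply: gf; first by rewrite r0.
  by move=> x; rewrite !mulrA !divff ?gt_eqF // !mul1r FR.
have gr u : complex.Re (g u) = r * f u.
  by rewrite -gf mulrA divff ?gt_eqF // mul1r.
move=> u; rewrite (real g pg) -/r (FE g u glin (gK _ K0)) !gr /F.
by apply/eqP; rewrite eq_complex /= !mul0r subr0 addr0 mulrN !eqxx.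
Qed.

End PureState.

(** * Unitization *)

Record cstar_algebra (R : realType) := CstarAlgebra {
  cs_sort :> completeNormedModType R[i];
  cmul : {bilinear cs_sort -> cs_sort -> cs_sort};
  cstar : {linear cs_sort -> cs_sort | Num.conj \; *:%R};
  cmulA : forall a b c, cmul (cmul a b) c = cmul a (cmul b c);
  cmul_norm : forall a b, `|cmul a b| <= `|a| * `|b|;
  cstarK : forall a, cstar (cstar a) = a;
  cstarM : forall a b, cstar (cmul a b) = cmul (cstar b) (cstar a);
  cstar_normE : forall a, `|cstar a| = `|a|;
  cmul_starl_norm : forall a, `|cmul (cstar a) a| = `|a| ^+ 2 }.

Definition unitization (R : realType) (A : cstar_algebra R) : Type := (A * R[i])%type.

Section Unitization.
Variables (R : realType) (A : cstar_algebra R).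
Local Notation U := (unitization A).
Local Notation mul := (@cmul R A).
Local Notation star := (@cstar R A).
Implicit Types (a b x y : A) (u v w : U) (c : R[i]) (r e M : R).

HB.instance Definition _ := GRing.Lmodule.copy U (A * R[i]^o)%type.

Definition unit_one : U := (0, 1).
Definition unit_mul u v : U :=
  (mul u.1 v.1 + u.2 *: v.1 + v.2 *: u.1, u.2 * v.2).

Lemma unit_mulA : associative unit_mul.
Proof.
move=> [a c] [b d] [x e]; rewrite /unit_mul /=; congr (_, _); last by rewrite mulrA.
rewrite !linearDr !linearDl /= !linearZr /= !linearZl /= !scalerDr cmulA !scalerA.
rewrite -!addrA (mulrC e c) (mulrC e d); congr (_ + _).
rewrite [RHS]addrCA; congr (_ + _); rewrite [LHS]addrCA; congr (_ + _).
by rewrite addrCA.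
Qed.

Lemma unit_mul1 : left_id unit_one unit_mul.
Proof.
by move=> [a c]; rewrite /unit_mul /= linear0l add0r scale1r scaler0 addr0 mul1r.
Qed.

Lemma unit_mulr1 : right_id unit_one unit_mul.
Proof.
by move=> [a c]; rewrite /unit_mul /= linear0r add0r scale1r scaler0 add0r mulr1.
Qed.

Lemma unit_mulDl : left_distributive unit_mul +%R.
Proof.
move=> [a c] [b d] [x e]; rewrite /unit_mul /= mulrDl linearDl /= scalerDl scalerDr.
congr (_, _); rewrite [RHS]addrACA; congr (_ + _); by rewrite addrACA.
Qed.

Lemma unit_mulDr : right_distributive unit_mul +%R.
Proof.
move=> [a c] [b d] [x e]; rewrite /unit_mul /= mulrDr linearDr /= scalerDr scalerDl.
congr (_, _); rewrite [RHS]addrACA; congr (_ + _); by rewrite addrACA.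
Qed.

Lemma unit_one_neq0 : unit_one != 0.
Proof. by apply/eqP => -[/eqP]; rewrite oner_eq0. Qed.

HB.instance Definition _ := GRing.Zmodule_isNzRing.Build U
  unit_mulA unit_mul1 unit_mulr1 unit_mulDl unit_mulDr unit_one_neq0.

Lemma unit_scaleAl c u v : c *: (u * v) = c *: u * v.
Proof.
case: u v => [a d] [b e]; congr (_, _) => /=; last by rewrite /GRing.scale /= mulrA.
rewrite linearZl /= !scalerDr scalerA; congr (_ + _).
by rewrite !scalerA mulrC.
Qed.

HB.instance Definition _ := GRing.Lmodule_isLalgebra.Build R[i] U unit_scaleAl.

Lemma unit_scaleAr c u v : c *: (u * v) = u * (c *: v).
Proof.
case: u v => [a d] [b e]; congr (_, _) => /=.
  by rewrite linearZr /= !scalerDr !scalerA (mulrC d).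
by rewrite /GRing.scale /= mulrCA.
Qed.

HB.instance Definition _ := GRing.Lalgebra_isAlgebra.Build R[i] U unit_scaleAr.

Definition unit_star u : U := (star u.1, u.2^*).

Definition unit_act u x : A := mul u.1 x + u.2 *: x.

Lemma unit_actD u v x : unit_act (u + v) x = unit_act u x + unit_act v x.
Proof. by rewrite /unit_act /= linearDl /= scalerDl addrACA. Qed.

Lemma unit_actZ c u x : unit_act (c *: u) x = c *: unit_act u x.
Proof. by rewrite /unit_act /= linearZl /= scalerDr scalerA. Qed.

Lemma unit_actM u v x : unit_act (u * v) x = unit_act u (unit_act v x).
Proof.
rewrite /unit_act /= !linearDl linearDr !linearZl /= linearZr /= scalerDr !scalerA.
rewrite cmulA -!addrA; congr (_ + _).
by rewrite [LHS]addrCA.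
Qed.

Lemma cstarMZ u x y : mul (star (unit_act u x)) y = mul (star x) (unit_act (unit_star u) y).
Proof.
rewrite /unit_act /= linearD linearZ /= cstarM linearDl linearZl linearDr linearZr /=.
by rewrite cmulA.
Qed.

Lemma nr_cmul a b : nr (mul a b) <= nr a * nr b.
Proof. by rewrite -lecR rmorphM /= !nrE cmul_norm. Qed.

Lemma nr_cstar a : nr (star a) = nr a.
Proof. by rewrite /nr cstar_normE. Qed.

Lemma nr_cmul_star a : nr (mul (star a) a) = nr a ^+ 2.
Proof. by apply: complexI; rewrite rmorphXn /= !nrE cmul_starl_norm. Qed.

Let val u (i : option A) : R := if i is Some x then nr (unit_act u x) else cabs u.2.
Let wgt (i : option A) : R := if i is Some x then nr x else 1.
(** The operator norm of left multiplication, together with the modulus of the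
    scalar part: the latter makes it a norm also when [A] already has a unit. *)
Definition unit_nrm u : R := best_const (val u) wgt.

Let wgt_ge0 i : 0 <= wgt i.
Proof. by case: i => [x|] /=; [exact: nr_ge0 | exact: ler01]. Qed.

Lemma unit_nrm_le u M : 0 <= M -> (forall x, nr (unit_act u x) <= M * nr x) ->
  cabs u.2 <= M -> unit_nrm u <= M.
Proof.
by move=> M0 h1 h2; apply: best_const_le; split => // -[x|] /=; rewrite ?mulr1.
Qed.

Lemma unit_nrmP u : [/\ 0 <= unit_nrm u,
  forall x, nr (unit_act u x) <= unit_nrm u * nr x & cabs u.2 <= unit_nrm u].
Proof.
have [|h0 h] := @best_constP _ _ (val u) wgt wgt_ge0.
  exists (nr u.1 + cabs u.2); split.
    by rewrite addr_ge0 ?nr_ge0 ?cabs_ge0.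
  case=> [x|] /=; last by rewrite mulr1 lerDr nr_ge0.
  apply: le_trans (nrD _ _) _; rewrite nrZ mulrDl lerD2r; exact: nr_cmul.
split=> // [x|]; first exact: (h (Some x)).
by have := h None; rewrite mulr1.
Qed.

Lemma unit_nrm_ge0 u : 0 <= unit_nrm u.
Proof. by have [] := unit_nrmP u. Qed.

Lemma unit_nrm_pair a c : unit_nrm (a, c) <= nr a + cabs c.
Proof.
apply: unit_nrm_le => /=; last by rewrite lerDr nr_ge0.
  by rewrite addr_ge0 ?nr_ge0 ?cabs_ge0.
by move=> x; apply: le_trans (nrD _ _) _; rewrite nrZ mulrDl lerD2r; exact: nr_cmul.
Qed.

Lemma unit_nrmD u v : unit_nrm (u + v) <= unit_nrm u + unit_nrm v.
Proof.
have [u0 u1 u2] := unit_nrmP u; have [v0 v1 v2] := unit_nrmP v.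
apply: unit_nrm_le; first exact: addr_ge0.
  move=> x; rewrite unit_actD mulrDl; apply: le_trans (nrD _ _) _; exact: lerD.
by apply: le_trans (cabsD _ _) _; exact: lerD.
Qed.

Lemma unit_nrmZ_le c u : unit_nrm (c *: u) <= cabs c * unit_nrm u.
Proof.
have [u0 u1 u2] := unit_nrmP u; apply: unit_nrm_le.
- by rewrite mulr_ge0 ?cabs_ge0.
- by move=> x; rewrite unit_actZ nrZ -mulrA ler_wpM2l ?cabs_ge0.
- by rewrite [(c *: u).2]/(c * u.2) cabsM ler_wpM2l ?cabs_ge0.
Qed.

Lemma unit_nrmZ c u : unit_nrm (c *: u) = cabs c * unit_nrm u.
Proof.
apply/eqP; rewrite eq_le unit_nrmZ_le /=.
have [->|c0] := eqVneq c 0; first by rewrite cabs0 mul0r unit_nrm_ge0.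
have := unit_nrmZ_le c^-1 (c *: u); rewrite scalerA mulVf // scale1r => h.
have cp : 0 < cabs c.
  by rewrite lt_neqAle cabs_ge0 andbT eq_sym; apply: contra c0 => /eqP/cabs0_eq0 ->.
apply: le_trans (ler_wpM2l (ltW cp) h) _.
by rewrite mulrA -cabsM divff // cabs1 mul1r.
Qed.

Lemma unit_nrmM u v : unit_nrm (u * v) <= unit_nrm u * unit_nrm v.
Proof.
have [u0 u1 u2] := unit_nrmP u; have [v0 v1 v2] := unit_nrmP v.
apply: unit_nrm_le; first exact: mulr_ge0.
  move=> x; rewrite unit_actM -mulrA; apply: le_trans (u1 _) _; exact: ler_wpM2l.
by rewrite /= cabsM; apply: ler_pM; rewrite ?cabs_ge0.
Qed.

Lemma unit_star_lin c u v : unit_star (c *: u + v) = c^* *: unit_star u + unit_star v.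
Proof.
by congr (_, _) => /=; rewrite ?linearP // rmorphD rmorphM.
Qed.

Lemma unit_starM u v : unit_star (u * v) = unit_star v * unit_star u.
Proof.
case: u v => [a c] [b d]; congr (_, _) => /=; last by rewrite rmorphM mulrC.
by rewrite !linearD /= !linearZ /= cstarM addrAC.
Qed.

Lemma unit_starK u : unit_star (unit_star u) = u.
Proof. by case: u => a c; rewrite /unit_star /= cstarK conjCK. Qed.

Lemma unit_nrm_starl_ge u : unit_nrm u ^+ 2 <= unit_nrm (unit_star u * u).
Proof.
have [v0 v1 v2] := unit_nrmP (unit_star u * u); set t := unit_nrm (_ * _) in v0 v1 v2 *.
have sq (r : R) : 0 <= r -> r ^+ 2 <= t -> r <= Num.sqrt t.
  by move=> x0 h; rewrite -(ger0_norm x0) -sqrtr_sqr ler_wsqrtr.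
have h : unit_nrm u <= Num.sqrt t.
  apply: unit_nrm_le; first exact: sqrtr_ge0.
    move=> x; rewrite -(@ler_sqr _ (nr _)) ?nnegrE ?nr_ge0 ?mulr_ge0 ?sqrtr_ge0 ?nr_ge0 //.
    rewrite exprMn sqr_sqrtr // -nr_cmul_star cstarMZ -unit_actM.
    apply: le_trans (nr_cmul _ _) _; rewrite nr_cstar mulrC expr2 mulrA.
    by rewrite ler_wpM2r ?nr_ge0.
  by apply: sq; [exact: cabs_ge0|]; move: v2; rewrite /= cabsM cabs_conj expr2.
rewrite -[leRHS](sqr_sqrtr v0) ler_sqr // nnegrE ?sqrtr_ge0 ?unit_nrm_ge0 //.
Qed.

Lemma unit_nrm_star u : unit_nrm (unit_star u) = unit_nrm u.
Proof.
suff h w : unit_nrm w <= unit_nrm (unit_star w).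
  by apply/eqP; rewrite eq_le -{2}(unit_starK u) !h.
have := le_trans (unit_nrm_starl_ge w) (unit_nrmM _ _); rewrite expr2.
have [->|y0] := eqVneq (unit_nrm w) 0; first by rewrite unit_nrm_ge0.
by rewrite ler_pM2r // lt_neqAle eq_sym y0 /= unit_nrm_ge0.
Qed.

Lemma unit_nrm_starl u : unit_nrm (unit_star u * u) = unit_nrm u ^+ 2.
Proof.
apply/eqP; rewrite eq_le unit_nrm_starl_ge andbT.
by apply: le_trans (unit_nrmM _ _) _; rewrite unit_nrm_star expr2.
Qed.

Lemma nr_le_unit_nrm a : nr a <= unit_nrm (a, 0).
Proof.
have [h0 h _] := unit_nrmP (a, 0); have := h (star a).
rewrite /unit_act /= scale0r addr0 nr_cstar -{1}(cstarK a) nr_cmul_star nr_cstar expr2.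
have [->|a0] := eqVneq (nr a) 0; first by rewrite h0.
by rewrite ler_pM2r // lt_neqAle eq_sym a0 nr_ge0.
Qed.

Lemma unit_nrm_inj a : unit_nrm (a, 0) = nr a.
Proof.
apply/eqP; rewrite eq_le nr_le_unit_nrm andbT.
by apply: le_trans (unit_nrm_pair _ _) _; rewrite cabs0 addr0.
Qed.

Lemma unit_fst_le u : nr u.1 <= unit_nrm u + unit_nrm u.
Proof.
have [u0 u1 u2] := unit_nrmP u; rewrite -unit_nrm_inj.
have -> : (u.1, 0) = u + (- u.2) *: (1 : U).
  case: u {u0 u1 u2} => a c; congr (_, _) => /=.
    by rewrite scaler0 addr0.
  by rewrite /GRing.scale /= mulr1 subrr.
apply: le_trans (unit_nrmD _ _) _; rewrite lerD2l; apply: le_trans (unit_nrmZ_le _ _) _.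
rewrite cabsN -[leRHS]mulr1; apply: ler_pM; rewrite ?cabs_ge0 ?unit_nrm_ge0 //.
by apply: le_trans (unit_nrm_pair _ _) _; rewrite nr0 add0r cabs1.
Qed.

Lemma unit_nrm0_eq0 u : unit_nrm u = 0 -> u = 0.
Proof.
move=> u0; have [_ _] := unit_nrmP u; have := unit_fst_le u.
case: u u0 => a c u0 /=; rewrite u0 addr0 => a0 c0.
have -> : a = 0 by apply/nr0_eq0/le_anti; rewrite a0 nr_ge0.
by have -> : c = 0 by apply/cabs0_eq0/le_anti; rewrite c0 cabs_ge0.
Qed.

Lemma unit_complete (u : nat -> U) :
  (forall e, 0 < e -> exists n0 : nat, forall n m, (n0 <= n)%N -> (n <= m)%N ->
     unit_nrm (u m - u n) <= e) ->
  exists l, forall e, 0 < e -> exists n0 : nat, forall n, (n0 <= n)%N ->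
     unit_nrm (u n - l) <= e.
Proof.
move=> h.
have [|a ha] := @nr_complete R A (fun n => (u n).1).
  move=> e e0; have [n0 hn0] := h (e / 2) (divr_gt0 e0 (ltr0n _ 2)); exists n0 => n m n0n nm.
  apply: le_trans (unit_fst_le (u m - u n)) _.
  have -> : e = e / 2 + e / 2 by field.
  by apply: lerD; apply: hn0.
have [|c hc] := @complex_complete R (fun n => (u n).2).
  move=> e e0; have [n0 hn0] := h e e0; exists n0 => n m n0n nm.
  have [_ _ k] := unit_nrmP (u m - u n); apply: le_trans k _; exact: hn0.
exists (a, c) => e e0.
have e2 : 0 < e / 2 by rewrite divr_gt0.
have [n1 h1] := ha _ e2; have [n2 h2] := hc _ e2.
exists (maxn n1 n2) => n; rewrite geq_max => /andP[/h1 {}h1 /h2 {}h2].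
have -> : u n - (a, c) = ((u n).1 - a, (u n).2 - c) by [].
apply: le_trans (unit_nrm_pair _ _) _.
have -> : e = e / 2 + e / 2 by field.
exact: lerD.
Qed.

Definition unitization_cstar : unital_cstar R :=
  UnitalCstar unit_star_lin unit_starM unit_starK unit_nrmD unit_nrmZ
    unit_nrm0_eq0 unit_nrmM unit_nrm_starl unit_complete.

End Unitization.

(** * Hilbert space completion *)

Record semi_inner (R : realType) := SemiInner {
  si_space :> lmodType R[i];
  sform : si_space -> si_space -> R[i];
  sformP : forall c x y z, sform (c *: x + y) z = c * sform x z + sform y z;
  sform_conj : forall x y, sform y x = (sform x y)^*;
  sform_ge0 : forall x, 0 <= sform x x }.

Section SemiInner.
Variables (R : realType) (V : semi_inner R).
Local Notation s := (@sform R V).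
Implicit Types (x y z v w : V) (c : R[i]) (e M : R).

Lemma sformDl x y z : s (x + y) z = s x z + s y z.
Proof. by have := sformP 1 x y z; rewrite scale1r mul1r. Qed.

Lemma sform0l z : s 0 z = 0.
Proof. by apply: (addrI (s 0 z)); rewrite -sformDl !addr0. Qed.

Lemma sformZl c x z : s (c *: x) z = c * s x z.
Proof. by have := sformP c x 0 z; rewrite sform0l !addr0. Qed.

Lemma sformBl x y z : s (x - y) z = s x z - s y z.
Proof. by rewrite sformDl -scaleN1r sformZl mulN1r. Qed.

Lemma sformDr x y z : s z (x + y) = s z x + s z y.
Proof. by rewrite sform_conj sformDl rmorphD /= -!sform_conj. Qed.

Lemma sformZr c x z : s z (c *: x) = c^* * s z x.
Proof. by rewrite sform_conj sformZl rmorphM /= -sform_conj. Qed.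

Lemma sformBr x y z : s z (x - y) = s z x - s z y.
Proof. by rewrite sform_conj sformBl rmorphB /= -!sform_conj. Qed.

Definition sn x : R := Num.sqrt (complex.Re (s x x)).

Lemma sn_ge0 x : 0 <= sn x.
Proof. exact: sqrtr_ge0. Qed.
Hint Resolve sn_ge0 : core.

Lemma Re_sform_ge0 x : 0 <= complex.Re (s x x).
Proof. by have := sform_ge0 x; case: (s x x) => a b; rewrite lecE /= => /andP[]. Qed.

Lemma sn_sqr x : sn x ^+ 2 = complex.Re (s x x).
Proof. by rewrite sqr_sqrtr // Re_sform_ge0. Qed.

Lemma sformE x : s x x = (sn x ^+ 2)%:C.
Proof.
rewrite sn_sqr; have := sform_ge0 x.
by case: (s x x) => a b; rewrite lecE /= => /andP[/eqP -> _].
Qed.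

(** Positivity of the form at [x - t <x, y> y], for real [t]. *)
Lemma cauchy_schwarz x y : cabs (s x y) <= sn x * sn y.
Proof.
rewrite -ler_sqr ?nnegrE ?cabs_ge0 ?mulr_ge0 // exprMn.
set a := sn x ^+ 2; set d := sn y ^+ 2; set be := cabs (s x y) ^+ 2.
have a0 : 0 <= a by exact: sqr_ge0.
have d0 : 0 <= d by exact: sqr_ge0.
have be0 : 0 <= be by exact: sqr_ge0.
(* The value at [t = 1 / <y, y>] is the claim; if [<y, y> = 0], the value is
   negative for large [t] unless [<x, y> = 0]. *)
have key (t : R) : 0 <= a - 2 * t * be + t ^+ 2 * be * d.
  have := Re_sform_ge0 (x - (t%:C * s x y) *: y).
  rewrite sformBl !sformBr !sformZl !sformZr !sformE (sform_conj x y).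
  rewrite (_ : (t%:C * s x y)^* = t%:C * (s x y)^*); last by rewrite rmorphM /= conjC_real.
  rewrite -/a -/d.
  have E : s x y * (s x y)^* = be%:C by rewrite cabs2E.
  have -> : a%:C - t%:C * (s x y)^* * s x y -
      (t%:C * s x y * (s x y)^* - t%:C * s x y * (t%:C * (s x y)^* * d%:C)) =
      a%:C - 2 * t%:C * (s x y * (s x y)^*) + t%:C ^+ 2 * (s x y * (s x y)^*) * d%:C by ring.
  by rewrite E -[2](rmorph_nat (real_complex R)) -rmorphXn -!rmorphM -rmorphB -rmorphD.
have [d00|dn0] := eqVneq d 0.
  rewrite d00 mulr0; have [->//|ben0] := eqVneq be 0.
  have bep : 0 < be by rewrite lt_neqAle eq_sym ben0.
  have := key ((a + 1) / (2 * be)); rewrite d00 mulr0 addr0.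
  have -> : 2 * ((a + 1) / (2 * be)) * be = a + 1 by field.
  lra.
have dp : 0 < d by rewrite lt_neqAle eq_sym dn0.
have := key d^-1.
have -> : a - 2 * d^-1 * be + d^-1 ^+ 2 * be * d = a - be / d by field.
by rewrite subr_ge0 ler_pdivrMr.
Qed.

(** Vectors of the completion are represented by the antilinear functionals
    they define on [V]: those uniformly approximable by vectors of [V]. Null
    vectors are thereby identified without a quotient, and completeness is that
    of the complex numbers at each point. *)
Definition approximable (g : V -> R[i]) :=
  forall e, 0 < e -> exists v, forall w, cabs (g w - s v w) <= e * sn w.

Definition approximable_pred : {pred V -> R[i]} := fun g => `[< approximable g >].

Record completion := Completion {
  cval :> V -> R[i];
  cvalP : cval \in approximable_pred }.

HB.instance Definition _ := [isSub for cval].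
HB.instance Definition _ := [Choice of completion by <:].

Fact approximable_submod : submod_closed approximable_pred.
Proof.
split=> [|c g h /asboolP ag /asboolP ah]; apply/asboolP => e e0.
  by exists 0 => w; rewrite sform0l subr0 cabs0 mulr_ge0 // ltW.
have c1 : 0 < cabs c + 1 by have := cabs_ge0 c; lra.
have [v hv] := ag (e / 2 / (cabs c + 1)) (divr_gt0 (divr_gt0 e0 (ltr0n _ 2)) c1).
have [v' hv'] := ah (e / 2) (divr_gt0 e0 (ltr0n _ 2)).
exists (c *: v + v') => w; rewrite sformP.
have -> : (c *: g + h) w - (c * s v w + s v' w) = c * (g w - s v w) + (h w - s v' w).
  by rewrite mulrBr addrACA opprD.
apply: le_trans (cabsD _ _) _; rewrite cabsM.
have -> : e * sn w = e / 2 * sn w + e / 2 * sn w by field.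
apply: lerD; last exact: hv'.
apply: le_trans (ler_wpM2l (cabs_ge0 c) (hv w)) _.
rewrite mulrA ler_wpM2r // mulrA ler_pdivrMr // mulrC ler_pM2l ?divr_gt0 //; lra.
Qed.

HB.instance Definition _ := GRing.isSubmodClosed.Build R[i] (V -> R[i]) approximable_pred
  approximable_submod.
HB.instance Definition _ := [SubChoice_isSubLmodule of completion by <:].

End SemiInner.

Section Completion.
Variables (R : realType) (V : semi_inner R).
Local Notation s := (@sform R V).
Local Notation H := (completion V).
Implicit Types (x y z v w : V) (c : R[i]) (e M : R) (g h : H).

Let sn0' x : 0 <= sn x := sn_ge0 x.
Hint Resolve sn0' : core.

Lemma cval_approx g e : 0 < e -> exists v, forall w, cabs (g w - s v w) <= e * sn w.
Proof. by move=> e0; have /asboolP/(_ e e0) := cvalP g. Qed.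

Lemma completion_ext g h : (forall w, g w = h w) -> g = h.
Proof. by move=> E; apply/val_inj/funext. Qed.

Lemma approximable_form v : s v \in @approximable_pred R V.
Proof.
by apply/asboolP => e e0; exists v => w; rewrite subrr cabs0 mulr_ge0 // ltW.
Qed.

Definition embed v : H := Completion (approximable_form v).

Definition dual_norm g : R := best_const (fun w => cabs (g w)) (@sn R V).

Lemma dual_norm_le g M : 0 <= M -> (forall w, cabs (g w) <= M * sn w) -> dual_norm g <= M.
Proof. by move=> M0 h; apply: best_const_le. Qed.

Lemma dual_normP g : 0 <= dual_norm g /\ forall w, cabs (g w) <= dual_norm g * sn w.
Proof.
apply: best_constP => //.
have [v hv] := cval_approx g ltr01.
exists (1 + sn v); split=> [|w]; first by rewrite addr_ge0 ?ler01 ?sn_ge0.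
rewrite -(subrK (s v w) (g w)); apply: le_trans (cabsD _ _) _.
by rewrite mulrDl; apply: lerD => //; exact: cauchy_schwarz.
Qed.

Lemma dual_normD g h : dual_norm (g + h) <= dual_norm g + dual_norm h.
Proof.
have [g0 g1] := dual_normP g; have [h0 h1] := dual_normP h.
apply: dual_norm_le => [|w]; first exact: addr_ge0.
by rewrite mulrDl [X in cabs X]/(g w + h w); apply: le_trans (cabsD _ _) _; exact: lerD.
Qed.

Lemma dual_normZ_le c g : dual_norm (c *: g) <= cabs c * dual_norm g.
Proof.
have [g0 g1] := dual_normP g.
apply: dual_norm_le => [|w]; first by rewrite mulr_ge0 ?cabs_ge0.
by rewrite -mulrA [X in cabs X]/(c * g w) cabsM ler_wpM2l ?cabs_ge0.
Qed.

Lemma dual_normZ c g : dual_norm (c *: g) = cabs c * dual_norm g.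
Proof.
apply/eqP; rewrite eq_le dual_normZ_le /=.
have [->|c0] := eqVneq c 0; first by rewrite cabs0 mul0r (dual_normP _).1.
have := dual_normZ_le c^-1 (c *: g); rewrite scalerA mulVf // scale1r => h.
have cp : 0 < cabs c.
  by rewrite lt_neqAle cabs_ge0 andbT eq_sym; apply: contra c0 => /eqP/cabs0_eq0 ->.
apply: le_trans (ler_wpM2l (ltW cp) h) _.
by rewrite mulrA -cabsM divff // cabs1 mul1r.
Qed.

Lemma dual_norm0_eq0 g : dual_norm g = 0 -> g = 0.
Proof.
move=> g0; apply: completion_ext => w; apply: cabs0_eq0; apply/le_anti.
by rewrite cabs_ge0 andbT; have [_ /(_ w)] := dual_normP g; rewrite g0 mul0r.
Qed.

Let nrmC g : R[i] := (dual_norm g)%:C.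

Let nrmC_D g h : nrmC (g + h) <= nrmC g + nrmC h.
Proof. by rewrite -rmorphD lecR; exact: dual_normD. Qed.

Let nrmC_Z c g : nrmC (c *: g) = `|c| * nrmC g.
Proof. by rewrite -cabsE -rmorphM /= -dual_normZ. Qed.

Let nrmC0 g : nrmC g = 0 -> g = 0.
Proof. by move=> /complexI/dual_norm0_eq0. Qed.

HB.instance Definition _ := @Lmodule_isNormed.Build R[i] H nrmC nrmC_D nrmC_Z nrmC0.

Lemma nr_eval g w : cabs (g w) <= nr g * sn w.
Proof. exact: (dual_normP g).2. Qed.

Lemma nr_completion_le g M : 0 <= M -> (forall w, cabs (g w) <= M * sn w) -> nr g <= M.
Proof. exact: dual_norm_le. Qed.

Lemma nr_embed v : nr (embed v) = sn v.
Proof.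
apply/eqP; rewrite eq_le; apply/andP; split.
  by apply: nr_completion_le => // w; exact: cauchy_schwarz.
have := nr_eval (embed v) v; rewrite /= sformE cabs_real ger0_norm ?sqr_ge0 // expr2.
have [->|v0] := eqVneq (sn v) 0; first by rewrite nr_ge0.
by rewrite ler_pM2r // lt_neqAle eq_sym v0 sn_ge0.
Qed.

Lemma embedP c v w : embed (c *: v + w) = c *: embed v + embed w.
Proof. by apply: completion_ext => z /=; rewrite sformP. Qed.

Lemma embedB v w : embed (v - w) = embed v - embed w.
Proof. by rewrite addrC -scaleN1r embedP scaleN1r addrC. Qed.

Lemma embed_dense g e : 0 < e -> exists v, nr (g - embed v) <= e.
Proof.
move=> e0; have [v hv] := cval_approx g e0; exists v.
by apply: nr_completion_le => //; exact: ltW.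
Qed.

Lemma evalP g c v w : g (c *: v + w) = c^* * g v + g w.
Proof.
apply/eqP; rewrite -subr_eq0; apply/eqP/cabs0_eq0/le_anti; rewrite cabs_ge0 andbT.
apply/ler_addgt0Pr => e e0; rewrite add0r.
set B := sn (c *: v + w) + cabs c * sn v + sn w + 1.
have B0 : 0 < B by rewrite ltr_wpDl // !addr_ge0 // mulr_ge0 ?cabs_ge0.
have [z hz] := cval_approx g (divr_gt0 e0 B0).
have -> : g (c *: v + w) - (c^* * g v + g w) =
    (g (c *: v + w) - s z (c *: v + w)) - c^* * (g v - s z v) - (g w - s z w).
  by rewrite sformDr sformZr; ring.
apply: le_trans (cabsD _ _) _; rewrite cabsN.
apply: le_trans (lerD (cabsD _ _) (hz w)) _; rewrite cabsN cabsM cabs_conj.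
apply: le_trans (lerD (lerD (hz _) (ler_wpM2l (cabs_ge0 c) (hz v))) (lexx _)) _.
have -> : e / B * sn (c *: v + w) + cabs c * (e / B * sn v) + e / B * sn w = e / B * (B - 1).
  by rewrite /B; ring.
by rewrite mulrAC ler_pdivrMr // ler_pM2l // gerBl ler01.
Qed.

Lemma evalB g v w : g (v - w) = g v - g w.
Proof.
have -> : v - w = (-1) *: w + v by rewrite scaleN1r addrC.
by rewrite evalP rmorphN rmorph1 mulN1r addrC.
Qed.

Lemma completion_complete (F : set_system H) : ProperFilter F -> cauchy F -> cvg F.
Proof.
move=> FF /cauchyP Fc.
have /choice[gs Fgs] : forall n : nat, exists g, F (ball g (n.+1%:R^-1 : R)%:C).
  by move=> n; apply: Fc; rewrite ltcR invr_gt0.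
have inball g h (r : R) : ball g r%:C h -> nr (g - h) < r.
  by rewrite -ball_normE /= -nrE ltcR.
have close n m : nr (gs m - gs n) <= m.+1%:R^-1 + n.+1%:R^-1.
  have [h [/inball h1 /inball h2]] := filter_ex (filterI (Fgs m) (Fgs n)).
  apply: le_trans (nr_triangle h _ _) _; apply: lerD; first exact: ltW.
  by rewrite nrBC ltW.
have small e : 0 < e -> exists n : nat, n.+1%:R^-1 <= e.
  by move=> /inv_succ_small[n hn]; exists n; exact: hn.
have inv_mono n m : (n <= m)%N -> (m.+1%:R^-1 : R) <= n.+1%:R^-1.
  by move=> nm; rewrite lef_pV2 ?posrE // ler_nat ltnS.
have /choice[l hl] : forall w, exists l, forall e, 0 < e ->
    exists n0 : nat, forall n, (n0 <= n)%N -> cabs (gs n w - l) <= e.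
  move=> w; apply: complex_complete => e e0.
  have w1 : 0 < sn w + 1 by rewrite ltr_wpDl // sn_ge0.
  have [n0 hn0] := small (e / (sn w + 1) / 2) (divr_gt0 (divr_gt0 e0 w1) (ltr0n _ 2)).
  exists n0 => n m n0n nm; have := nr_eval (gs m - gs n) w.
  have -> : (gs m - gs n) w = gs m w - gs n w by [].
  move=> h; apply: le_trans h _.
  have h : nr (gs m - gs n) <= e / (sn w + 1).
    apply: le_trans (close n m) _.
    have h1 := le_trans (inv_mono _ _ (leq_trans n0n nm)) hn0.
    have h2 := le_trans (inv_mono _ _ n0n) hn0.
    by have := lerD h1 h2; rewrite -splitr.
  apply: le_trans (ler_wpM2r (sn_ge0 w) h) _.
  by rewrite mulrAC ler_pdivrMr // ler_pM2l // lerDl ler01.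
have hgl n w : cabs (l w - gs n w) <= 2 * n.+1%:R^-1 * sn w.
  apply/ler_addgt0Pr => e e0; have [n0 hn0] := hl w e e0.
  pose m := maxn n0 n.
  rewrite -(subrK (gs m w) (l w)) -addrA addrC; apply: le_trans (cabsD _ _) _.
  apply: lerD; last by rewrite -cabsN opprB; apply: hn0; exact: leq_maxl.
  apply: le_trans (nr_eval (gs m - gs n) w) _; rewrite ler_wpM2r ?sn_ge0 //.
  apply: le_trans (close n m) _; rewrite mulr_natl mulr2n lerD2r; apply: inv_mono.
  exact: leq_maxr.
have lapp : l \in @approximable_pred R V.
  apply/asboolP => e e0; have [n hn] := small (e / 4) (divr_gt0 e0 (ltr0n _ 4)).
  have [v hv] := cval_approx (gs n) (divr_gt0 e0 (ltr0n _ 2)).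
  exists v => w; rewrite -(subrK (gs n w) (l w)) -addrA; apply: le_trans (cabsD _ _) _.
  have -> : e * sn w = e / 2 * sn w + e / 2 * sn w by field.
  apply: lerD; last exact: hv.
  apply: le_trans (hgl n w) _; rewrite ler_wpM2r ?sn_ge0 //.
  by move: hn; set q := n.+1%:R^-1 => hn; lra.
pose L : H := Completion lapp.
have Ln n : nr (L - gs n) <= 2 * n.+1%:R^-1.
  by apply: nr_completion_le; [by rewrite mulr_ge0 ?invr_ge0 ?ler0n|exact: hgl].
apply/cvg_ex; exists L; apply/fcvg_ballP => _ /posC[e e0 ->].
have [n hn] := small (e / 4) (divr_gt0 e0 (ltr0n _ 4)).
apply: filterS (Fgs n) => h /inball hh.
rewrite -ball_normE /= -nrE ltcR.
apply: le_lt_trans (nr_triangle (gs n) _ _) _.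
by have := Ln n; move: hn hh; set q := n.+1%:R^-1; set a := nr (gs n - h) => hn hh hL; lra.
Qed.

HB.instance Definition _ := Uniform_isComplete.Build H completion_complete.

End Completion.

Section CompletionDot.
Variables (R : realType) (V : semi_inner R).
Local Notation s := (@sform R V).
Local Notation H := (completion V).
Implicit Types (x y z v w : V) (c d : R[i]) (e M : R) (g h : H).

(** The inner product of [g] and [h] is the value at [h] of the continuous
    extension of [g]. *)
Definition is_inner g h c :=
  exists2 M, 0 <= M & forall w, cabs (c - g w) <= M * nr (h - embed w).

Lemma is_inner_unique g h c d : is_inner g h c -> is_inner g h d -> c = d.
Proof.
move=> [M M0 hM] [M' M'0 hM'].
apply/eqP; rewrite -subr_eq0; apply/eqP/cabs0_eq0/le_anti; rewrite cabs_ge0 andbT.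
apply/ler_addgt0Pr => e e0; rewrite add0r.
have B0 : 0 < M + M' + 1 by lra.
have [w hw] := embed_dense h (divr_gt0 e0 B0).
have -> : c - d = (c - g w) - (d - g w) by ring.
apply: le_trans (cabsD _ _) _; rewrite cabsN.
apply: le_trans (lerD (hM w) (hM' w)) _; rewrite -mulrDl.
have h1 : (M + M') * nr (h - embed w) <= (M + M') * (e / (M + M' + 1)).
  by rewrite ler_wpM2l // addr_ge0.
apply: le_trans h1 _; rewrite mulrA ler_pdivrMr // mulrC ler_pM2l //; lra.
Qed.

Lemma is_inner_exists g h : exists c, is_inner g h c.
Proof.
have n0 (n : nat) : 0 < n.+1%:R^-1 :> R by rewrite invr_gt0 ltr0n.
have /choice[w hw] : forall n : nat, exists w, nr (h - embed w) <= n.+1%:R^-1 :> R.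
  by move=> n; exact: embed_dense.
have g1 : 0 < nr g + 1 by have := nr_ge0 g; lra.
have [|c hc] := @complex_complete R (fun n => g (w n)).
  move=> e e0.
  have [n hn] := inv_succ_small (divr_gt0 (divr_gt0 e0 g1) (ltr0n _ 2)).
  exists n => k m nk km; rewrite -evalB.
  apply: le_trans (nr_eval _ _) _; rewrite -nr_embed embedB.
  have h2 : nr (embed (w m) - embed (w k)) <= e / (nr g + 1).
    apply: le_trans (nr_triangle h _ _) _; rewrite (nrBC (embed _)) [leRHS]splitr.
    apply: lerD; first by apply: le_trans (hw m) _; apply: hn; exact: leq_trans km.
    by apply: le_trans (hw k) _; exact: hn.
  apply: le_trans (ler_wpM2l (nr_ge0 g) h2) _.
  by rewrite mulrA ler_pdivrMr // mulrC ler_pM2l // lerDl ler01.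
exists c; exists (nr g) => [|v]; first exact: nr_ge0.
apply/ler_addgt0Pr => e e0.
have [n1 hn1] := hc (e / 2) (divr_gt0 e0 (ltr0n _ 2)).
have [n2 hn2] := inv_succ_small (divr_gt0 (divr_gt0 e0 (ltr0n _ 2)) g1).
pose n := maxn n1 n2.
have -> : c - g v = (g (w n) - g v) - (g (w n) - c) by ring.
apply: le_trans (cabsD _ _) _; rewrite cabsN.
apply: le_trans (lerD (lexx _) (hn1 n (leq_maxl _ _))) _.
rewrite {2}[e]splitr addrA lerD2r -evalB.
apply: le_trans (nr_eval _ _) _; rewrite -nr_embed embedB.
apply: le_trans (ler_wpM2l (nr_ge0 g) (nr_triangle h _ _)) _.
rewrite mulrDr addrC lerD2r (nrBC (embed _)).
apply: le_trans (ler_wpM2l (nr_ge0 g) (le_trans (hw n) (hn2 n (leq_maxr _ _)))) _.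
rewrite mulrA ler_pdivrMr // mulrC ler_pM2l ?divr_gt0 //; lra.
Qed.

Definition inner g h : R[i] := projT1 (cid (is_inner_exists g h)).

Lemma innerP g h : is_inner g h (inner g h).
Proof. by rewrite /inner; case: cid. Qed.

Lemma inner_embedr g w : inner g (embed w) = g w.
Proof.
apply: (is_inner_unique (innerP _ _)); exists (nr g) => [|v]; first exact: nr_ge0.
by rewrite -evalB -embedB nr_embed; exact: nr_eval.
Qed.

Lemma inner_linearl c g1 g2 h : inner (c *: g1 + g2) h = c * inner g1 h + inner g2 h.
Proof.
have [M1 M10 h1] := innerP g1 h; have [M2 M20 h2] := innerP g2 h.
apply: (is_inner_unique (innerP _ _)).
exists (cabs c * M1 + M2) => [|w]; first by rewrite addr_ge0 // mulr_ge0 // cabs_ge0.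
have -> : c * inner g1 h + inner g2 h - (c *: g1 + g2) w =
  c * (inner g1 h - g1 w) + (inner g2 h - g2 w).
  have -> : (c *: g1 + g2) w = c * g1 w + g2 w by [].
  by ring.
apply: le_trans (cabsD _ _) _; rewrite cabsM mulrDl -mulrA.
by apply: lerD => //; rewrite ler_wpM2l ?cabs_ge0.
Qed.

Lemma cabs_le_eps c : (forall e, 0 < e -> cabs c <= e) -> c = 0.
Proof.
move=> h; apply/cabs0_eq0/le_anti; rewrite cabs_ge0 andbT.
by apply/ler_addgt0Pr => e e0; rewrite add0r; exact: h.
Qed.

Lemma inner_conj g h : inner g h = (inner h g)^*.
Proof.
rewrite -[LHS]conjCK; congr (_^*).
apply: is_inner_unique (innerP h g); exists (nr h + 1) => [|v].
  by rewrite addr_ge0 ?nr_ge0.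
have [M M0 hM] := innerP g h.
apply/ler_addgt0Pr => e e0.
have v0 := sn_ge0 v.
have B0 : 0 < M + sn v + e + 1 by lra.
have E0 : 0 < e / (M + sn v + e + 1) by exact: divr_gt0.
have [w hw] := embed_dense h E0.
have wh : sn w <= nr h + 1.
  rewrite -nr_embed; apply: le_trans (nr_leD (y := h) (e := 1) _ (lexx _)) _; last by rewrite addrC.
  rewrite nrBC; apply: le_trans hw _; rewrite ler_pdivrMr // mul1r; lra.
have -> : (inner g h)^* - h v = (inner g h - g w)^* + (g w - s v w)^* - (h v - s w v).
  by rewrite !rmorphB /= (sform_conj v w); ring.
apply: le_trans (cabsD _ _) _; rewrite cabsN.
apply: le_trans (lerD (cabsD _ _) (lexx _)) _; rewrite !cabs_conj.
have h1 := hM w.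
have h2 : cabs (g w - s v w) <= (nr h + 1) * nr (g - embed v).
  apply: le_trans (nr_eval (g - embed v) w) _.
  by rewrite mulrC ler_wpM2r ?nr_ge0.
have h3 := nr_eval (h - embed w) v.
rewrite [X in cabs X]/(h v - s w v) in h3.
apply: le_trans (lerD (lerD h1 h2) h3) _.
rewrite addrAC addrC lerD2l [_ * sn v]mulrC -mulrDl.
apply: le_trans (ler_wpM2l _ hw) _; first by lra.
rewrite mulrA ler_pdivrMr // mulrC ler_pM2l //; lra.
Qed.

Lemma nr_inner g : (nr g ^+ 2)%:C = inner g g.
Proof.
apply/eqP; rewrite -subr_eq0; apply/eqP/cabs_le_eps => e e0.
have [M M0 hM] := innerP g g.
have g0 := nr_ge0 g.
have B0 : 0 < M + 3 * nr g + 3 + e by lra.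
have [w hw] := embed_dense g (divr_gt0 e0 B0).
set d := e / _ in hw.
have d1 : d <= 1 by rewrite /d ler_pdivrMr // mul1r; lra.
have d0 : 0 <= d by rewrite /d divr_ge0 // ltW.
have w1 : sn w <= nr g + d.
  by rewrite -nr_embed addrC; apply: nr_leD (lexx _); rewrite nrBC.
have w2 : nr g <= sn w + d.
  by rewrite -nr_embed addrC; exact: nr_leD hw (lexx _).
have w0 := sn_ge0 w.
have -> : (nr g ^+ 2)%:C - inner g g =
   (nr g ^+ 2 - sn w ^+ 2)%:C - (g w - s w w) - (inner g g - g w).
  by rewrite rmorphB /= -sformE; ring.
apply: le_trans (cabsD _ _) _; rewrite cabsN.
apply: le_trans (lerD (cabsD _ _) (hM w)) _; rewrite cabsN cabs_real.
have h2 := nr_eval (g - embed w) w.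
rewrite [X in cabs X]/(g w - s w w) in h2.
apply: le_trans (lerD (lerD (lexx _) h2) (lexx _)) _.
have h3 : `|nr g ^+ 2 - sn w ^+ 2| <= d * (2 * nr g + 1).
  rewrite subr_sqr normrM; apply: ler_pM; rewrite ?normr_ge0 //.
    by rewrite ler_norml; apply/andP; split; lra.
  by rewrite ger0_norm ?addr_ge0 //; lra.
have h4 : nr (g - embed w) * sn w <= d * (nr g + 1).
  by apply: ler_pM => //; [exact: nr_ge0 | lra].
have h5 : M * nr (g - embed w) <= d * M by rewrite mulrC; exact: ler_wpM2r.
apply: le_trans (lerD (lerD h3 h4) h5) _.
rewrite -!mulrDr /d mulrAC ler_pdivrMr // ler_pM2l //; lra.
Qed.

Let inner_additivel h : zmod_morphism (inner ^~ h).
Proof.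
move=> g1 g2 /=; have -> : g1 - g2 = (-1) *: g2 + g1 by rewrite scaleN1r addrC.
by rewrite inner_linearl mulN1r addrC.
Qed.

Let inner_scalel h : scalable_for *%R (inner ^~ h).
Proof.
move=> c g /=; have h0 : inner 0 h = 0.
  by rewrite -(subrr g) inner_additivel subrr.
by rewrite -[c *: g]addr0 inner_linearl h0 addr0.
Qed.

Let inner_additiver g : zmod_morphism (inner g).
Proof. by move=> h1 h2 /=; rewrite !(inner_conj g) inner_additivel rmorphB. Qed.

Let inner_scaler g : scalable_for (Num.conj \; *%R) (inner g).
Proof. by move=> c h /=; rewrite !(inner_conj g) inner_scalel rmorphM. Qed.

HB.instance Definition _ := isBilinear.Build R[i] H H R[i] *%R (Num.conj \; *%R) inner
  inner_additivel inner_additiver inner_scalel inner_scaler.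

Let inner_herm g h : inner g h = (-1) ^+ false * (inner h g)^*.
Proof. by rewrite expr0 mul1r -inner_conj. Qed.

HB.instance Definition _ := isHermitianSesquilinear.Build R[i] H false Num.conj inner inner_herm.

Let inner_pos g : g != 0 -> 0 < inner g g.
Proof.
move=> g0; rewrite -nr_inner ltcR exprn_gt0 // lt_neqAle nr_ge0 andbT eq_sym.
by apply: contra g0 => /eqP/nr0_eq0 ->.
Qed.

HB.instance Definition _ := isDotProduct.Build R[i] H inner inner_pos.

Let inner_norm g : `|g| ^+ 2 = inner g g.
Proof. by rewrite -nr_inner rmorphXn /= nrE. Qed.

Definition completion_hilbert : hilbert R := Hilbert (hdot := inner) inner_norm.

End CompletionDot.

(** * Extension by density *)

Section Extension.
Variables (R : realType) (V : semi_inner R) (W : completeNormedModType R[i]).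
Variables (T : V -> W) (M : R).
Hypotheses (T_lin : forall (c : R[i]) x y, T (c *: x + y) = c *: T x + T y)
  (T_bd : forall x, nr (T x) <= M * sn x) (M_ge0 : 0 <= M).
Local Notation H := (completion V).
Implicit Types (g h : H) (l : W).

Let TB x y : T (x - y) = T x - T y.
Proof.
have -> : x - y = (-1) *: y + x by rewrite scaleN1r addrC.
by rewrite T_lin scaleN1r addrC.
Qed.

Let approx g l := forall e, 0 < e -> exists2 v, nr (g - embed v) <= e & nr (l - T v) <= e.

Let approx_le g l : approx g l -> nr l <= M * nr g.
Proof.
move=> a; apply/ler_addgt0Pr => e e0.
have M1 : 0 < M + 1 by rewrite ltr_wpDl.
have [v h1 h2] := a _ (divr_gt0 e0 M1); set d := e / _ in h1 h2.
apply: le_trans (nr_leD h2 (T_bd v)) _.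
have : sn v <= d + nr g.
  by rewrite -nr_embed; apply: nr_leD (lexx _); rewrite nrBC.
move=> /(ler_wpM2l M_ge0) h3.
have dE : d * (M + 1) = e by rewrite divfK // gt_eqF.
move: dE h3; rewrite !mulrDr mulr1 (mulrC M d); lra.
Qed.

Let approx_lin c g h l m : approx g l -> approx h m -> approx (c *: g + h) (c *: l + m).
Proof.
move=> a1 a2 e e0.
have c1 : 0 < cabs c + 1 by have := cabs_ge0 c; lra.
have d0 : 0 < e / (cabs c + 1) by exact: divr_gt0.
have [v v1 v2] := a1 _ d0; have [w w1 w2] := a2 _ d0.
set d := e / _ in d0 v1 v2 w1 w2.
have dE : d * (cabs c + 1) = e by rewrite divfK // gt_eqF.
have aux (X : normedModType R[i]) (p q p' q' : X) : nr (p - p') <= d -> nr (q - q') <= d ->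
    nr (c *: p + q - (c *: p' + q')) <= e.
  move=> h1 h2; rewrite opprD addrACA -scalerBr.
  apply: le_trans (nrD _ _) _; rewrite nrZ -dE mulrDr mulr1; apply: lerD => //.
  by rewrite mulrC ler_wpM2r ?cabs_ge0.
by exists (c *: v + w); rewrite ?embedP ?T_lin; exact: aux.
Qed.

Let approx_exists g : exists l, approx g l.
Proof.
have n0 (n : nat) : 0 < n.+1%:R^-1 :> R by rewrite invr_gt0 ltr0n.
have /choice[w hw] : forall n : nat, exists w, nr (g - embed w) <= n.+1%:R^-1 :> R.
  by move=> n; exact: embed_dense.
have g1 : 0 < M + 1 by rewrite ltr_wpDl.
have [|c hc] := @nr_complete R W (fun n => T (w n)).
  move=> e e0.
  have [n hn] := inv_succ_small (divr_gt0 (divr_gt0 e0 g1) (ltr0n _ 2)).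
  exists n => k m nk km; rewrite -TB.
  apply: le_trans (T_bd _) _; rewrite -nr_embed embedB.
  have h2 : nr (embed (w m) - embed (w k)) <= e / (M + 1).
    apply: le_trans (nr_triangle g _ _) _; rewrite (nrBC (embed _)) [leRHS]splitr.
    apply: lerD; first by apply: le_trans (hw m) _; apply: hn; exact: leq_trans km.
    by apply: le_trans (hw k) _; exact: hn.
  apply: le_trans (ler_wpM2l M_ge0 h2) _.
  by rewrite mulrA ler_pdivrMr // mulrC ler_pM2l // lerDl ler01.
exists c => e e0; have [n1 h1] := hc e e0; have [n2 h2] := inv_succ_small e0.
exists (w (maxn n1 n2)); first by apply: le_trans (hw _) _; apply: h2; exact: leq_maxr.
by rewrite nrBC; apply: h1; exact: leq_maxl.
Qed.

Lemma extension_exists : exists E : H -> W,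
  [/\ forall (c : R[i]) g h, E (c *: g + h) = c *: E g + E h,
      forall g, nr (E g) <= M * nr g &
      forall v, E (embed v) = T v].
Proof.
have /choice[E hE] := approx_exists.
have uniq g l m : approx g l -> approx g m -> l = m.
  move=> al am; apply/eqP; rewrite -subr_eq0; apply/eqP/nr0_eq0/le_anti.
  rewrite nr_ge0 andbT.
  have := approx_le (approx_lin (-1) am al).
  by rewrite !scaleN1r !addNr nr0 mulr0 addrC.
exists E; split.
- by move=> c g h; apply: uniq (hE _) _; exact: approx_lin.
- by move=> g; exact: approx_le.
- move=> v; apply: uniq (hE _) _ => e e0; exists v; rewrite subrr nr0; exact: ltW.
Qed.

End Extension.

(** * Hilbert spaces *)

Section Hilbert.
Variables (R : realType) (H : hilbert R).
Local Notation dot := (hdot H).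
Implicit Types (x y z h k : H) (c : R[i]) (e r : R) (M : set H).

Lemma hdotC x y : dot y x = (dot x y)^*.
Proof. by rewrite (@hermitian_subproof _ _ _ _ dot) expr0 mul1r. Qed.

Lemma hdotP c x y z : dot (c *: x + y) z = c * dot x z + dot y z.
Proof. by rewrite linearPl. Qed.

Lemma hdotE x : dot x x = (nr x ^+ 2)%:C.
Proof. by rewrite rmorphXn /= nrE hdot_norm. Qed.

Lemma hdot_ge0 x : 0 <= dot x x.
Proof. by rewrite hdotE ler0c sqr_ge0. Qed.

Definition hilbert_semi_inner : semi_inner R := SemiInner hdotP hdotC hdot_ge0.
Local Notation V := hilbert_semi_inner.

Lemma sn_nr x : @sn R V x = nr x.
Proof. by rewrite /sn (hdotE x : @sform R V x x = _) /= sqrtr_sqr ger0_norm ?nr_ge0. Qed.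

Lemma hdot_le x y : cabs (dot x y) <= nr x * nr y.
Proof. by have := @cauchy_schwarz R V x y; rewrite !sn_nr. Qed.

Lemma hdotDl x y z : dot (x + y) z = dot x z + dot y z.
Proof. exact: (@sformDl R V). Qed.
Lemma hdotDr x y z : dot z (x + y) = dot z x + dot z y.
Proof. exact: (@sformDr R V). Qed.
Lemma hdotBl x y z : dot (x - y) z = dot x z - dot y z.
Proof. exact: (@sformBl R V). Qed.
Lemma hdotBr x y z : dot z (x - y) = dot z x - dot z y.
Proof. exact: (@sformBr R V). Qed.
Lemma hdotZl c x z : dot (c *: x) z = c * dot x z.
Proof. exact: (@sformZl R V). Qed.
Lemma hdotZr c x z : dot z (c *: x) = c^* * dot z x.
Proof. exact: (@sformZr R V). Qed.
Lemma hdot0l z : dot 0 z = 0.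
Proof. exact: (@sform0l R V). Qed.
Lemma hdot0r z : dot z 0 = 0.
Proof. by rewrite hdotC hdot0l rmorph0. Qed.

Lemma hdot_eq0 x : dot x x = 0 -> x = 0.
Proof.
by rewrite hdotE => /complexI/eqP; rewrite sqrf_eq0 => /eqP/nr0_eq0.
Qed.

Lemma closed_subspace_orth (A : set H) x : (forall y, A y -> dot x y = 0) ->
  forall y, closed_span A y -> dot x y = 0.
Proof.
move=> h y /closure_nr cy; apply: cabs_le_eps => e e0.
have x1 : 0 < nr x + 1 by have := nr_ge0 x; lra.
have [z Az hz] := cy _ (divr_gt0 e0 x1).
have dz : dot x z = 0.
  apply: (Az [set z | dot x z = 0]); split=> //; split=> [|c u v hu hv] /=.
    by rewrite hdot0r.
  by rewrite hdotDr hdotZr hu hv mulr0 addr0.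
rewrite -(subr0 (dot x y)) -dz -hdotBr; apply: le_trans (hdot_le _ _) _.
apply: le_trans (ler_wpM2l (nr_ge0 x) (ltW hz)) _.
rewrite mulrA ler_pdivrMr // mulrC ler_pM2l //; lra.
Qed.

Lemma parallelogram x y : nr (x + y) ^+ 2 + nr (x - y) ^+ 2 = 2 * nr x ^+ 2 + 2 * nr y ^+ 2.
Proof.
have E z : nr z ^+ 2 = complex.Re (dot z z) by rewrite hdotE.
rewrite !E hdotBl !hdotBr hdotDl !hdotDr.
case: (dot x x) (dot x y) (dot y x) (dot y y) => [? ?] [? ?] [? ?] [? ?] /=; ring.
Qed.

(** A minimizing sequence for the distance from [x] to [M] is Cauchy by the
    parallelogram law, and minimality at the limit [m], tested at
    [m + t <x - m, y> y], gives orthogonality. *)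
Theorem projection_exists M x : closed M -> subspace M ->
  exists2 m, M m & forall y, M y -> dot (x - m) y = 0.
Proof.
move=> /closed_nr cM [M0 Mlin].
pose D := [set nr (x - y) ^+ 2 | y in M].
have Dinf : has_inf D.
  by split; [exists (nr (x - 0) ^+ 2), 0|exists 0 => _ [y _ <-]; exact: sqr_ge0].
pose d := inf D.
have d_le y : M y -> d <= nr (x - y) ^+ 2.
  by move=> My; apply: ge_inf; [exact: Dinf.2|exists y].
have /choice[u hu] : forall n : nat, exists y, M y /\ nr (x - y) ^+ 2 <= d + n.+1%:R^-1.
  move=> n; have n0 : 0 < n.+1%:R^-1 :> R by rewrite invr_gt0 ltr0n.
  have [_ [y My <-] h] := inf_adherent n0 Dinf.
  by exists y; split => //; exact: ltW.
have close n m : nr (u m - u n) ^+ 2 <= 2 * m.+1%:R^-1 + 2 * n.+1%:R^-1.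
  have [Mn hn] := hu n; have [Mm hm] := hu m.
  have := parallelogram (x - u n) (x - u m).
  have -> : x - u n - (x - u m) = u m - u n.
    by rewrite opprB addrC addrA subrK.
  have Mmid : M ((2^-1)%:C *: u n + ((2^-1)%:C *: u m + 0)).
    by apply: (Mlin _ _ _ Mn); exact: (Mlin _ _ _ Mm M0).
  have := d_le _ Mmid; rewrite addr0 -scalerDr.
  have -> : x - u n + (x - u m) = (2 : R)%:C *: (x - (2^-1)%:C *: (u n + u m)).
    rewrite scalerBr scalerA -rmorphM divff ?pnatr_eq0 // scale1r.
    by rewrite rmorph_nat scaler_nat mulr2n opprD addrACA.
  rewrite nrZ cabs_real ger0_norm // exprMn.
  move: hn hm; set p := n.+1%:R^-1; set q := m.+1%:R^-1; lra.
have [|m hm] := @nr_complete R H u.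
  move=> e e0; have e2 : 0 < e ^+ 2 / 4 by rewrite divr_gt0 ?exprn_gt0.
  have [n0 hn0] := inv_succ_small e2; exists n0 => n k n0n nk.
  rewrite -ler_sqr ?nnegrE ?nr_ge0 ?(ltW e0) //.
  have := close n k; have := hn0 _ n0n; have := hn0 _ (leq_trans n0n nk).
  set p := n.+1%:R^-1; set q := k.+1%:R^-1; lra.
have Mm : M m.
  apply: cM => e e0; have [n0 hn0] := hm e e0; exists (u n0); first by have [] := hu n0.
  by rewrite nrBC; exact: hn0.
have dm : nr (x - m) ^+ 2 <= d.
  apply/ler_addgt0Pr => e e0.
  have a0 := nr_ge0 (x - m).
  have d0 : 0 <= d.
    by apply: lb_le_inf => [|_ [y _ <-]]; [exact: Dinf.1|exact: sqr_ge0].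
  have B0 : 0 < 2 * nr (x - m) + 1 by lra.
  (* Moving [m] by at most [de] changes the squared distance to [x] by at most
     [e / 2]. *)
  have [de [de0 de1 deB]] : exists de : R,
      [/\ 0 < de, de <= 1 & de * (2 * nr (x - m) + 1) <= e / 2].
    exists (Num.min 1 (e / 2 / (2 * nr (x - m) + 1))); split.
    - by rewrite lt_min ltr01 !divr_gt0.
    - by rewrite ge_min lexx.
    - by rewrite -ler_pdivlMr // ge_min lexx orbT.
  have [n1 hn1] := hm de de0; have [n2 hn2] := inv_succ_small (divr_gt0 e0 (ltr0n _ 2)).
  pose n := maxn n1 n2.
  have h1 : nr (x - m) <= de + nr (x - u n).
    rewrite [leRHS]addrC; apply: le_trans (nr_triangle (u n) _ _) _.
    by rewrite lerD2l; exact: (hn1 n (leq_maxl _ _)).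
  have [_ h2] := hu n; have h3 := hn2 n (leq_maxr _ _).
  have h4 : d + n.+1%:R^-1 <= d + e / 2 by rewrite lerD2l.
  have b0 := nr_ge0 (x - u n).
  move: h1 h2 h3 b0 a0 deB; set q := n.+1%:R^-1; set a := nr (x - m); set b := nr _.
  clearbody q a b; rewrite !expr2 => h1 h2 h3 b0 a0 deB.
  have [hc|hc] := leP a de; first by nra.
  have : (a - de) * (a - de) <= b * b by apply: ler_pM; lra.
  nra.
exists m => // y My; have [z zE] : exists z, z = x - m by eexists.
rewrite -zE; rewrite -zE in dm.
have z_le c : nr z ^+ 2 <= nr (z - c *: y) ^+ 2.
  have -> : z - c *: y = x - (c *: y + m) by rewrite zE opprD addrCA addrC addrAC addrC.
  by apply: le_trans dm _; apply: d_le; exact: Mlin.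
apply/cabs0_eq0/eqP; rewrite -sqrf_eq0; apply/eqP.
set be := _ ^+ 2; have be0 : 0 <= be by exact: sqr_ge0.
have yy := nr_ge0 y.
have key (t : R) : 0 <= - (2 * t * be) + t ^+ 2 * be * nr y ^+ 2.
  have := z_le (t%:C * dot z y); rewrite -lecR -hdotE -(hdotE (z - _)).
  rewrite hdotBl !hdotBr !hdotZl !hdotZr (hdotC z y).
  rewrite (_ : (t%:C * dot z y)^* = t%:C * (dot z y)^*); last by rewrite rmorphM /= conjC_real.
  rewrite (hdotE y) -subr_ge0.
  have E : dot z y * (dot z y)^* = be%:C by rewrite cabs2E.
  rewrite (_ : _ - dot z z = - (2 * t%:C * (dot z y * (dot z y)^*))
       + t%:C ^+ 2 * (dot z y * (dot z y)^*) * (nr y ^+ 2)%:C); last by ring.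
  rewrite E -[2](rmorph_nat (real_complex R)) -(rmorphXn (real_complex R)).
  rewrite -!(rmorphM (real_complex R)).
  by rewrite -(rmorphN (real_complex R)) -(rmorphD (real_complex R)) ler0c.
apply/le_anti; rewrite be0 andbT.
have Y0 : 0 < nr y ^+ 2 + 1 by have := sqr_ge0 (nr y); lra.
(* Below the minimizing [t = 1 / |y|^2], so as to include [y = 0]. *)
have [t t0 tE] : exists2 t : R, 0 < t & t * (nr y ^+ 2 + 1) = 1.
  by exists (nr y ^+ 2 + 1)^-1; rewrite ?invr_gt0 // mulVf // gt_eqF.
have := key t.
have -> : - (2 * t * be) + t ^+ 2 * be * nr y ^+ 2 =
    t * be * (t * (nr y ^+ 2 + 1)) - t * be * (2 + t) by ring.
rewrite tE mulr1 -[X in X - _]mulr1 -mulrBr => h.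
rewrite leNgt; apply/negP => bp.
have lt0 : 1 - (2 + t) < 0 by lra.
have tb : 0 < t * be by exact: mulr_gt0.
have : t * be * (1 - (2 + t)) < 0 by rewrite pmulr_rlt0.
by rewrite ltNge h.
Qed.

End Hilbert.

(** * Star actions of the unit fiber *)

Section UnitFiber.
Variables (R : realType) (G : groupType) (B : fell_bundle R G).
Local Notation Be := (B 1%g).

(** Proofs of equations in [G] are unique, so that the choice of the fiber in
    which a product or an adjoint is taken does not matter. *)
Lemma fmul_irr (s t r : G) (h h' : (s * t)%g = r) a b :
  @fmul R G B _ _ _ h a b = @fmul R G B _ _ _ h' a b.
Proof. by rewrite (eq_irrelevance h h'). Qed.

Lemma fmul_fstarl (s u r : G) (hs : (s^-1)%g = u) (h : (u * s)%g = r)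
    (h' : (s^-1 * s)%g = r) (a b : B s) :
  fmul h (fstar hs a) b = fmul h' (fstar erefl a) b.
Proof. by case: u / hs h => h; exact: fmul_irr. Qed.

Lemma fmul_fstarr (s u r : G) (hs : (s^-1)%g = u) (h : (s * u)%g = r)
    (h' : (s * s^-1)%g = r) (a b : B s) :
  fmul h b (fstar hs a) = fmul h' b (fstar erefl a).
Proof. by case: u / hs h => h; exact: fmul_irr. Qed.

Let emul_starl_norm (a : Be) :
  `|fmul (mulg1 1%g) (fstar (invg1 G) a) a| = `|a| ^+ 2.
Proof. by rewrite -fmul_starl_norm (fmul_fstarl _ _ (mulVg 1%g)). Qed.

Definition unit_fiber : cstar_algebra R :=
  @CstarAlgebra R Be (fmul (mulg1 1%g)) (fstar (invg1 G))
    (fmulA _ _ _ _) (fmul_norm _) (fstarK _ _) (fstarM _ _ _ _ _)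
    (fstar_norm _) emul_starl_norm.

Local Notation A := unit_fiber.
Local Notation U := (unitization_cstar A).

Section StarAction.
Variables (V : semi_inner R) (act : Be -> V -> V).
Hypotheses (act_linl : forall c a b x, act (c *: a + b) x = c *: act a x + act b x)
  (act_linr : forall a c x y, act a (c *: x + y) = c *: act a x + act a y)
  (act_mul : forall a b x, act (emul a b) x = act a (act b x))
  (act_star : forall a x y, sform (act a x) y = sform x (act (estar a) y)).
Implicit Types (a b : Be) (x y : V) (u v : U) (c : R[i]).

Definition uact u x : V := act u.1 x + u.2 *: x.

Lemma act0l x : act 0 x = 0.
Proof. by have := act_linl (-1) 0 0 x; rewrite scaler0 addr0 scaleN1r addNr. Qed.

Lemma act0r a : act a 0 = 0.
Proof. by have := act_linr a (-1) 0 0; rewrite scaler0 addr0 scaleN1r addNr. Qed.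

Lemma actDr a x y : act a (x + y) = act a x + act a y.
Proof. by have := act_linr a 1 x y; rewrite !scale1r. Qed.

Lemma actDl a b x : act (a + b) x = act a x + act b x.
Proof. by have := act_linl 1 a b x; rewrite !scale1r. Qed.

Lemma actZr a c x : act a (c *: x) = c *: act a x.
Proof. by have := act_linr a c x 0; rewrite act0r !addr0. Qed.

Lemma actZl a c x : act (c *: a) x = c *: act a x.
Proof. by have := act_linl c a 0 x; rewrite act0l !addr0. Qed.

Lemma uactP c u v x : uact (c *: u + v) x = c *: uact u x + uact v x.
Proof.
by rewrite /uact /= act_linl scalerDl scalerDr scalerA addrACA.
Qed.

Lemma uactM u v x : uact (u * v) x = uact u (uact v x).
Proof.
rewrite /uact /= !actDl !actZl actDr actZr.
rewrite (act_mul u.1 v.1 x : act (fmul (mulg1 1%g) u.1 v.1) x = _) scalerDr scalerA addrA.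
by congr (_ + _); rewrite addrAC.
Qed.

Lemma uact_star u x y : sform (uact u x) y = sform x (uact (ustar u) y).
Proof.
by rewrite /uact /= sformDl sformDr act_star sformZl sformZr conjCK.
Qed.

Lemma uact1 x : uact 1 x = x.
Proof. by rewrite /uact /= act0l add0r scale1r. Qed.

Lemma uactB u v x : uact (u - v) x = uact u x - uact v x.
Proof.
have -> : u - v = (-1) *: v + u by rewrite scaleN1r addrC.
by rewrite uactP scaleN1r addrC.
Qed.

Lemma uactA c x : uact (c%:A : U) x = c *: x.
Proof. by rewrite /uact /= scaler0 act0l add0r [_%:A]mulr1. Qed.

(** In the unitization, [|a|^2 - a^*a = y^2] with [y] self-adjoint, so
    [|a|^2 <x, x> - <a x, a x> = <y x, y x> >= 0]. *)
Lemma act_bd a x : sn (act a x) <= nr a * sn x.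
Proof.
pose u : U := (a, 0).
have Nu : unrm u = nr a by exact: unit_nrm_inj.
have su : ustar (ustar u * u) = ustar u * u by rewrite ustarM ustarK.
have Nuu : unrm (ustar u * u) <= nr a ^+ 2 by rewrite unrm_starl Nu.
have [y [sy _ y2 _]] := pos_sqrt (pos_of_norm su Nuu).
have ua : uact u x = act a x by rewrite /uact /= scale0r addr0.
have := Re_sform_ge0 (uact y x).
rewrite uact_star sy -uactM y2 uactB uactA sformBr sformZr conjC_real uactM.
rewrite -uact_star !sformE /= !mul0r subr0 ua subr_ge0 => h.
by rewrite -ler_sqr ?nnegrE ?sn_ge0 ?mulr_ge0 ?nr_ge0 ?sn_ge0 // exprMn.
Qed.

Local Notation H := (completion V).
Implicit Types (g h : H).

Let nr_estar a : nr (estar a) = nr a.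
Proof. exact: (@nr_cstar R A). Qed.

Let estarK a : estar (estar a) = a.
Proof. exact: (@cstarK R A). Qed.

Let estarP c a b : estar (c *: a + b) = c^* *: estar a + estar b.
Proof. by rewrite /estar linearP. Qed.

Lemma rep_approximable a g : (fun w => g (act (estar a) w)) \in @approximable_pred R V.
Proof.
apply/asboolP => e e0.
have a1 : 0 < nr a + 1 by rewrite ltr_wpDl // nr_ge0.
have [v hv] := cval_approx g (divr_gt0 e0 a1).
exists (act a v) => w; rewrite act_star; apply: le_trans (hv _) _.
have := act_bd (estar a) w; rewrite nr_estar => h.
apply: le_trans (ler_wpM2l _ h) _; first by rewrite divr_ge0 ?ltW.
rewrite mulrA ler_wpM2r ?sn_ge0 // mulrAC ler_pdivrMr // ler_pM2l //.
by rewrite lerDl ler01.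
Qed.

(** On functionals [a] acts by composition with the action of [a^*], a formula
    that makes sense on the whole completion at once. *)
Definition rep_act a g : H := Completion (rep_approximable a g).

Lemma rep_act_embed a (v : V) : rep_act a (embed v) = embed (act a v).
Proof. by apply: completion_ext => w /=; rewrite act_star. Qed.

Lemma nr_rep_act a g : nr (rep_act a g) <= nr a * nr g.
Proof.
apply: nr_completion_le => [|w]; first by rewrite mulr_ge0 ?nr_ge0.
apply: le_trans (nr_eval g _) _.
have := act_bd (estar a) w; rewrite nr_estar => h.
by apply: le_trans (ler_wpM2l (nr_ge0 g) h) _; rewrite mulrA (mulrC (nr g)).
Qed.

Let rep_act_addl g : zmod_morphism (rep_act ^~ g).
Proof.
move=> a b; apply: completion_ext => w.
have E : estar (a - b) = (-1) *: estar b + estar a.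
  have -> : a - b = (-1) *: b + a by rewrite scaleN1r addrC.
  by rewrite estarP rmorphN rmorph1.
have {}E : act (estar (a - b)) w = act (estar a) w - act (estar b) w.
  by rewrite E act_linl scaleN1r addrC.
by have := congr1 (cval g) E; rewrite evalB.
Qed.

Let rep_act_scalel g : scalable_for *:%R (rep_act ^~ g).
Proof.
move=> c a; apply: completion_ext => w.
have g0 : g 0 = 0 by rewrite -(subrr (0 : V)) evalB subrr.
have E : estar (c *: a) = c^* *: estar a by rewrite /estar linearZ.
have {}E : act (estar (c *: a)) w = c^* *: act (estar a) w + 0.
  by rewrite E actZl addr0.
by have := congr1 (cval g) E; rewrite evalP g0 addr0 conjCK.
Qed.

Let rep_act_addr a : zmod_morphism (rep_act a).
Proof. by move=> g h; apply: completion_ext. Qed.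

Let rep_act_scaler a : scalable_for *:%R (rep_act a).
Proof. by move=> c h; apply: completion_ext. Qed.

Definition rep_bilinear : {bilinear Be -> completion_hilbert V -> completion_hilbert V} :=
  HB.pack rep_act (isBilinear.Build _ _ _ _ *:%R *:%R rep_act
    rep_act_addl rep_act_addr rep_act_scalel rep_act_scaler).

End StarAction.
End UnitFiber.

(** * Bounded linear maps *)

Section BoundedLinear.
Variables (R : realType) (V W : normedModType R[i]).

Lemma lipschitz_continuous (f : V -> W) M :
  (forall x y, nr (f x - f y) <= M * nr (x - y)) -> continuous f.
Proof.
move=> fM x; apply/cvgrPdist_le => _ /posC[e e0 ->].
have M1 : 0 < `|M| + 1 by rewrite ltr_wpDl.
have d0 : (0 : R[i]) < (e / (`|M| + 1))%:C by rewrite ltcR divr_gt0.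
apply: filterS (nbhsx_ballx x _ d0) => y; rewrite -ball_normE /= -nrE ltcR => h.
rewrite -nrE lecR; apply: le_trans (fM x y) _.
apply: le_trans (_ : (`|M| + 1) * nr (x - y) <= _).
  by rewrite ler_wpM2r ?nr_ge0 //; have := ler_norm M; lra.
by rewrite mulrC -ler_pdivlMr // ltW.
Qed.

Lemma closed_span_sub (S K : set V) : closed K -> subspace K -> S `<=` K ->
  closed_span S `<=` K.
Proof.
move=> cK sK SK; rewrite /closed_span => x cx; apply: cK.
by apply: (closure_subset _ cx); apply: smallest_sub.
Qed.

Lemma sub_closed_span (S : set V) : S `<=` closed_span S.
Proof. by move=> x Sx; apply: subset_closure; exact: sub_gen_smallest. Qed.

End BoundedLinear.

(** * Representations of the unit fiber *)

Section Representations.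
Variables (R : realType) (G : groupType) (B : fell_bundle R G).
Local Notation Be := (B 1%g).
Local Notation A := (unit_fiber B).
Local Notation U := (unitization_cstar A).

Section StarRep.
Variables (V : semi_inner R) (act : Be -> V -> V).
Hypotheses (act_linl : forall (c : R[i]) a b x, act (c *: a + b) x = c *: act a x + act b x)
  (act_linr : forall a (c : R[i]) x y, act a (c *: x + y) = c *: act a x + act a y)
  (act_mul : forall a b x, act (emul a b) x = act a (act b x))
  (act_star : forall a x y, sform (act a x) y = sform x (act (estar a) y)).

Let op : {bilinear Be -> completion_hilbert V -> completion_hilbert V} :=
  rep_bilinear act_linl act_linr act_mul act_star.

Let opE a g : op a g = rep_act act_linl act_linr act_mul act_star a g.
Proof. by []. Qed.

Let op_bounded a : continuous (op a).
Proof.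
apply: (@lipschitz_continuous _ _ _ _ (nr a)) => x y.
by rewrite -linearBr; exact: nr_rep_act.
Qed.

Let op_mul a b h : op (emul a b) h = op a (op b h).
Proof.
apply: completion_ext => w /=; rewrite -act_mul; congr (cval h (act _ w)).
exact: fstarM.
Qed.

Let op_star a h k :
  hdot (completion_hilbert V) (op a h) k = hdot (completion_hilbert V) h (op (estar a) k).
Proof.
have estarK : estar (estar a) = a by exact: fstarK.
apply/eqP; rewrite -subr_eq0; apply/eqP/cabs_le_eps => e e0.
have bnd (r : R) : 0 <= r -> r * (e / (r + 1)) <= e.
  move=> r0; have r1 : 0 < r + 1 by rewrite ltr_wpDl.
  by rewrite mulrA ler_pdivrMr // mulrC ler_pM2l // lerDl ler01.
pose M := nr (op a h) + nr h * nr (estar a).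
have M0 : 0 <= M by rewrite addr_ge0 ?mulr_ge0 ?nr_ge0.
have M1 : 0 < M + 1 by rewrite ltr_wpDl.
have [w hw] := embed_dense k (divr_gt0 e0 M1).
have E : hdot (completion_hilbert V) (op a h) (embed w : completion_hilbert V) =
    hdot (completion_hilbert V) h (op (estar a) (embed w : completion_hilbert V)).
  change (inner (op a h) (embed w) = inner h (op (estar a) (embed w))).
  by rewrite !opE rep_act_embed !inner_embedr.
have -> : hdot (completion_hilbert V) (op a h) k - hdot (completion_hilbert V) h (op (estar a) k) =
   hdot (completion_hilbert V) (op a h) (k - embed w : completion_hilbert V) -
   hdot (completion_hilbert V) h (op (estar a) (k - embed w : completion_hilbert V)).
  have -> : op (estar a) (k - embed w : completion_hilbert V) =
      op (estar a) k - op (estar a) (embed w : completion_hilbert V) by exact: linearBr.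
  by rewrite !hdotBr E opprB addrA subrK.
apply: le_trans (cabsD _ _) _; rewrite cabsN.
apply: le_trans (lerD (hdot_le _ _) (hdot_le _ _)) _.
have h2 : nr (op (estar a) (k - embed w : completion_hilbert V)) <= nr (estar a) * nr (k - embed w).
  exact: nr_rep_act.
apply: le_trans (lerD (lexx _) (ler_wpM2l (nr_ge0 h) h2)) _.
rewrite mulrA -mulrDl -/M; apply: le_trans (ler_wpM2l M0 hw) _.
exact: bnd.
Qed.

Definition star_rep : representation B := Representation op_bounded op_mul op_star.

Lemma star_rep_embed a v : star_rep a (embed v : completion_hilbert V) = embed (act a v).
Proof. exact: rep_act_embed. Qed.

Lemma star_rep_eval a (g : completion V) w : cval (star_rep a g) w = g (act (estar a) w).
Proof. by []. Qed.

End StarRep.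

Section Rep.
Variable pi : representation B.
Local Notation H := (rep_space pi).
Local Notation dot := (hdot H).
Local Notation V := (hilbert_semi_inner H).
Implicit Types (a b : Be) (h k : H) (u v : U).

Let linl (c : R[i]) a b (x : V) : pi (c *: a + b) x = c *: (pi a x : V) + pi b x.
Proof. exact: linearPl. Qed.
Let linr a (c : R[i]) (x y : V) : pi a (c *: x + y) = c *: (pi a x : V) + pi a y.
Proof. exact: linearPr. Qed.
Let pimul a b (x : V) : pi (emul a b) x = pi a (pi b x).
Proof. exact: rep_mul. Qed.
Let pistar a (x y : V) : sform (pi a x : V) y = sform x (pi (estar a) y : V).
Proof. exact: rep_star. Qed.

Lemma nr_rep a h : nr (pi a h) <= nr a * nr h.
Proof.
by have := @act_bd R G B V (fun a x => pi a x) linl linr pimul pistar a h; rewrite !sn_nr.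
Qed.

(** The representation extended to the unitization. *)
Definition urep u h : H := pi u.1 h + u.2 *: h.

Lemma urepP (c : R[i]) u v h : urep (c *: u + v) h = c *: urep u h + urep v h.
Proof. exact: (@uactP R G B V (fun a x => pi a x) linl). Qed.

Lemma urepM u v h : urep (u * v) h = urep u (urep v h).
Proof. exact: (@uactM R G B V (fun a x => pi a x) linl linr pimul). Qed.

Lemma urep_star u h k : dot (urep u h) k = dot h (urep (ustar u) k).
Proof. exact: (@uact_star R G B V (fun a x => pi a x) pistar). Qed.

Lemma urep1 h : urep 1 h = h.
Proof. exact: (@uact1 R G B V (fun a x => pi a x) linl). Qed.

Lemma rep_ker_ideal : ideal (rep_ker pi).
Proof.
split.
- apply/closed_nr => a ha h; apply: nr_eq => e e0; rewrite subr0.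
  have h1 : 0 < nr h + 1 by rewrite ltr_wpDl ?nr_ge0.
  have [b kb hb] := ha _ (divr_gt0 e0 h1).
  rewrite -(subr0 (pi a h)) -(kb h) -linearBl; apply: le_trans (nr_rep _ _) _.
  apply: le_trans (ler_wpM2r (nr_ge0 h) hb) _.
  by rewrite mulrAC ler_pdivrMr // ler_pM2l // lerDl ler01.
- split=> [h|c a b ha hb h]; first by rewrite linear0l.
  by rewrite linearPl ha hb scaler0 addr0.
- by move=> a x kx; split=> h; rewrite rep_mul kx // linear0r.
Qed.

(** The vectors killed by a right ideal form a closed invariant subspace. *)
Lemma irreducible_ideal_vector (K : set Be) h : irreducible pi ->
  (forall x a, K x -> K (emul x a)) -> ~ K `<=` rep_ker pi -> h != 0 ->
  exists2 k : Be, K k & pi k h != 0.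
Proof.
move=> [_ irr] Kr Kpi h0.
apply: contrapT => Kh.
have [|||M0|MT] := irr [set h | forall k : Be, K k -> pi k h = 0].
- apply/closed_nr => x hx k Kk; apply: nr_eq => e e0; rewrite subr0.
  have k1 : 0 < nr k + 1 by rewrite ltr_wpDl ?nr_ge0.
  have [y hy yx] := hx _ (divr_gt0 e0 k1).
  rewrite -(subr0 (pi k x)) -(hy k Kk) -linearBr; apply: le_trans (nr_rep _ _) _.
  apply: le_trans (ler_wpM2l (nr_ge0 k) yx) _.
  by rewrite mulrA ler_pdivrMr // mulrC ler_pM2l // lerDl ler01.
- split=> [k _|c x y hx hy k Kk]; first by rewrite linear0r.
  by rewrite linearPr hx // hy // scaler0 addr0.
- by move=> a x hx k Kk; rewrite -rep_mul; apply: hx; exact: Kr.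
- have : [set h | forall k : Be, K k -> pi k h = 0] h.
    move=> k Kk; apply/eqP/negPn/negP => kh; apply: Kh; by exists k.
  by rewrite M0 /=; move/eqP; rewrite (negbTE h0).
- apply: Kpi => k Kk x.
  have : [set h | forall k : Be, K k -> pi k h = 0] x by rewrite MT.
  by move=> /(_ k Kk).
Qed.

End Rep.

Lemma idealE (J : set Be) : ideal J ->
  [/\ J 0, forall (c : R[i]) x y, J x -> J y -> J (c *: x + y),
      forall a x, J x -> J (emul a x), forall a x, J x -> J (emul x a) &
      forall x, (forall e, 0 < e -> exists2 y, J y & nr (x - y) <= e) -> J x].
Proof.
move=> [/closed_nr cJ [J0 Jlin] Jmul]; split=> //.
- by move=> a x Jx; have [] := Jmul a x Jx.
- by move=> a x Jx; have [] := Jmul a x Jx.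
Qed.
End Representations.

(** * The irreducible representations separate the closed ideals *)

Section Separation.
Variables (R : realType) (G : groupType) (B : fell_bundle R G).
Local Notation Be := (B 1%g).
Local Notation A := (unit_fiber B).
Local Notation U := (unitization_cstar A).
Variable J : set Be.
Hypothesis idJ : ideal J.
Implicit Types (u v w x y : U).

Definition unit_ideal u := J u.1 /\ u.2 = 0.

Lemma unit_ideal0 : unit_ideal 0.
Proof. by have [J0 _ _ _ _] := idealE idJ. Qed.

Lemma unit_ideal_lin (c : R[i]) x y : unit_ideal x -> unit_ideal y -> unit_ideal (c *: x + y).
Proof.
have [_ Jlin _ _ _] := idealE idJ.
move=> [Jx x0] [Jy y0]; split; first exact: Jlin.
by change (c * x.2 + y.2 = 0 :> R[i]); rewrite x0 y0 mulr0 addr0.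
Qed.

Lemma unit_ideal_mull v x : unit_ideal x -> unit_ideal (v * x).
Proof.
have [J0 Jlin Jl _ _] := idealE idJ.
move=> [Jx x0]; split; last by change (v.2 * x.2 = 0 :> R[i]); rewrite x0 mulr0.
change (J (emul v.1 x.1 + v.2 *: x.1 + x.2 *: v.1)); rewrite x0 scale0r addr0 addrC.
by apply: Jlin => //; exact: Jl.
Qed.

Lemma unit_ideal_mulr v x : unit_ideal x -> unit_ideal (x * v).
Proof.
have [J0 Jlin _ Jr _] := idealE idJ.
move=> [Jx x0]; split; last by change (x.2 * v.2 = 0 :> R[i]); rewrite x0 mul0r.
change (J (emul x.1 v.1 + x.2 *: v.1 + v.2 *: x.1)); rewrite x0 scale0r addr0 addrC.
by apply: Jlin => //; exact: Jr.
Qed.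

Lemma unit_ideal_closed x :
  (forall e, 0 < e -> exists2 y, unit_ideal y & unrm (x - y) <= e) -> unit_ideal x.
Proof.
have [_ _ _ _ Jc] := idealE idJ.
move=> h; split.
  apply: Jc => e e0; have [y [Jy _] hy] := h (e / 2) (divr_gt0 e0 (ltr0n _ 2)).
  exists y.1 => //; apply: le_trans (unit_fst_le (x - y)) _.
  by rewrite [leRHS]splitr; apply: lerD.
apply: cabs_le_eps => e e0; have [y [_ y0] hy] := h e e0.
have [_ _] := unit_nrmP (x - y).
have -> : (x - y).2 = x.2 :> R[i] by change (x.2 - y.2 = x.2 :> R[i]); rewrite y0 subr0.
by move=> h2; exact: le_trans h2 hy.
Qed.

Section VectorFunctional.
Variables (pi : representation B) (m : rep_space pi).
Hypothesis piJ : J `<=` rep_ker pi.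
Local Notation dot := (hdot (rep_space pi)).

Definition vector_functional u : R[i] := dot (urep u m) m.

Lemma vector_functional_positive : positive_mod unit_ideal vector_functional.
Proof.
split.
- by move=> c x y; rewrite /vector_functional urepP hdotP.
- by move=> x; rewrite /vector_functional -hdotC urep_star ustarK.
- by move=> x; rewrite /vector_functional urepM urep_star ustarK hdot_ge0.
- move=> x [Jx x0]; rewrite /vector_functional /urep x0 scale0r addr0.
  by rewrite (piJ Jx) hdot0l.
Qed.

End VectorFunctional.

Section GNS.
Variable F : U -> R[i].
Hypothesis Fpos : positive_mod unit_ideal F.

Let Flin (c : R[i]) x y : F (c *: x + y) = c * F x + F y.
Proof. by have [h _ _ _] := Fpos. Qed.

Let gns_formP (c : R[i]) x y z :
  F (ustar z * (c *: x + y)) = c * F (ustar z * x) + F (ustar z * y).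
Proof. by rewrite mulrDr -scalerAr Flin. Qed.

Let gns_form_conj x y : F (ustar x * y) = (F (ustar y * x))^*.
Proof. by have [_ h _ _] := Fpos; rewrite -h ustarM ustarK. Qed.

Let gns_form_ge0 x : 0 <= F (ustar x * x).
Proof. by have [_ _ h _] := Fpos; exact: h. Qed.

Definition gns_space : semi_inner R :=
  @SemiInner R U (fun x y => F (ustar y * x)) gns_formP gns_form_conj gns_form_ge0.
Local Notation V := gns_space.

Definition unit_inj (a : Be) : U := (a, 0).

Definition gns_act (a : Be) (x : V) : V := (unit_inj a * x : U).

Lemma unit_injP (c : R[i]) (a b : Be) : unit_inj (c *: a + b) = c *: unit_inj a + unit_inj b.
Proof. by congr (_, _); change (0 = c * 0 + 0 :> R[i]); rewrite mulr0 addr0. Qed.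

Lemma unit_injM (a b : Be) : unit_inj (emul a b) = unit_inj a * unit_inj b.
Proof.
congr (_, _); last by rewrite /= mulr0.
by rewrite /= !scale0r !addr0.
Qed.

Lemma unit_inj_star (a : Be) : unit_inj (estar a) = ustar (unit_inj a).
Proof. by congr (_, _); rewrite /= rmorph0. Qed.

Let gns_linl (c : R[i]) (a b : Be) (x : V) :
  gns_act (c *: a + b) x = c *: gns_act a x + gns_act b x.
Proof. by rewrite /gns_act unit_injP mulrDl -scalerAl. Qed.

Let gns_linr (a : Be) (c : R[i]) (x y : V) :
  gns_act a (c *: x + y) = c *: gns_act a x + gns_act a y.
Proof. by rewrite /gns_act mulrDr -scalerAr. Qed.

Let gns_mul (a b : Be) (x : V) : gns_act (emul a b) x = gns_act a (gns_act b x).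
Proof. by rewrite /gns_act unit_injM mulrA. Qed.

Let gns_star (a : Be) (x y : V) : sform (gns_act a x) y = sform x (gns_act (estar a) y).
Proof.
change (F (ustar y * (unit_inj a * x)) = F (ustar (unit_inj (estar a) * y) * x)).
by rewrite unit_inj_star ustarM ustarK mulrA.
Qed.

Definition gns : representation B := star_rep gns_linl gns_linr gns_mul gns_star.
Local Notation H := (rep_space gns).
Local Notation dot := (hdot H).

Definition gns_vector : H := embed (1 : V).
Local Notation xi := gns_vector.

Lemma gns_cyclic (u : U) : urep u xi = embed (u : V).
Proof.
rewrite /urep /xi star_rep_embed.
have -> : (embed (gns_act u.1 1 : V) : H) = u.2 *: (- embed (1 : V) : H) + embed (u : V).
  rewrite scalerN -scaleNr; have := embedP (- u.2) (1 : V) (u : V) => <-; congr embed.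
  rewrite /gns_act mulr1; case: u => b c; congr (_, _) => /=; first by rewrite scaler0 add0r.
  by rewrite /GRing.scale /= mulr1 addNr.
by rewrite scalerN addrC addrA subrr add0r.
Qed.

Lemma gns_dot_embed (g : H) (v : U) : dot g (embed (v : V) : H) = cval g v.
Proof. exact: inner_embedr. Qed.

(** For [j] in [J], [j^* w] has length zero, as [w^* j j^* w] is in the ideal. *)
Lemma gns_vanish : J `<=` rep_ker gns.
Proof.
have [_ _ Jl _ _] := idealE idJ; have [_ _ _ FK] := Fpos.
move=> j Jj g; apply: completion_ext => w; rewrite star_rep_eval.
apply: cabs0_eq0; apply/le_anti; rewrite cabs_ge0 andbT.
apply: le_trans (nr_eval g _) _.
suff -> : sn (gns_act (estar j) w) = 0 by rewrite mulr0.
have E : sform (gns_act (estar j) w) (gns_act (estar j) w) = 0.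
  change (F (ustar (unit_inj (estar j) * w) * (unit_inj (estar j) * w)) = 0).
  rewrite FK // unit_inj_star ustarM ustarK.
  by apply: unit_ideal_mulr; apply: unit_ideal_mull; split.
by rewrite /sn E /= sqrtr0.
Qed.

Lemma gns_dense (M : set H) : closed M -> subspace M ->
  (forall a h, M h -> M (gns a h)) -> M xi -> M = setT.
Proof.
move=> /closed_nr cM [M0 Mlin] inv Mxi; apply/seteqP; split=> // g _.
apply: cM => e e0; have [v hv] := embed_dense g e0; exists (embed v) => //.
rewrite -gns_cyclic /urep addrC; apply: Mlin => //; exact: inv.
Qed.

Hypothesis F1 : F 1 = 1.
Hypothesis Fpure : forall g h, positive_mod unit_ideal g -> positive_mod unit_ideal h ->
      (forall u, F u = g u + h u) -> 0 < complex.Re (g 1) < 1 ->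
      forall u, g u = g 1 * F u.

Variable a0 : Be.
Hypothesis Fa0 : F (ustar (unit_inj a0) * unit_inj a0) <> 0.

Lemma gns_nonzero : gns a0 xi != 0.
Proof.
apply/eqP => E; apply: Fa0.
have v1 : gns_act a0 (1 : U) = unit_inj a0 by rewrite /gns_act mulr1.
have : dot (gns a0 xi) (gns a0 xi) = 0 by rewrite E hdot0l.
by rewrite /xi star_rep_embed v1 gns_dot_embed.
Qed.

Let FE u : F u = dot (urep u xi) xi.
Proof.
rewrite gns_cyclic gns_dot_embed; change (F u = F (ustar 1 * u)).
by rewrite ustar1 mul1r.
Qed.

Let urepD u (g h : H) : urep u (g + h) = urep u g + urep u h.
Proof. by rewrite /urep linearDr scalerDr addrACA. Qed.

(** The projection [m] of the cyclic vector [xi] to an invariant subspace splits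
    the state into the vector functionals of [m] and [xi - m]. Unless one of
    these vectors vanishes, purity makes [m] a multiple of [xi], so that the
    subspace contains the cyclic vector. *)
Lemma gns_irreducible : irreducible gns.
Proof.
split; first by exists a0, xi; split => //; exact: gns_nonzero.
move=> M cM sM inv; have [M0 Mlin] := sM.
have [m Mm orth] := projection_exists xi cM sM.
have [m' m'E] : exists m', m' = xi - m by eexists.
rewrite -m'E in orth.
have xiE : xi = m + m' by rewrite m'E addrC subrK.
have Minv u h : M h -> M (urep u h).
  by move=> Mh; rewrite /urep addrC; apply: (Mlin _ _ _ Mh); exact: inv.
have orthl u (y : H) : M y -> dot (urep u m') y = 0.
  by move=> My; rewrite urep_star; apply: orth; exact: Minv.
have orthr u (y : H) : M y -> dot (urep u y) m' = 0.
  by move=> My; rewrite hdotC orth ?rmorph0 //; exact: Minv.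
have [m0|m0] := eqVneq m 0.
  left; apply/seteqP; split=> [y My|y ->] //=.
  apply: completion_ext => v; rewrite -gns_dot_embed -gns_cyclic.
  rewrite -[v](ustarK (v : U)) -urep_star xiE m0 add0r orthr //.
have [m'0|m'0] := eqVneq m' 0.
  by right; apply: gns_dense => //; rewrite xiE m'0 addr0.
right.
have FgD u : F u = vector_functional m u + vector_functional m' u.
  rewrite FE {1}xiE urepD hdotDl xiE !hdotDr orthl // orthr // addr0 add0r.
  by [].
have vf1 (k : H) : vector_functional k 1 = (nr k ^+ 2)%:C.
  by rewrite /vector_functional urep1 hdotE.
have nm : 0 < nr m ^+ 2.
  rewrite exprn_gt0 // lt_neqAle nr_ge0 andbT eq_sym.
  by apply: contra m0 => /eqP/nr0_eq0 ->.
have nm' : 0 < nr m' ^+ 2.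
  rewrite exprn_gt0 // lt_neqAle nr_ge0 andbT eq_sym.
  by apply: contra m'0 => /eqP/nr0_eq0 ->.
have sum1 : nr m ^+ 2 + nr m' ^+ 2 = 1.
  by apply: complexI; rewrite rmorphD /= -!vf1 -FgD F1.
have pure u : vector_functional m u = vector_functional m 1 * F u.
  apply: (Fpure (vector_functional_positive m gns_vanish)
    (vector_functional_positive m' gns_vanish) FgD).
  by rewrite vf1 /= nm; lra.
have mE : m = (nr m ^+ 2)%:C *: xi.
  apply: completion_ext => v.
  have -> : cval ((nr m ^+ 2)%:C *: xi) v = (nr m ^+ 2)%:C * cval xi v by [].
  rewrite -!gns_dot_embed -gns_cyclic -{1 2}[v](ustarK (v : U)) -!urep_star.
  by rewrite -FE -vf1 -pure xiE hdotDr orthr // addr0.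
apply: gns_dense => //.
have -> : xi = (nr m ^+ 2)%:C^-1 *: m + 0.
  rewrite addr0 {2}mE scalerA mulVf ?scale1r //.
  by apply/eqP => /complexI/eqP; rewrite gt_eqF.
exact: Mlin.
Qed.

End GNS.

(** The GNS representation of a pure state of the unitization that vanishes on
    [J] and not at [a^*a]. *)
Theorem irreducible_separation (a : Be) : ~ J a ->
  exists pi : representation B, [/\ irreducible pi, J `<=` rep_ker pi & ~ rep_ker pi a].
Proof.
move=> Ja.
have Ka : ~ unit_ideal (unit_inj a) by move=> [].
have [F [Fpos F1 Fa Fpure]] := pure_state_exists unit_ideal0 unit_ideal_lin
  unit_ideal_mull unit_ideal_mulr unit_ideal_closed Ka.
exists (gns Fpos); split.
- exact: gns_irreducible Fpure _ Fa.
- exact: gns_vanish.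
- by move=> /(_ (gns_vector Fpos)) E; have := gns_nonzero Fpos Fa; rewrite E eqxx.
Qed.

End Separation.

(** * Closed spans and density *)

Section ClosedSpan.
Variables (R : realType).

Lemma smallest_subspace (V : normedModType R[i]) (S : set V) :
  subspace (smallest (@subspace R V) S).
Proof.
split=> [M [[M0 _] _] //|c x y Sx Sy M [sM SM]].
by have [_ Mlin] := sM; apply: Mlin; [apply: Sx|apply: Sy].
Qed.

Lemma closed_span_subspace (V : normedModType R[i]) (S : set V) : subspace (closed_span S).
Proof.
have [S0 Slin] := smallest_subspace S.
split; first exact: subset_closure.
move=> c x y /closure_nr cx /closure_nr cy; apply/closure_nr => e e0.
have c1 : 0 < cabs c + 1 by rewrite ltr_wpDl ?cabs_ge0.
have d0 : 0 < e / (cabs c + 1) by exact: divr_gt0.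
have [x' Sx' hx] := cx _ d0; have [y' Sy' hy] := cy _ d0.
exists (c *: x' + y'); first exact: Slin.
rewrite opprD addrACA -scalerBr; apply: le_lt_trans (nrD _ _) _; rewrite nrZ.
set d := e / _ in hx hy d0.
have dE : e = cabs c * d + d by rewrite /d; field; rewrite gt_eqF.
rewrite dE; apply: ler_ltD => //; rewrite ler_wpM2l ?cabs_ge0 // ltW //.
Qed.

Lemma closed_span_closed (V : normedModType R[i]) (S : set V) : closed (closed_span S).
Proof. exact: closed_closure. Qed.

Lemma closed_span_image (V W : normedModType R[i]) (f : V -> W) (M : R) (S : set V) (S' : set W) :
  (forall (c : R[i]) x y, f (c *: x + y) = c *: f x + f y) -> f 0 = 0 ->
  (forall x y, nr (f x - f y) <= M * nr (x - y)) ->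
  (forall x, S x -> closed_span S' (f x)) ->
  forall x, closed_span S x -> closed_span S' (f x).
Proof.
move=> flin f0 flip fS x; apply: (@closed_span_sub _ _ _ [set x | closed_span S' (f x)]).
- have := @closed_span_closed W S' => /closed_nr cS.
  apply/closed_nr => y hy; apply: cS => e e0.
  have M1 : 0 < `|M| + 1 by rewrite ltr_wpDl.
  have [z Sz hz] := hy _ (divr_gt0 e0 M1); exists (f z) => //.
  apply: le_trans (flip y z) _.
  apply: le_trans (_ : (`|M| + 1) * nr (y - z) <= _).
    by rewrite ler_wpM2r ?nr_ge0 //; have := ler_norm M; lra.
  by rewrite mulrC -ler_pdivlMr.
- have [S0 Slin] := closed_span_subspace S'.
  split=> [|c u v hu hv] /=; first by rewrite f0.
  by rewrite flin; exact: Slin.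
- exact: fS.
Qed.

End ClosedSpan.

Section Density.
Variables (R : realType) (V : semi_inner R) (W : normedModType R[i]).

Lemma dense_eq (f g : completion V -> W) M M' :
  (forall x y, nr (f x - f y) <= M * nr (x - y)) ->
  (forall x y, nr (g x - g y) <= M' * nr (x - y)) ->
  (forall v, f (embed v) = g (embed v)) -> forall x, f x = g x.
Proof.
move=> fM gM fg x; apply: nr_eq => e e0.
have M1 : 0 < `|M| + `|M'| + 1 by rewrite ltr_wpDl ?addr_ge0.
have [v hv] := embed_dense x (divr_gt0 e0 M1).
apply: le_trans (nr_triangle (f (embed v)) _ _) _; rewrite {2}fg.
apply: le_trans (lerD (fM _ _) (gM _ _)) _; rewrite (nrBC (embed v)) -mulrDl.
apply: le_trans (_ : (`|M| + `|M'| + 1) * nr (x - embed v) <= _).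
  rewrite ler_wpM2r ?nr_ge0 //; have := ler_norm M; have := ler_norm M'; lra.
by rewrite mulrC -ler_pdivlMr.
Qed.

End Density.

(** * Induced representations *)

Section Induced.
Variables (R : realType) (G : groupType) (B : fell_bundle R G) (t : G).
Local Notation Be := (B 1%g).
Implicit Types (a d : Be) (b c : B t) (x y z : B t^-1%g).

Lemma fstarVK (b : B t) : fstar (invgK t) (fstar erefl b : B t^-1%g) = b.
Proof. exact: fstarK. Qed.

Lemma fstarKV (x : B t^-1%g) : fstar erefl (fstar (invgK t) x) = x.
Proof. exact: fstarK. Qed.

(** The involution identifies [B_t] with [B_{t^-1}]: the ideal [D_{t^-1}], defined
    by products [x y^*] of elements of [B_{t^-1}], contains the [c^* b]. *)
Lemma Dideal_gen b c : Dideal t^-1%g (fmul (mulVg t) (fstar erefl c) b).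
Proof.
apply: sub_closed_span; exists (fstar erefl c), (fstar erefl b).
by rewrite -(fmul_fstarr (invgK t) (mulVg t)) fstarVK.
Qed.

Section KernelFormula.
Variables (pi rho : representation B).
Hypothesis ind : is_induced t pi rho.

(** The matrix coefficients of [rho a] between elementary tensors are those of
    the [pi (c^* a b)], and the elementary tensors span a dense subspace. *)
Lemma induced_kernel a : rep_ker rho a <->
  forall b c, rep_ker pi (fmul (mulVg t) (fstar erefl c) (fmul (mul1g t) a b)).
Proof.
have [q [_ qdot qspan qact]] := ind.
split=> [ra b c h|h].
  apply: hdot_eq0; rewrite -qdot -qact ra hdot0l //.
have K (b : B t) k : rho a (q b k) = 0.
  apply: hdot_eq0; apply: (closed_subspace_orth (A := [set v | exists b h, v = q b h])).
    by move=> _ [c [k' ->]]; rewrite qact qdot h hdot0l.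
  by rewrite qspan.
move=> k; have : closed_span [set v | exists b h, v = q b h] k by rewrite qspan.
apply: (closed_span_sub (K := [set v | rho a v = 0])) => [||_ [b [k' ->]]]; last exact: (K b k').
  apply/closed_nr => v hv; apply: nr_eq => e e0; rewrite subr0.
  have a1 : 0 < nr a + 1 by rewrite ltr_wpDl ?nr_ge0.
  have [w hw vw] := hv _ (divr_gt0 e0 a1).
  rewrite -(subr0 (rho a v)) -hw -linearBr; apply: le_trans (nr_rep _ _) _.
  apply: le_trans (ler_wpM2l (nr_ge0 a) vw) _.
  by rewrite mulrA ler_pdivrMr // mulrC ler_pM2l // lerDl ler01.
split=> [|s u v hu hv] /=; first by rewrite linear0r.
by rewrite linearPr hu hv scaler0 addr0.
Qed.

End KernelFormula.

Section Existence.
Variables (rho : representation B) (k : rep_space rho).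
Local Notation dot := (hdot (rep_space rho)).

(** The tensors [x (x) k] of [B_{t^-1} (x) rho], for a fixed vector [k]. The form is
    positive because [x^*x] is of the form [c^*c] with [c] in [B_e]. *)
Let form x y : R[i] := dot (rho (fmul (mulgV t) (fstar (invgK t) y) x) k) k.

Let formP (s : R[i]) x y z : form (s *: x + y) z = s * form x z + form y z.
Proof. by rewrite /form linearPr linearPl hdotP. Qed.

Let estar_mul (b : B t) (x : B t^-1%g) : estar (fmul (mulgV t) b x) =
  fmul (mulgV t) (fstar (invgK t) x) (fstar erefl b).
Proof. exact: fstarM. Qed.

Let form_conj x y : form y x = (form x y)^*.
Proof.
by rewrite /form -hdotC rep_star estar_mul fstarKV.
Qed.

Let form_ge0 x : 0 <= form x x.
Proof.
have [c E] := fmul_starl_pos x.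
rewrite /form (fmul_fstarl _ _ (mulVg t^-1%g)) E.
rewrite -/(emul (estar c) c) rep_mul rep_star /estar fstarK hdot_ge0 //.
Qed.

Definition induced_space : semi_inner R := @SemiInner R (B t^-1%g) form formP form_conj form_ge0.
Local Notation V := induced_space.

Definition induced_act a (x : V) : V := fmul (mul1g t^-1%g) a x.

Let act_linl (s : R[i]) a d (x : V) :
  induced_act (s *: a + d) x = s *: induced_act a x + induced_act d x.
Proof. exact: linearPl. Qed.

Let act_linr a (s : R[i]) (x y : V) :
  induced_act a (s *: x + y) = s *: induced_act a x + induced_act a y.
Proof. exact: linearPr. Qed.

Let act_mul a d (x : V) : induced_act (emul a d) x = induced_act a (induced_act d x).
Proof. exact: fmulA. Qed.

Let act_star a (x y : V) : sform (induced_act a x) y = sform x (induced_act (estar a) y).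
Proof.
change (form (fmul (mul1g t^-1%g) a x) y = form x (fmul (mul1g t^-1%g) (estar a) y)).
rewrite /form; congr (dot (rho _ k) k).
have -> : fstar (invgK t) (fmul (mul1g t^-1%g) (estar a) y) =
    fmul (mulg1 t) (fstar (invgK t) y) (estar (estar a)) by exact: fstarM.
have -> : estar (estar a) = a by exact: fstarK.
by rewrite -(fmulA (mulg1 t) (mulgV t)).
Qed.

Definition induced_rep : representation B := star_rep act_linl act_linr act_mul act_star.

Local Notation pi := induced_rep.
Local Notation Hp := (rep_space induced_rep).
Local Notation iota x := (embed (x : V) : Hp).

(** The map [x (x) k -> b x k] to be extended to the completion. *)
Let T (b : B t) (x : V) : rep_space rho := rho (fmul (mulgV t) b x) k.

Let T_lin b (s : R[i]) (x y : V) : T b (s *: x + y) = s *: T b x + T b y.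
Proof. by rewrite /T linearPr linearPl. Qed.

Let T_dot b c (x y : V) : dot (T b x) (T c y) =
  sform (induced_act (fmul (mulVg t) (fstar erefl c) b) x) y.
Proof.
have -> : dot (T b x) (T c y) =
    dot (rho (emul (estar (fmul (mulgV t) c y)) (fmul (mulgV t) b x)) k) k.
  rewrite rep_mul rep_star; congr (dot (T b x) (rho _ k)).
  by symmetry; exact: fstarK.
rewrite estar_mul; congr (dot (rho _ k) k).
rewrite /emul /induced_act.
rewrite (fmulA (mulgV t) (mulg1 1%g) (mulg1 t^-1%g) (mulgV t)).
congr (fmul _ _); symmetry; exact: fmulA.
Qed.

Let T_bd b (x : V) : nr (T b x) <= (nr (fmul (mulVg t) (fstar erefl b) b) + 1) * sn x.
Proof.
set d := fmul _ _ _; have d0 := nr_ge0 d; have x0 := sn_ge0 x.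
rewrite -ler_sqr ?nnegrE ?nr_ge0 ?mulr_ge0 ?addr_ge0 //.
have -> : nr (T b x) ^+ 2 = complex.Re (dot (T b x) (T b x)) by rewrite hdotE.
rewrite T_dot; apply: le_trans (le_Re_cabs _) _; apply: le_trans (cauchy_schwarz _ _) _.
apply: le_trans (ler_wpM2r x0 (act_bd act_linl act_linr act_mul act_star d x)) _.
rewrite -mulrA -expr2 exprMn ler_wpM2r ?sqr_ge0 //; nra.
Qed.

Let bd b := nr (fmul (mulVg t) (fstar erefl b) b) + 1.

Let bd_ge0 b : 0 <= bd b.
Proof. by rewrite addr_ge0 ?nr_ge0. Qed.

Let q (b : B t) : Hp -> rep_space rho :=
  projT1 (cid (extension_exists (T_lin b) (T_bd b) (bd_ge0 b))).

Let q_lin b (s : R[i]) g h : q b (s *: g + h) = s *: q b g + q b h.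
Proof. by rewrite /q; case: cid => E /= [El _ _]; exact: El. Qed.

Let q_bd b g : nr (q b g) <= bd b * nr g.
Proof. by rewrite /q; case: cid => E /= [_ Eb _]; exact: Eb. Qed.

Let q_embed b (x : V) : q b (iota x) = T b x.
Proof. by rewrite /q; case: cid => E /= [_ _ Ee]; exact: Ee. Qed.

Let qB b g h : q b (g - h) = q b g - q b h.
Proof.
have -> : g - h = (-1) *: h + g by rewrite scaleN1r addrC.
by rewrite q_lin scaleN1r addrC.
Qed.

Let q_lip b g h : nr (q b g - q b h) <= bd b * nr (g - h).
Proof. by rewrite -qB. Qed.

Let q_linl g (s : R[i]) b c : q (s *: b + c) g = s *: q b g + q c g.
Proof.
apply: (@dense_eq R V (rep_space rho) (fun g => q (s *: b + c) g)
   (fun g => s *: q b g + q c g) (bd (s *: b + c)) (cabs s * bd b + bd c)).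
- by move=> x y; exact: q_lip.
- move=> x y; rewrite opprD addrACA -scalerBr; apply: le_trans (nrD _ _) _.
  by rewrite nrZ mulrDl -mulrA; apply: lerD; rewrite ?ler_wpM2l ?cabs_ge0 //; exact: q_lip.
- by move=> x; rewrite !q_embed /T linearPl linearPl.
Qed.

Let q_addl g : zmod_morphism (q ^~ g).
Proof.
move=> b c; have -> : b - c = (-1) *: c + b by rewrite scaleN1r addrC.
by rewrite q_linl scaleN1r addrC.
Qed.

Let q_addr b : zmod_morphism (q b).
Proof. by move=> g h; exact: qB. Qed.

Let q_scalel g : scalable_for *:%R (q ^~ g).
Proof.
move=> s b; have q0 : q 0 g = 0 by rewrite -(subrr (0 : B t)) q_addl subrr.
by rewrite -[s *: b]addr0 q_linl q0 addr0.
Qed.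

Let q_scaler b : scalable_for *:%R (q b).
Proof.
move=> s g; have q0 : q b 0 = 0 by rewrite -(subrr (0 : Hp)) qB subrr.
by rewrite -[s *: g]addr0 q_lin q0 addr0.
Qed.

Let q_bil : {bilinear B t -> Hp -> rep_space rho} :=
  HB.pack q (isBilinear.Build _ _ _ _ *:%R *:%R q q_addl q_addr q_scalel q_scaler).

Let q_act a b g : rho a (q b g) = q (fmul (mul1g t) a b) g.
Proof.
apply: (@dense_eq R V (rep_space rho) (fun g => rho a (q b g))
   (fun g => q (fmul (mul1g t) a b) g) (nr a * bd b) (bd (fmul (mul1g t) a b))).
- move=> x y; rewrite -linearBr; apply: le_trans (nr_rep _ _) _.
  by rewrite -mulrA ler_wpM2l ?nr_ge0 //; exact: q_lip.
- by move=> x y; exact: q_lip.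
- move=> x; rewrite !q_embed /T -rep_mul; congr (rho _ k).
  by symmetry; exact: fmulA.
Qed.

Let q_balanced b d g : q (fmul (mulg1 t) b d) g = q b (pi d g).
Proof.
apply: (@dense_eq R V (rep_space rho) (fun g => q (fmul (mulg1 t) b d) g)
   (fun g => q b (pi d g)) (bd (fmul (mulg1 t) b d)) (bd b * nr d)).
- by move=> x y; exact: q_lip.
- move=> x y; apply: le_trans (q_lip _ _ _) _; rewrite -linearBr -mulrA.
  by rewrite ler_wpM2l //; exact: nr_rep.
- move=> x; rewrite (star_rep_embed act_linl act_linr act_mul act_star) !q_embed /T.
  by congr (rho _ k); exact: fmulA.
Qed.

(** [q c] is adjoint to the map [h -> c^* (x) h], here evaluated at [k]. *)
Let q_adj c g : dot (q c g) k = cval g (fstar erefl c).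
Proof.
apply: (@dense_eq R V R[i]^o (fun g => dot (q c g) k)
   (fun g => cval g (fstar erefl c)) (nr k * bd c) (@sn R V (fstar erefl c))).
- move=> x y; rewrite -hdotBl -qB; apply: le_trans (hdot_le _ _) _.
  by rewrite mulrC -mulrA ler_wpM2l ?nr_ge0 //; exact: q_bd.
- move=> x y; rewrite mulrC; exact: (nr_eval (x - y) (fstar erefl c)).
- move=> x; rewrite q_embed /T; congr (dot (rho _ k) k).
  by congr (fmul _ _ _); symmetry; exact: fstarVK.
Qed.

Let q_dot b c g h : dot (q b g) (q c h) =
  hdot Hp (pi (fmul (mulVg t) (fstar erefl c) b) g) h.
Proof.
set d := fmul _ _ _.
apply: (@dense_eq R V R[i]^o (fun g => dot (q b g) (q c h))
   (fun g => hdot Hp (pi d g) h) (bd b * nr (q c h)) (nr d * nr h)).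
- move=> x y; rewrite -hdotBl -qB; apply: le_trans (hdot_le _ _) _.
  by rewrite mulrAC ler_wpM2r ?nr_ge0 //; exact: q_bd.
- move=> x y; rewrite -hdotBl -linearBr; apply: le_trans (hdot_le _ _) _.
  by rewrite mulrAC ler_wpM2r ?nr_ge0 //; exact: nr_rep.
move=> x.
apply: (@dense_eq R V R[i]^o (fun h => dot (q b (iota x)) (q c h))
   (fun h => hdot Hp (pi d (iota x)) h) (nr (q b (iota x)) * bd c) (nr (pi d (iota x)))).
- move=> u v; rewrite -hdotBr -qB; apply: le_trans (hdot_le _ _) _.
  by rewrite -mulrA ler_wpM2l ?nr_ge0 //; exact: q_bd.
- by move=> u v; rewrite -hdotBr; exact: hdot_le.
move=> y; rewrite (star_rep_embed act_linl act_linr act_mul act_star) !q_embed T_dot.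
by symmetry; exact: inner_embedr.
Qed.

Hypothesis irr : irreducible rho.
Variables (c0 : B t) (x0 : B t^-1%g).
Hypothesis nz : rho (fmul (mulgV t) c0 x0) k != 0.

(** Closed spans of vectors [b (x) m] with [m] in a given set are invariant under
    [rho], hence trivial. *)
Let span_invariant (M : Hp -> Prop) :
  let S := [set v | exists b h, M h /\ v = q b h] in
  closed_span S = [set 0] \/ closed_span S = setT.
Proof.
move=> S; apply: irr.2; first exact: closed_span_closed.
  exact: closed_span_subspace.
move=> a; apply: (@closed_span_image R _ _ (fun v => rho a v) (nr a)).
- by move=> s u v; rewrite linearPr.
- by rewrite linear0r.
- by move=> u v; rewrite -linearBr; exact: nr_rep.
- move=> _ [b [h [Mh ->]]]; apply: sub_closed_span.
  by exists (fmul (mul1g t) a b), h; split.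
Qed.

(** Let [M] be a closed invariant subspace. If [B_t (x) M] spans zero, then [M] is
    zero by [q_adj]. Otherwise it spans the whole space; the component
    [z = g - m] orthogonal to [M] of a vector [g] satisfies
    [<q b h, q c z> = <pi (c^* b) h, z> = 0] for [h] in [M], so [q c z = 0] for
    all [c] and [z = 0], again by [q_adj]. *)
Lemma induced_exists_of_vector : exists pi : representation B,
  [/\ irreducible pi, restriction_nonzero pi (Dideal t^-1%g) & is_induced t pi rho].
Proof.
exists pi.
have nzd : restriction_nonzero pi (Dideal t^-1%g).
  exists (fmul (mulVg t) (fstar erefl c0) c0), (iota x0); split; first exact: Dideal_gen.
  apply/eqP => E; move/eqP: nz; apply; apply: hdot_eq0.
  have := q_dot c0 c0 (iota x0) (iota x0).
  by rewrite E hdot0l q_embed.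
have q_zero (z : Hp) : (forall c, q c z = 0) -> z = 0.
  move=> qz; apply: completion_ext => x; rewrite -(fstarKV x) -q_adj qz hdot0l //.
split=> //; last first.
  exists q_bil; split.
  - by move=> b d h _; exact: q_balanced.
  - exact: q_dot.
  - have [E0|//] := span_invariant (fun _ => True); last first.
      move=> E; rewrite -E; congr closed_span; apply/seteqP; split=> v [b [h]].
        by move=> vE; exists b, h.
      by move=> [_ vE]; exists b, h.
    have : closed_span [set v | exists b h, True /\ v = q b h] (q c0 (iota x0)).
      by apply: sub_closed_span; exists c0, (iota x0).
    by rewrite E0 q_embed /= => /eqP; rewrite (negbTE nz).
  - exact: q_act.
split.
  by have [a [h [_ ah]]] := nzd; exists a, h.
move=> M cM sM inv; have [M0 Mlin] := sM.
have [E0|ET] := span_invariant M.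
  left; apply/seteqP; split=> [m Mm|m ->] //=.
  apply: q_zero => c.
  have : closed_span [set v | exists b h, M h /\ v = q b h] (q c m).
    by apply: sub_closed_span; exists c, m.
  by rewrite E0.
right; apply/seteqP; split=> // g _.
have [m Mm orth] := projection_exists g cM sM.
suff /eqP : g - m = 0 by rewrite subr_eq0 => /eqP ->.
apply: q_zero => c; apply: hdot_eq0.
apply: (closed_subspace_orth (A := [set v | exists b h, M h /\ v = q b h])); last by rewrite ET.
move=> _ [b [h [Mh ->]]]; rewrite hdotC q_dot hdotC orth ?rmorph0 //; exact: inv.
Qed.

End Existence.

(** Some [b c^*] with [b], [c] in [B_t] acts nontrivially on some vector [k], and
    [B_{t^-1} (x) k] carries the representation that induces [rho]. *)
Theorem induced_exists (rho : representation B) : irreducible rho ->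
  restriction_nonzero rho (Dideal t) -> exists pi : representation B,
  [/\ irreducible pi, restriction_nonzero pi (Dideal t^-1%g) & is_induced t pi rho].
Proof.
move=> irr [d [h [Dd dh]]].
have [[b [c [k nz]]]|no] := pselect (exists b c k, rho (fmul (mulgV t) b (fstar erefl c)) k != 0).
  exact: (induced_exists_of_vector irr nz).
exfalso; have [ck sk _] := rep_ker_ideal rho.
have : rep_ker rho d.
  apply: (closed_span_sub ck sk _ Dd) => _ [b [c ->]] k.
  by apply: contrapT => /eqP nz; apply: no; exists b, c, k.
by move=> /(_ h) E; rewrite E eqxx in dh.
Qed.

End Induced.

(** * Order isomorphisms of lattices *)

Section OrderIsomorphism.
Variables (T U : Type) (L : (T -> Prop) -> Prop) (M : (U -> Prop) -> Prop)
  (f : (T -> Prop) -> (U -> Prop)).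
Hypotheses (latL : is_lattice L) (fL : forall A, L A -> M (f A))
  (f_le : forall A B, L A -> L B -> included (f A) (f B) <-> included A B)
  (f_surj : forall C, M C -> exists2 A, L A & f A = C).

Let f_meet A B S : L A -> L B -> is_meet L A B S -> is_meet M (f A) (f B) (f S).
Proof.
move=> LA LB [LS SA SB Sm]; split; [exact: fL|exact/f_le|exact/f_le|].
move=> _ /f_surj[S' LS' <-] /f_le S'A /f_le S'B.
by apply/f_le => //; apply: Sm => //; [exact: S'A|exact: S'B].
Qed.

Let f_join A B S : L A -> L B -> is_join L A B S -> is_join M (f A) (f B) (f S).
Proof.
move=> LA LB [LS SA SB Sm]; split; [exact: fL|exact/f_le|exact/f_le|].
move=> _ /f_surj[S' LS' <-] /f_le AS' /f_le BS'.
by apply/f_le => //; apply: Sm => //; [exact: AS'|exact: BS'].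
Qed.

Lemma lattice_isomorphism_of_order : lattice_isomorphism L M f.
Proof.
split=> //.
- move=> _ _ /f_surj[A LA <-] /f_surj[B LB <-].
  have [[S SM] [S' SJ]] := latL LA LB; split.
    by exists (f S); exact: f_meet.
  by exists (f S'); exact: f_join.
- move=> A B LA LB E; apply/funext => x; apply/propext; split.
    by apply: (f_le LA LB).1; rewrite E.
  by apply: (f_le LB LA).1; rewrite E.
Qed.

End OrderIsomorphism.

(** * Invariant ideals and invariant open sets *)

Section InvariantIdeals.
Variables (R : realType) (G : groupType) (B : fell_bundle R G).
Local Notation Be := (B 1%g).
Implicit Types (I J K : set Be) (x y : spectrum B).

Lemma ideal_bigcap (C : set Be -> Prop) : (forall I, C I -> ideal I) ->
  ideal [set a | forall I, C I -> I a].
Proof.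
move=> hC; split.
- apply/closed_nr => a ha I CI; have [_ _ _ _ Ic] := idealE (hC I CI).
  by apply: Ic => e e0; have [b hb ab] := ha e e0; exists b => //; exact: hb.
- split=> [I CI|c a b ha hb I CI]; have [I0 Il _ _ _] := idealE (hC I CI) => //.
  by apply: Il; [exact: ha|exact: hb].
- move=> a b hb; split=> I CI; have [_ _ Il Ir _] := idealE (hC I CI).
    by apply: Il; exact: hb.
  by apply: Ir; exact: hb.
Qed.

Lemma invariant_ideal_bigcap (C : set Be -> Prop) : (forall I, C I -> invariant_ideal I) ->
  invariant_ideal [set a | forall I, C I -> I a].
Proof.
move=> hC; have id : ideal [set a | forall I, C I -> I a].
  by apply: ideal_bigcap => I /hC[].
split=> // t a sa I CI; have [_ /(_ t)] := hC I CI; apply.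
apply: closed_span_sub sa; [exact: closed_span_closed|exact: closed_span_subspace|].
move=> _ [b [c [i [hi ->]]]]; apply: sub_closed_span; exists b, c, i; split=> //; exact: hi.
Qed.

Lemma invariant_ideal_lattice : is_lattice (@invariant_ideal R G B).
Proof.
move=> I J iI iJ; split.
  exists [set a | forall K, K = I \/ K = J -> K a]; split.
  - by apply: invariant_ideal_bigcap => K [->|->].
  - by move=> a; apply; left.
  - by move=> a; apply; right.
  - by move=> S' _ h1 h2 a Sa K [->|->]; [exact: h1|exact: h2].
exists [set a | forall K, [/\ invariant_ideal K, included I K & included J K] -> K a]; split.
- by apply: invariant_ideal_bigcap => K [].
- by move=> a Ia K [_ h _]; exact: h.
- by move=> a Ja K [_ _ h]; exact: h.
- by move=> S' iS h1 h2 a; apply.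
Qed.

(** ** Points of the spectrum and their kernels *)

Lemma unitary_equiv_ker (pi rho : representation B) a : unitary_equiv pi rho ->
  rep_ker pi a <-> rep_ker rho a.
Proof.
move=> [u [uiso usurj uint]]; split=> h k.
  by have [k' <-] := usurj k; rewrite -uint h linear0.
apply: hdot_eq0; rewrite -uiso uint h hdot0l //.
Qed.

Lemma unitary_equiv_refl (pi : representation B) : unitary_equiv pi pi.
Proof. by exists idfun; split=> // k; exists k. Qed.

Lemma spectrum_rep x : exists2 pi, irreducible pi & x pi.
Proof.
case: x => x [pi irr E]; exists pi => //.
by change (x pi); rewrite E; exact: unitary_equiv_refl.
Qed.

Lemma spectrum_of_rep (pi : representation B) : irreducible pi -> exists x : spectrum B, x pi.
Proof.
move=> irr.
have P : exists2 pi', irreducible pi' &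
    (fun rho => unitary_equiv pi rho) = (fun rho => unitary_equiv pi' rho) by exists pi.
exists (Spectrum P); exact: unitary_equiv_refl.
Qed.

Lemma spectrum_ker_eq x pi rho a : x pi -> x rho -> rep_ker pi a <-> rep_ker rho a.
Proof.
case: x => x [pi0 irr E] h1 h2.
change (x pi) in h1; change (x rho) in h2; rewrite E in h1 h2.
by rewrite -(unitary_equiv_ker a h1) -(unitary_equiv_ker a h2).
Qed.

Lemma class_kerE x pi : x pi -> class_ker x = rep_ker pi.
Proof.
move=> xpi; apply/seteqP; split=> a.
  by move=> [rho xrho]; exact: (spectrum_ker_eq a xrho xpi).1.
by move=> h; exists pi.
Qed.

Lemma restriction_nonzeroE (pi : representation B) J :
  restriction_nonzero pi J <-> ~ J `<=` rep_ker pi.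
Proof.
split=> [[a [h [Ja /eqP ah]]] JK|no]; first by apply: ah; exact: JK.
apply: contrapT => no'; apply: no => a Ja h.
by apply: contrapT => /eqP ah; apply: no'; exists a, h.
Qed.

Lemma XsetE J x : Xset J x <-> ~ J `<=` class_ker x.
Proof.
have [pi _ xpi] := spectrum_rep x; split=> [[rho xrho /restriction_nonzeroE]|].
  by rewrite -(class_kerE xrho).
by rewrite (class_kerE xpi) => /restriction_nonzeroE h; exists pi.
Qed.

Lemma not_Xset J x : ~ Xset J x -> J `<=` class_ker x.
Proof. by move=> h; apply: contrapT => /XsetE. Qed.

Lemma class_ker_ideal x : ideal (class_ker x).
Proof. by have [pi _ xpi] := spectrum_rep x; rewrite (class_kerE xpi); exact: rep_ker_ideal. Qed.

(** ** Open sets and ideals *)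

(** If [a] is in [I] and not in [J], a representation that separates [a] from [J]
    is a point of [X_I] outside [X_J]. *)
Lemma Xset_le I J : ideal J -> included (Xset I) (@Xset R G B J) <-> included I J.
Proof.
move=> iJ; split=> [h a Ia|IJ x /XsetE h]; last first.
  by apply/XsetE => JK; apply: h => a /IJ/JK.
apply: contrapT => Ja; have [pi [irr Jpi pia]] := irreducible_separation iJ Ja.
have [x xpi] := spectrum_of_rep irr.
have /XsetE : Xset J x by apply/h/XsetE; rewrite (class_kerE xpi) => /(_ a Ia).
by rewrite (class_kerE xpi).
Qed.

Lemma Xset_open J : spectrum_open (@Xset R G B J).
Proof.
exists [set P | Prim P /\ J `<=` P].
  apply/seteqP; split=> [P [PP JP]|P [PP FP]].
    by split=> // a; apply; split.
  by split=> // a Ja; apply: FP => Q [_ JQ]; exact: JQ.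
move=> x; split=> [/XsetE h [_ /h]//|h].
by apply/XsetE => JK; apply: h; split=> //; exists x.
Qed.

Definition ideal_of_open (O : spectrum B -> Prop) : set Be :=
  [set a | forall I, (exists2 x, ~ O x & I = class_ker x) -> I a].

Lemma ideal_of_open_ideal O : ideal (ideal_of_open O).
Proof. by apply: ideal_bigcap => _ [x _ ->]; exact: class_ker_ideal. Qed.

(** A point of [O] has a kernel that does not contain the intersection of the
    kernels of the points outside [O]: these lie in the closed set complementary
    to [O]. *)
Lemma Xset_ideal_of_open O : spectrum_open O -> Xset (ideal_of_open O) = O.
Proof.
move=> [F Fcl OF]; apply/funext => x; apply/propext; split=> [/XsetE h|Ox].
  apply: contrapT => nOx; apply: h => a; apply; by exists x.
apply/XsetE => h; move/OF: Ox; apply; rewrite Fcl; split; first by exists x.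
move=> a ha; apply: h => _ [y nOy ->].
have Fy : F (class_ker y) by apply: contrapT => /OF.
exact: ha.
Qed.

(** ** Invariance *)

Lemma ideal_preimage_l I d : ideal I ->
  closed [set a | I (emul a d)] /\ subspace [set a | I (emul a d)].
Proof.
move=> /idealE[I0 Ilin _ _ Ic]; split.
  apply/closed_nr => a ha; apply: Ic => e e0.
  have d1 : 0 < nr d + 1 by rewrite ltr_wpDl ?nr_ge0.
  have [b Ib ab] := ha _ (divr_gt0 e0 d1); exists (emul b d) => //.
  rewrite /emul -linearBl; apply: le_trans (nr_cmul (A := unit_fiber B) _ _) _.
  apply: le_trans (ler_wpM2r (nr_ge0 d) ab) _.
  by rewrite mulrAC ler_pdivrMr // ler_pM2l // lerDl ler01.
split=> [|c a b Ia Ib] /=; first by rewrite /emul linear0l.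
by rewrite /emul linearPl; exact: Ilin.
Qed.

Lemma ideal_preimage_r I d : ideal I ->
  closed [set a | I (emul d a)] /\ subspace [set a | I (emul d a)].
Proof.
move=> /idealE[I0 Ilin _ _ Ic]; split.
  apply/closed_nr => a ha; apply: Ic => e e0.
  have d1 : 0 < nr d + 1 by rewrite ltr_wpDl ?nr_ge0.
  have [b Ib ab] := ha _ (divr_gt0 e0 d1); exists (emul d b) => //.
  rewrite /emul -linearBr; apply: le_trans (nr_cmul (A := unit_fiber B) _ _) _.
  apply: le_trans (ler_wpM2l (nr_ge0 d) ab) _.
  by rewrite mulrA ler_pdivrMr // mulrC ler_pM2l // lerDl ler01.
split=> [|c a b Ia Ib] /=; first by rewrite /emul linear0r.
by rewrite /emul linearPr; exact: Ilin.
Qed.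

Lemma emulA (a b c : Be) : emul (emul a b) c = emul a (emul b c).
Proof. exact: fmulA. Qed.

Lemma ideal_span_mul2 I (S : set Be) : ideal I ->
  (forall d d', S d -> S d' -> I (emul d d')) ->
  forall d d', closed_span S d -> closed_span S d' -> I (emul d d').
Proof.
move=> iI h d d' Sd Sd'.
have [c1 s1] := ideal_preimage_l d' iI.
apply: (closed_span_sub c1 s1 _ Sd) => a Sa /=.
have [c2 s2] := ideal_preimage_r a iI.
by apply: (closed_span_sub c2 s2 _ Sd') => b Sb /=; exact: h.
Qed.

Lemma ideal_span_mul I (S : set Be) j : ideal I ->
  (forall d d', S d -> S d' -> I (emul d (emul j d'))) ->
  forall d d', closed_span S d -> closed_span S d' -> I (emul d (emul j d')).
Proof.
move=> iI h d d' Sd Sd'.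
have [c1 s1] := ideal_preimage_l (emul j d') iI.
apply: (closed_span_sub c1 s1 _ Sd) => a Sa /=; rewrite -emulA.
have [c2 s2] := ideal_preimage_r (emul a j) iI.
by apply: (closed_span_sub c2 s2 _ Sd') => b Sb /=; rewrite emulA; exact: h.
Qed.

Section Translate.
Variable t : G.
Implicit Types (b c : B t).

(** [c^* b] and [b c^*] for [b], [c] in [B_t]: generators of [D_{t^-1}] and [D_t]. *)
Local Notation lprod c b := (fmul (mulVg t) (fstar erefl c) b).
Local Notation rprod b c := (fmul (mulgV t) b (fstar erefl c)).
Local Notation translate b i c := (rprod (fmul (mulg1 t) b i) c).
Local Notation translateV c i b :=
  (fmul (mulVg t) (fmul (mulg1 t^-1%g) (fstar erefl c) i) b).

Lemma DidealVE : Dideal t^-1%g = closed_span [set d | exists b c, d = lprod c b].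
Proof.
congr closed_span; apply/seteqP; split=> _ [x [y ->]].
  exists (fstar (invgK t) y), (fstar (invgK t) x).
  by rewrite fstarKV (fmul_fstarr (invgK t) (mulVg t) (mulgV t^-1%g)).
exists (fstar erefl y), (fstar erefl x).
by rewrite -(fmul_fstarr (invgK t) (mulVg t)) fstarVK.
Qed.

Lemma translate_lprod c1 b1 i c2 b2 :
  fmul (mulVg t) (fstar erefl c1) (fmul (mul1g t) (translate b1 i c2) b2) =
  emul (lprod c1 b1) (emul i (lprod c2 b2)).
Proof.
rewrite (fmulA (mulgV t) (mul1g t) (mulVg t) (mulg1 t)).
rewrite (fmulA (mulg1 t) (mulg1 t) (mulg1 1%g) (mulg1 t)).
by rewrite /emul (fmulA (mulVg t) (mulg1 1%g) (mulg1 t) (mulVg t)).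
Qed.

Lemma translateV_rprod b1 c1 i b2 c2 :
  translate b1 (translateV c1 i b2) c2 = emul (rprod b1 c1) (emul i (rprod b2 c2)).
Proof.
rewrite (fmulA (mulg1 t) (mulgV t) (mul1g t^-1%g) (mulgV t)).
rewrite (fmulA (mulVg t) (mul1g t^-1%g) (mulgV t) (mulg1 t^-1%g)).
rewrite (fmulA (mulg1 t^-1%g) (mulg1 t^-1%g) (mulg1 1%g) (mulg1 t^-1%g)).
by rewrite /emul (fmulA (mulgV t) (mulg1 1%g) (mulg1 t^-1%g) (mulgV t)).
Qed.

Lemma lprod_rprod c1 b1 c2 b2 :
  fmul (mulVg t) (fstar erefl c1) (fmul (mul1g t) (rprod b1 c2) b2) =
  emul (lprod c1 b1) (lprod c2 b2).
Proof.
rewrite (fmulA (mulgV t) (mul1g t) (mulVg t) (mulg1 t)).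
by rewrite /emul (fmulA (mulVg t) (mulg1 1%g) (mulg1 t) (mulVg t)).
Qed.

Lemma invariant_translate J b i c : invariant_ideal J -> J i -> J (translate b i c).
Proof.
by move=> [_ /(_ t) inv] Ji; apply: inv; apply: sub_closed_span; exists b, c, i.
Qed.

Lemma Dideal_rprod b c : Dideal t (rprod b c).
Proof. by apply: sub_closed_span; exists b, c. Qed.

Lemma translate_Dideal b i c : Dideal t (translate b i c).
Proof. exact: Dideal_rprod. Qed.

Lemma induced_translate (pi rho : representation B) J b i c : is_induced t pi rho ->
  ideal J -> J `<=` rep_ker pi -> J i -> rep_ker rho (translate b i c).
Proof.
move=> ind /idealE[_ _ Jl Jr _] Jpi Ji; apply/(induced_kernel ind) => b' c' .
by rewrite translate_lprod; apply: Jpi; apply: Jl; apply: Jr.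
Qed.

End Translate.

Lemma invariant_translateV J t (b c : B t) i : invariant_ideal J -> J i ->
  J (fmul (mulVg t) (fmul (mulg1 t^-1%g) (fstar erefl c) i) b).
Proof.
move=> iJ Ji; have := invariant_translate (fstar erefl c) (fstar erefl b) iJ Ji.
by rewrite -(fmul_fstarr (invgK t) (mulVg t)) fstarVK.
Qed.

(** Three applications of [irreducible_ideal_vector] to a nonzero vector. The
    ideal [J] is placed between two factors of [D] in order to rewrite the
    product with the generators of [D_t]. *)
Lemma irreducible_prime (pi : representation B) (D J : set Be) : irreducible pi ->
  (forall d a, D d -> D (emul d a)) -> (forall j a, J j -> J (emul j a)) ->
  ~ D `<=` rep_ker pi -> ~ J `<=` rep_ker pi ->
  exists d i d', [/\ D d, J i, D d' & ~ rep_ker pi (emul d (emul i d'))].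
Proof.
move=> irr Dr Jr nD nJ.
have [[a [h [_ ah]]] _] := irr.
have h0 : h != 0 by apply: contraNneq ah => ->; rewrite linear0r.
have [d' Dd' h1] := irreducible_ideal_vector irr Dr nD h0.
have [i Ji h2] := irreducible_ideal_vector irr Jr nJ h1.
have [d Dd h3] := irreducible_ideal_vector irr Dr nD h2.
exists d, i, d'; split=> // /(_ h).
by rewrite !rep_mul => E; rewrite E eqxx in h3.
Qed.

Lemma Dideal_mulr t (d a : Be) : Dideal t d -> Dideal t (emul d a).
Proof.
move=> Dd; apply: (@closed_span_image R _ _ (fun d => emul d a) (nr a) _ _ _ _ _ _ _ Dd).
- by move=> c u v; rewrite /emul linearPl.
- by rewrite /emul linear0l.
- move=> u v; rewrite /emul -linearBl mulrC; exact: (nr_cmul (A := unit_fiber B)).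
- move=> _ [b [c ->]]; apply: sub_closed_span.
  exists b, (fmul (mul1g t) (estar a) c).
  have -> : fstar erefl (fmul (mul1g t) (estar a) c) =
      fmul (mulg1 t^-1%g) (fstar erefl c) (estar (estar a)) by exact: fstarM.
  have -> : estar (estar a) = a by exact: fstarK.
  exact: fmulA.
Qed.

(** If [rho] is induced from [pi], then [rho] kills [b i c^*] exactly when [pi]
    kills all [c'^* b i c^* b']. Invariance of [J] places [b i c^*] in [J], so that
    [rho] vanishing on [J] makes [pi] vanish on [D_{t^-1} J D_{t^-1}], and dually;
    primeness excludes this. That [rho] is nonzero on [D_t] follows in the same
    way, without the factor from [J]. *)
Lemma Xset_invariant J : invariant_ideal J ->
  partial_action_invariant (@hat_dom R G B) (@hat_alpha R G B) (Xset J).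
Proof.
move=> iJ t y; have [idJ _] := iJ; have [_ _ Jl Jr _] := idealE idJ.
rewrite /hat_dom invgK; split.
  move=> [x [/XsetE nJ /XsetE nD [_ [pi [rho [xpi yrho ind]]]]]].
  have [pi0 irr xpi0] := spectrum_rep x.
  rewrite (class_kerE xpi0) in nJ nD.
  have iK := rep_ker_ideal pi0.
  have kereq a : rep_ker pi a -> rep_ker pi0 a by exact: (spectrum_ker_eq a xpi xpi0).1.
  have Dr (u a : Be) : Dideal t^-1%g u -> Dideal t^-1%g (emul u a) by exact: Dideal_mulr.
  split; apply/XsetE; rewrite (class_kerE yrho) => sub.
    have [d [i [d' [Dd Ji Dd']]]] := irreducible_prime irr Dr (fun j a => Jr a j) nD nJ.
    apply; rewrite DidealVE in Dd Dd'.
    apply: (ideal_span_mul iK _ Dd Dd') => _ _ [b1 [c1 ->]] [b2 [c2 ->]].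
    rewrite -translate_lprod; apply: kereq; apply: (induced_kernel ind _).1.
    by apply: sub; exact: invariant_translate.
  have [d [d' [d'' [Dd Dd' _]]]] := irreducible_prime irr Dr Dr nD nD.
  have [_ _ _ Kr _] := idealE iK.
  apply; rewrite -emulA; apply: Kr; rewrite DidealVE in Dd Dd'.
  apply: (ideal_span_mul2 iK _ Dd Dd') => _ _ [b1 [c1 ->]] [b2 [c2 ->]].
  rewrite -lprod_rprod; apply: kereq; apply: (induced_kernel ind _).1.
  by apply: sub; exact: Dideal_rprod.
move=> [/XsetE nJ /XsetE nD].
have [rho irr yrho] := spectrum_rep y.
rewrite (class_kerE yrho) in nJ nD.
have [pi [irrpi piD ind]] : exists pi : representation B,
    [/\ irreducible pi, restriction_nonzero pi (Dideal t^-1%g) & is_induced t pi rho].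
  by apply: induced_exists => //; apply/restriction_nonzeroE.
have [x xpi] := spectrum_of_rep irrpi.
have domx : Xset (Dideal t^-1%g) x by exists pi.
exists x; split=> //; last by split=> //; exists pi, rho.
apply/XsetE; rewrite (class_kerE xpi) => sub.
have Dr (u a : Be) : Dideal t u -> Dideal t (emul u a) by exact: Dideal_mulr.
have [d [i [d' [Dd Ji Dd']]]] := irreducible_prime irr Dr (fun j a => Jr a j) nD nJ.
apply; apply: (ideal_span_mul (rep_ker_ideal rho) _ Dd Dd') => _ _ [b1 [c1 ->]] [b2 [c2 ->]].
rewrite -translateV_rprod; apply: (induced_translate _ _ ind idJ sub).
exact: invariant_translateV.
Qed.

(** Let [y] be a point outside [O]. Outside [X_t], [y] kills [b i c^*] since this is
    in [D_t]. In [X_t], [y] is the image of a point [x], which is outside [O] by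
    invariance; so [x] kills the ideal and [y] kills its translates. *)
Lemma ideal_of_open_invariant O : invariant_open O -> invariant_ideal (ideal_of_open O).
Proof.
move=> [Oop inv]; split=> [|t]; first exact: ideal_of_open_ideal.
have [cJ sJ Jmul] := ideal_of_open_ideal O.
apply: closed_span_sub => // _ [b [c [i [Ji ->]]]] _ [y nOy ->].
have [Dy|nDy] := pselect (hat_dom t^-1%g y); last first.
  apply: (not_Xset nDy); rewrite invgK; exact: translate_Dideal.
have [rho irr yrho] := spectrum_rep y; rewrite (class_kerE yrho).
have [pi [irrpi piD ind]] : exists pi : representation B,
    [/\ irreducible pi, restriction_nonzero pi (Dideal t^-1%g) & is_induced t pi rho].
  apply: induced_exists => //; apply/restriction_nonzeroE.
  by move: Dy; rewrite /hat_dom invgK => /XsetE; rewrite (class_kerE yrho).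
have [x xpi] := spectrum_of_rep irrpi.
have domx : hat_dom t x by exists pi.
have nOx : ~ O x.
  move=> Ox; apply: nOy; have [|//] := (inv t y).1.
  by exists x; split=> //; split=> //; exists pi, rho.
apply: (induced_translate _ _ ind (ideal_of_open_ideal O) _ Ji).
by move=> a; rewrite -(class_kerE xpi); apply; exists x.
Qed.

End InvariantIdeals.

Theorem proposition3p10 (R : realType) (G : groupType) (B : fell_bundle R G) :
  lattice_isomorphism (@invariant_ideal R G B) (@invariant_open R G B)
    (@Xset R G B).
Proof.
apply: lattice_isomorphism_of_order.
- exact: invariant_ideal_lattice.
- by move=> J iJ; split; [exact: Xset_open|exact: Xset_invariant].
- by move=> I J _ [iJ _]; exact: Xset_le.
- move=> O iO; exists (ideal_of_open O); first exact: ideal_of_open_invariant.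
  by apply: Xset_ideal_of_open; have [] := iO.
Qed.
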